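(* The following decision problem is undecidable (i.e., there is no algorithm that, on every input, halts and correctly answers it). Input: a set $S$ of $3$ polyhypercubes in $\mathbb{Z}^4$. Question: can $\mathbb{Z}^4$ be tiled by translated copies of tiles in $S$?
   Context: A tile in $\mathbb{Z}^n$ is a finite (non-empty) subset of $\mathbb{Z}^n$. Identifying $z\in\mathbb{Z}^n$ with the unit hypercube $\prod_{i=1}^n [z_i,z_i+1]\subset\mathbb{R}^n$, a tile is equivalently a finite union of such unit hypercubes, and tiling $\mathbb{Z}^n$ corresponds to tiling $\mathbb{R}^n$ by unions of unit hypercubes. A polyhypercube in $\mathbb{Z}^4$ is a connected tile: a finite non-empty set $P\subset\mathbb{Z}^4$ such that any two of its points are joined by a path in $P$ whose consecutive points differ by $\pm$ a standard basis vector (i.e., the corresponding unit hypercubes are joined facet-to-facet). Given a finite set $S$ of tiles in $\mathbb{Z}^n$, one says that $\mathbb{Z}^n$ can be tiled by translated copies of tiles in $S$ if there is a family of sets of the form $P+v$ with $P\in S$ and $v\in\mathbb{Z}^n$ that are pairwise disjoint and whose union is $\mathbb{Z}^n$. Only translations are allowed (no rotations or reflections), and not every tile of $S$ is required to be used. The input $S$ is given by explicitly listing the finitely many elements of each tile; the dimension and the number of tiles are fixed. *)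

(* Defs.v *)
From HB Require Import structures.
From mathcomp Require Import all_boot all_order all_algebra finmap.

Set Implicit Arguments.
Unset Strict Implicit.
Unset Printing Implicit Defensive.

Import GRing.Theory.

Local Open Scope fset_scope.
Local Open Scope ring_scope.

Definition adjacent (n : nat) : rel 'rV[int]_n := fun x y =>
  [exists i : 'I_n, (y == x + delta_mx 0 i) || (y == x - delta_mx 0 i)].

Definition polyhypercube (n : nat) (P : {fset 'rV[int]_n}) : Prop :=
  P != fset0 /\
  forall x y : 'rV[int]_n, x \in P -> y \in P ->
    exists s : seq 'rV[int]_n,
      [/\ path (@adjacent n) x s, last x s = y & {subset s <= P}].

Definition translate (n : nat) (P : {fset 'rV[int]_n}) (v : 'rV[int]_n) :
    {fset 'rV[int]_n} :=
  [fset x + v | x in P].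

Definition tileable (n : nat) (S : {fset {fset 'rV[int]_n}}) : Prop :=
  exists F : {fset 'rV[int]_n} -> Prop,
    [/\ forall A, F A ->
          exists (P : {fset 'rV[int]_n}) v, P \in S /\ A = translate P v,
        forall A B, F A -> F B -> A <> B -> [disjoint A & B]%fset
      & forall z : 'rV[int]_n, exists A, F A /\ z \in A].

(* Terms for the partial recursive functions.  Terms carry no arity: a term   *)
(* denotes one partial function for each length of the argument list, and is  *)
(* undefined at the lengths that do not suit it.  At each fixed length these  *)
(* are exactly the partial recursive functions of that arity.                 *)
Inductive recfun : Type :=
  | Zero
  | Succ
  | Proj of nat
  | Comp of recfun & seq recfun
  | Prec of recfun & recfun
  | Mu of recfun.

(* [eval f xs y]: the computation of f on xs halts with result y.  In         *)
(* [eval_Mu], h.+1 gives the nonzero values of f before its first zero, all   *)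
(* of which must be defined.                                                  *)
Inductive eval : recfun -> seq nat -> nat -> Prop :=
  | eval_Zero xs : eval Zero xs 0%N
  | eval_Succ x : eval Succ [:: x] x.+1
  | eval_Proj i xs : (i < size xs)%N -> eval (Proj i) xs (nth 0%N xs i)
  | eval_Comp f gs xs ys z :
      evals gs xs ys -> eval f ys z -> eval (Comp f gs) xs z
  | eval_Prec0 f g xs z : eval f xs z -> eval (Prec f g) (0%N :: xs) z
  | eval_PrecS f g m xs y z :
      eval (Prec f g) (m :: xs) y -> eval g [:: m, y & xs] z ->
      eval (Prec f g) (m.+1 :: xs) z
  | eval_Mu f xs m (h : nat -> nat) :
      (forall k, (k < m)%N -> eval f (k :: xs) (h k).+1) ->
      eval f (m :: xs) 0%N -> eval (Mu f) xs m
with evals : seq recfun -> seq nat -> seq nat -> Prop :=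
  | evals_nil xs : evals [::] xs [::]
  | evals_cons g gs xs y ys :
      eval g xs y -> evals gs xs ys -> evals (g :: gs) xs (y :: ys).

(* The decision problem whose inputs are the x with [input x], presented to   *)
(* the algorithm by any c with [code x c], and whose question is [Q x].  The  *)
(* answers "yes" and "no" are 1 and 0.  The behaviour of the algorithm on     *)
(* numbers that code no input is unconstrained.                               *)
Definition recursively_decidable (T : Type) (input : T -> Prop)
    (code : T -> nat -> Prop) (Q : T -> Prop) : Prop :=
  exists f : recfun, forall x c, input x -> code x c ->
    exists b : bool, eval f [:: c] b /\ (b <-> Q x).

Definition code_int (z : int) : nat :=
  match z with Posz m => m.*2 | Negz m => m.*2.+1 end.

Definition code_point (n : nat) (v : 'rV[int]_n) : nat :=
  CodeSeq.code [seq code_int (v 0 i) | i <- enum 'I_n].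

Definition code_listing (n : nat) (w : seq (seq 'rV[int]_n)) : nat :=
  CodeSeq.code [seq CodeSeq.code [seq code_point v | v <- t] | t <- w].

(* w lists, without repetition and in any order, the tiles of S, each one by  *)
(* listing its points without repetition and in any order.                    *)
Definition listing (n : nat) (S : {fset {fset 'rV[int]_n}})
    (w : seq (seq 'rV[int]_n)) : Prop :=
  let tiles := [seq [fset x in t] | t <- w] in
  [/\ all uniq w, uniq tiles & S =i tiles].

Definition code_tileset (n : nat) (S : {fset {fset 'rV[int]_n}}) (c : nat) :
    Prop :=
  exists w, listing S w /\ c = code_listing w.

(* Main.v *)
Require Import Defs.
From mathcomp Require Import all_boot all_order all_algebra finmap zify.
From Stdlib Require Import Classical ClassicalEpsilon.

(* A supposed decision procedure f yields a counter machine that, on input e,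
   applies f to the code of a set S_e of three tiles, and loops for ever exactly
   when the answer is "no".  Some e satisfies: Z^4 can be tiled by S_e if and
   only if this machine diverges on e.  This is a contradiction.

   In the plane, the bits of e are the horizontal and vertical neighbour
   relations of finitely many Wang tiles.  As in Robinson's tilings, they force
   crosses of all levels, the arms of a cross of level k + 1 running between its
   four children of level k.  The lines between the blocks of level k carry symbols;
   lines of level t and crosses of level j < t make up a space-time diagram of a
   one-dimensional automaton with t cells at time t.  A tile also records its
   level, truncated at e + 1, and the first e steps of the automaton increment
   the input register.  Thus the input e is not hardwired in the tiles, and e can
   be chosen after the automaton.

   In Z^4, the tile T fills a net over the plane, with arms in its slice z = 0;
   the tile A fills the meshes of the net, one for each 2 x 2 block of the planar
   configuration, and F fills what remains next to the arms.  The tile A may be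
   shifted along z and w.  Its shift along z selects the four symbols a of its
   block, and its facet facing the arm of a symbol a has a mark at w = 2^a, to be
   matched by the mark of the arm.  Two neighbouring meshes share two arms, so
   that the difference of two powers of 2 is the same for both, which determines
   the two symbols if they are distinct. *)

Set Implicit Arguments.
Unset Strict Implicit.
Unset Printing Implicit Defensive.
Import Order.TTheory GRing.Theory Num.Theory.
Local Open Scope fset_scope.
Local Open Scope ring_scope.

(** * Coloured cells as polyhypercubes *)

(** Only three shapes are available whatever the planar problem is, so its data must go into their
    sizes and into marks on their facets. Colours of facets are not part of a polyhypercube; they
    are realised by bumps and holes deep enough to force all copies onto a lattice. Diagonalisation
    replaces a reduction from the halting problem, so that no algorithm building Wang tiles from a
    machine is needed. The Wang tiles of the automaton exist, hence so does a number e whose bits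
    list their neighbour pairs; only the map from e to S_e has to be computable, and it is
    arithmetic on the bits of an arbitrary number. The threshold e + 1 is compared with the levels
    outside those bits. This breaks the circle between the automaton, which may not mention e, and
    e, which lists its tiles. A symbol of the planar problem is thus a triple: a tile number and two
    truncated levels. The two powers of 2 are distinct because no symbol is its own neighbour; as
    adjacent Wang tiles differ in a parity, this excludes no configuration. *)

Notation pt := 'rV[int]_4.
Notation ee i := (delta_mx 0 i : pt).

Lemma third (i j : 'I_4) : exists k : 'I_4, (k != i) && (k != j).
Proof.
have : [exists k : 'I_4, (k != i) && (k != j)].
  by case: i => [[|[|[|[|?]]]] ?] //; case: j => [[|[|[|[|?]]]] ?] //;
    apply/existsP; (exists (inord 0); rewrite -!val_eqE /= !inordK //; done)
    || (exists (inord 1); rewrite -!val_eqE /= !inordK //; done)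
    || (exists (inord 2); rewrite -!val_eqE /= !inordK //; done).
by move/existsP.
Qed.

Ltac mlia := repeat match goal with |- context [fun_of_matrix ?M ?i ?j] =>
  move: (fun_of_matrix M i j) => ? end; lia.

Section Macro.
Context (T : Type) (mem : T -> pt -> bool) (cp cm : T -> 'I_4 -> pt -> nat) (K : nat).
Context (cpK : forall t i c, (cp t i c <= K)%N) (cmK : forall t i c, (cm t i c <= K)%N).

(** Dents occupy lateral positions 3 to K + 5 and depths 0 and 1; the margins keep the dents of
    distinct facets of a cell disjoint and not even adjacent. *)
Definition side : int := (K + 8)%N.
Local Notation L := side.

(* Each cell becomes a cube of side L.  A facet of colour k on its low side has a
   reference hole of depth 2 at the position 3 and a hole of depth 1 at the
   position 5 + k; a facet of colour k on its high side has the matching bumps. *)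
Definition dent (k : nat) (i : 'I_4) (o : 'I_4 -> int) : bool :=
  ([forall l, (l != i) ==> (o l == 3)] && (o i <= 1))
  || ([forall l, (l != i) ==> (o l == 5 + k%:Z)] && (o i == 0)).

Definition inmacro (t : T) (v : pt) : bool :=
  let c : pt := \row_i divz (v 0 i) L in
  let o := fun i => modz (v 0 i) L in
  if mem t c then [forall i, mem t (c - ee i) || ~~ dent (cm t i c) i o]
  else [exists i, mem t (c - ee i) && dent (cp t i (c - ee i)) i o].

Definition mk (c : pt) (o : 'I_4 -> int) : pt := \row_i (c 0 i * L + o i).

Definition inbox (o : 'I_4 -> int) := forall i, 0 <= o i < L.

Definition body (t : T) (c : pt) (o : 'I_4 -> int) : bool :=
  mem t c && [forall i, mem t (c - ee i) || ~~ dent (cm t i c) i o].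

Definition bump (t : T) (c : pt) (i : 'I_4) (o : 'I_4 -> int) : bool :=
  [&& ~~ mem t c, mem t (c - ee i) & dent (cp t i (c - ee i)) i o].

Lemma eq_dent k i o o' : o =1 o' -> dent k i o = dent k i o'.
Proof.
move=> e; rewrite /dent !e; congr (_ && _ || _ && _); apply: eq_forallb => l; by rewrite e.
Qed.

Lemma dentP k i o : (k <= K)%N -> dent k i o ->
  [/\ o i <= 1, forall l, l != i -> 3 <= o l <= K%:Z + 5
    & forall l m, l != i -> m != i -> o l = o m].
Proof.
move=> kK; case/orP => /andP[/forallP h h1]; split.
- done.
- by move=> l /(implyP (h l)) /eqP ->; lia.
- by move=> l m /(implyP (h l)) /eqP -> /(implyP (h m)) /eqP ->.
- lia.
- by move=> l /(implyP (h l)) /eqP ->; lia.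
- by move=> l m /(implyP (h l)) /eqP -> /(implyP (h m)) /eqP ->.
Qed.

Lemma sideE : L = K%:Z + 8. Proof. by rewrite /side PoszD. Qed.
Opaque side.
Lemma Lgt0 : 0 < L. Proof. by rewrite sideE; lia. Qed.

Lemma mk_div c o : inbox o -> forall i, divz (mk c o 0 i) L = c 0 i.
Proof.
move=> ho i; rewrite mxE; have := ho i; have := Lgt0; move: (c 0 i) (o i) L => a b l h1 h2.
by rewrite divzMDl ?divz_small ?addr0 // ?gt_eqF //; lia.
Qed.

Lemma mk_mod c o : inbox o -> forall i, modz (mk c o 0 i) L = o i.
Proof.
move=> ho i; rewrite mxE; have := ho i; have := Lgt0; move: (c 0 i) (o i) L => a b l h1 h2.
by rewrite modzMDl modz_small //; lia.
Qed.

Lemma inmacro_mk t c o : inbox o ->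
  inmacro t (mk c o) = body t c o || [exists i, bump t c i o].
Proof.
move=> ho; rewrite /inmacro /body.
have -> : (\row_i divz (mk c o 0 i) L) = c by apply/rowP => i; rewrite mxE mk_div.
have hd k i : dent k i (fun i => modz (mk c o 0 i) L) = dent k i o.
  by apply: eq_dent => l; rewrite mk_mod.
case: ifP => h /=.
  rewrite [X in _ || X](_ : _ = false).
    by rewrite orbF; apply: eq_forallb => i; rewrite hd.
  by apply/negbTE/existsPn => i; rewrite /bump h.
by apply: eq_existsb => i; rewrite hd /bump h.
Qed.

Definition cdiv (v : pt) : pt := \row_i divz (v 0 i) L.
Definition cmod (v : pt) : 'I_4 -> int := fun i => modz (v 0 i) L.

Lemma cmod_box v : inbox (cmod v).
Proof. by move=> i; rewrite /cmod modz_ge0 ?gt_eqF ?Lgt0 //= ltz_pmod ?Lgt0. Qed.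

Lemma mkK v : v = mk (cdiv v) (cmod v).
Proof. by apply/rowP => i; rewrite !mxE -divz_eq. Qed.

Definition upd (o : 'I_4 -> int) (l : 'I_4) (x : int) : 'I_4 -> int :=
  fun m => if m == l then x else o m.

Lemma upd_box o l x : inbox o -> 0 <= x < L -> inbox (upd o l x).
Proof. by move=> ho hx m; rewrite /upd; case: ifP. Qed.

Lemma updE o l x : upd o l x l = x. Proof. by rewrite /upd eqxx. Qed.
Lemma updN o l x m : m != l -> upd o l x m = o m. Proof. by rewrite /upd => /negbTE ->. Qed.

Lemma mk_upd c o l (d : int) : mk c (upd o l (o l + d)) = mk c o + d *: ee l.
Proof.
apply/rowP => m; rewrite !mxE /upd eqxx /=; case: (m =P l) => [->|_] /=; lia.
Qed.

(* A body cell always has a neighbour of the body in each of the four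
   directions, so only the cells of a bump are isolated in three directions. *)
Lemma thick t c o l : inbox o -> body t c o ->
  exists d : int, [/\ (d == 1) || (d == -1), 0 <= o l + d < L
     & body t c (upd o l (o l + d))].
Proof.
move=> ho /andP[tc /forallP hb].
pose ed o' := [exists i, ~~ mem t (c - ee i) && dent (cm t i c) i o'].
have bE o' : ~~ ed o' -> body t c o'.
  move=> h; rewrite /body tc; apply/forallP => i.
  by move/existsPn: h => /(_ i); rewrite negb_and negbK.
have hol := ho l.
case: (ltrP (o l) (L - 1)) => hl; last first.
  exists (-1); split => //; first by move: hol; have := sideE; lia.
  apply/bE/existsPn => m; apply/negP => /andP[em /(dentP (cmK _ _ _))[h1 h2 _]].
  case: (l =P m) => [e|/eqP ne].
    by subst m; rewrite updE in h1; move: hl h1; have := sideE; lia.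
  by have := h2 _ ne; rewrite updE; move: hl; have := sideE; lia.
case he: (ed (upd o l (o l + 1))); last first.
  by exists 1; split; rewrite ?eqxx //; [move: hol hl; have := sideE; lia | apply/bE; rewrite he].
exists (-1); case/existsP: he => m /andP[em hd].
case: (l =P m) => [e|/eqP ne].
  (* A dent is open towards its facet: if it contains the next cell along its axis, it contains this
     one. *)
  subst m; exfalso; have := hb l; rewrite (negbTE em) /= => /negP; apply.
  case/orP: hd => /andP[/forallP h1 h2]; last by move: h2; rewrite updE; lia.
  apply/orP; left; apply/andP; split; last by move: h2; rewrite updE; lia.
  apply/forallP => i; apply/implyP => hi; have := h1 i; rewrite hi /= updN //.
have [h1 h2 h3] := dentP (cmK _ _ _) hd.
have := h2 _ ne; rewrite updE => hl3.
have hm : o m <= 1 by move: h1; rewrite updN 1?eq_sym.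
(* All lateral coordinates of a dent cell are equal. The coordinate [l2] has the value [o l + 1], so
   a step to [o l - 1] misses the dents on the axis [m]. *)
have [l2 /andP[n1 n2]] := third l m.
have e2 := h3 _ _ ne n2; rewrite updE updN // in e2.
split => //; first by move: hol hl; have := sideE; lia.
apply/bE/existsPn => m'; apply/negP => /andP[em' /(dentP (cmK _ _ _))[h1' h2' h3']].
have : m' = m.
  apply/eqP; apply: contraT => h; have := h2' m; rewrite eq_sym h => /(_ isT).
  by rewrite updN 1?eq_sym //; lia.
move=> e; subst m'; have := h3' _ _ ne n2; rewrite updE updN //; lia.
Qed.

Lemma body_free t c o : mem t c -> (forall k i, (k <= K)%N -> ~~ dent k i o) -> body t c o.
Proof. by move=> h1 h2; rewrite /body h1; apply/forallP => i; rewrite h2 ?orbT. Qed.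

Lemma free_ge2 o : (forall i, 2 <= o i) -> forall k i, (k <= K)%N -> ~~ dent k i o.
Proof. by move=> h k i kK; apply/negP => /(dentP kK)[+ _ _]; have := h i; lia. Qed.

Definition hole (s : int) (i : 'I_4) (b : int) : 'I_4 -> int :=
  fun l => if l == i then b else s.

Lemma hole_box s i b : 0 <= b < L -> 0 <= s < L -> inbox (hole s i b).
Proof. by move=> h1 h2 l; rewrite /hole; case: ifP. Qed.

Lemma hole_side s i b l (d : int) k j : (k <= K)%N -> l != i -> 3 <= s -> b <= 1 ->
  (d == 1) || (d == -1) ->  ~~ dent k j (upd (hole s i b) l (s + d)).
Proof.
move=> kK li s3 b1 hd; apply/negP => /(dentP kK)[h1 h2 h3].
have : j = i.
  apply/eqP; apply: contraT => h; have := h2 i; rewrite eq_sym h => /(_ isT).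
  by rewrite updN 1?eq_sym // /hole eqxx; lia.
move=> e; subst j; have [l2 /andP[n1 n2]] := third l i.
by have := h3 _ _ li n2; rewrite updE updN // /hole (negbTE n2); lia.
Qed.


Lemma bump_back0 t c i o : inbox o -> bump t c i o -> o i = 0 ->
  inbox (upd o i (L - 1)) /\ body t (c - ee i) (upd o i (L - 1)) /\
  mk c o - ee i = mk (c - ee i) (upd o i (L - 1)).
Proof.
move=> ho /and3P[h1 h2 h3] e; have [d1 d2 d3] := dentP (cpK _ _ _) h3.
split; first by apply: upd_box => //; have := sideE; lia.
split; last first.
  apply/rowP => m; rewrite !mxE /upd eqxx /=; case: (m =P i) => [->|_] /=; lia.
apply: body_free => // k j kK.
apply/negP => /(dentP kK)[+ _ _]; case: (j =P i) => [->|/eqP ne].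
  by rewrite updE; have := sideE; lia.
by rewrite updN //; have := d2 _ ne; lia.
Qed.

Lemma bump_back1 t c i o : inbox o -> bump t c i o -> o i = 1 ->
  inbox (upd o i 0) /\ bump t c i (upd o i 0) /\ mk c o - ee i = mk c (upd o i 0).
Proof.
move=> ho /and3P[h1 h2 h3] e1.
split; first by apply: upd_box => //; have := sideE; lia.
split; last first.
  apply/rowP => m; rewrite !mxE /upd eqxx /=; case: (m =P i) => [->|_] /=; lia.
rewrite /bump h1 h2 /=.
case/orP: h3 => /andP[/forallP g1 g2]; last by move/eqP: g2 => g2; lia.
apply/orP; left; rewrite updE /= andbT; apply/forallP => l; apply/implyP => li.
by have := g1 l; rewrite li updN.
Qed.

Lemma bump01 t c i o : inbox o -> bump t c i o -> o i = 0 \/ o i = 1.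
Proof.
by move=> ho /and3P[_ _ h3]; have [d1 _ _] := dentP (cpK _ _ _) h3; have := ho i; lia.
Qed.

Lemma bump_back t c i o : inbox o -> bump t c i o -> inmacro t (mk c o - ee i).
Proof.
move=> ho hb; case: (bump01 ho hb) => e.
  by have [h1 [h2 ->]] := bump_back0 ho hb e; rewrite inmacro_mk ?h2.
have [h1 [h2 ->]] := bump_back1 ho hb e; rewrite inmacro_mk //.
by apply/orP; right; apply/existsP; exists i.
Qed.

Definition adj (i : 'I_4) (a b : T * pt) : Prop :=
  if mem a.1 (a.2 + ee i) then b = (a.1, a.2 + ee i)
  else ~~ mem b.1 (b.2 - ee i) /\ cp a.1 i a.2 = cm b.1 i b.2.

Definition coloured (Phi : pt -> T * pt) : Prop :=
  (forall p, mem (Phi p).1 (Phi p).2) /\ (forall p i, adj i (Phi p) (Phi (p + ee i))).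

Definition cell_connected (t : T) : Prop := forall P : pt -> Prop,
  (exists c, mem t c /\ P c) ->
  (forall c i, mem t c -> mem t (c + ee i) -> (P c <-> P (c + ee i))) ->
  forall c, mem t c -> P c.

Context (mac : T -> {fset pt}) (macE : forall t v, (v \in mac t) = inmacro t v).
Context (S : {fset {fset pt}}) (SE : forall P, P \in S <-> exists t, P = mac t).
Context (conn : forall t, cell_connected t).

Lemma mem_translate (P : {fset pt}) v z : (z \in translate P v) = (z - v \in P).
Proof.
apply/imfsetP/idP => [[x xP ->]|h]; first by rewrite addrK.
by exists (z - v) => //; rewrite subrK.
Qed.

Lemma dent_uniq k k' i j o : (k <= K)%N -> (k' <= K)%N -> dent k i o -> dent k' j o -> i = j.
Proof.
move=> h h' /(dentP h)[h1 h2 _] /(dentP h')[h1' h2' _]; apply/eqP.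
by apply: contraT => ij; have := h2' _ ij; lia.
Qed.

(** * From a colouring of the lattice to a tiling *)

Section Forward.
Context (Phi : pt -> T * pt) (ok : coloured Phi).

(** Inside a tile [adj] can be followed in both directions, since its second alternative requires
    the lower cell to be absent. Connectedness then carries the label over the whole copy. *)
Lemma coherent p t c r : Phi p = (t, c) -> mem t r -> Phi (p + (r - c)) = (t, r).
Proof.
case: ok => ok1 ok2 e; move: r; apply: conn.
  exists c; rewrite subrr addr0; split => //; by have := ok1 p; rewrite e.
move=> d i td tdi; have -> : p + (d + ee i - c) = p + (d - c) + ee i by rewrite addrAC !addrA.
have := ok2 (p + (d - c)) i; rewrite /adj; split => h.
  by move: H; rewrite h /= tdi.
move: H; rewrite h /= addrK td; case: ifP => // _; last by case.
by case: (Phi _) => a b /= [-> /addIr ->].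
Qed.

Definition origin p : T * pt := ((Phi p).1, p - (Phi p).2).
Definition place (a : T * pt) : {fset pt} := translate (mac a.1) (L *: a.2).

Lemma mem_place a q o : inbox o ->
  (mk q o \in place a) = body a.1 (q - a.2) o || [exists i, bump a.1 (q - a.2) i o].
Proof.
move=> ho; rewrite mem_translate macE -inmacro_mk //; congr inmacro.
apply/rowP => i; rewrite !mxE; mlia.
Qed.

(** A point of a copy outside its body lies in a bump, and the matching colours make this bump a
    hole of the cell at the position [q]. Hence disjointness and covering are decided inside a
    single cell. *)
Lemma place_owner p q o : inbox o -> mk q o \in place (origin p) ->
  (origin p = origin q /\ body (Phi q).1 (Phi q).2 o) \/
  exists i, origin p = origin (q - ee i) /\ (~~ mem (Phi q).1 ((Phi q).2 - ee i))
    && dent (cm (Phi q).1 i (Phi q).2) i o.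
Proof.
move=> ho; rewrite mem_place // /origin /=; case e: (Phi p) => [t c] /=.
have pq (r : pt) : p + (r - (p - c) - c) = r by apply/rowP => i; rewrite !mxE; mlia.
case/orP => [hb|/existsP[i /and3P[h1 h2 h3]]].
  left; have := coherent e (proj1 (andP hb)); rewrite pq => -> /=; split => //.
  by congr pair; apply/rowP => i; rewrite !mxE; mlia.
right; exists i; have := coherent e h2.
have -> : p + (q - (p - c) - ee i - c) = q - ee i by apply/rowP => j; rewrite !mxE; mlia.
move=> e2; split; first by rewrite e2 /=; congr pair; apply/rowP => j; rewrite !mxE; mlia.
have := ok.2 (q - ee i) i; rewrite subrK e2 /adj /= subrK (negbTE h1).
by case=> -> <-.
Qed.

Lemma forward : tileable S.
Proof.
exists (fun A => exists p, A = place (origin p)); split.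
- move=> _ [p ->]; exists (mac (origin p).1), (L *: (origin p).2); split => //.
  by apply/SE; eexists.
- move=> _ _ [p ->] [p' ->] ne; apply/fdisjointP => z; rewrite {1}[z]mkK [z in z \notin _]mkK.
  move=> h; apply/negP => h'; apply: ne; congr place.
  have hb := cmod_box z.
  case: (place_owner hb h) => [[e b]|[i [e /andP[b1 b2]]]];
  case: (place_owner hb h') => [[e' b']|[i' [e' /andP[b1' b2']]]]; rewrite e e' //.
  + by move/andP: b => [_ /forallP/(_ i')]; rewrite (negbTE b1') b2'.
  + by move/andP: b' => [_ /forallP/(_ i)]; rewrite (negbTE b1) b2.
  + by rewrite (dent_uniq _ _ b2 b2').
- move=> z; rewrite {1}[z]mkK; move: (cdiv z) (cmod z) (cmod_box z) => q o ho.
  have [ok1 ok2] := ok.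
  case hb: (body (Phi q).1 (Phi q).2 o).
    exists (place (origin q)); split; first by exists q.
    by rewrite mem_place //= subKr hb.
  move: hb; rewrite /body ok1 /= => /negbT; rewrite negb_forall => /existsP[i].
  rewrite negb_or negbK => /andP[b1 b2].
  exists (place (origin (q - ee i))); split; first by eexists.
  rewrite mem_place //=; apply/orP; right; apply/existsP; exists i.
  have -> : q - (q - ee i - (Phi (q - ee i)).2) = (Phi (q - ee i)).2 + ee i.
    by apply/rowP => j; rewrite !mxE; mlia.
  have := ok2 (q - ee i) i; rewrite subrK /adj /bump addrK ok1; case: ifP => h.
    by move=> e; move: b1; rewrite e /= addrK ok1.
  by case=> _ ->.
Qed.

End Forward.

Definition vec (o : 'I_4 -> int) : pt := \row_i o i.

(** * From a tiling to a colouring: rigidity *)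

Section Backward.
Context (lab : pt -> T * pt).
Context (labP : forall z z', lab z' = lab z <-> inmacro (lab z).1 (z' - (lab z).2)).

(** The corner [b] is any point: that all cells of all copies lie on one lattice of mesh [side] is a
    conclusion, not an assumption. *)
Definition isbox (b : pt) (t : T) (c : pt) : Prop :=
  mem t c /\ exists z, lab z = (t, b - L *: c).

Lemma lab_body b t c o : isbox b t c -> inbox o ->
  (lab (b + vec o) = (t, b - L *: c) <-> body t c o).
Proof.
move=> [tc [z hz]] ho; rewrite -hz labP hz /=.
have -> : b + vec o - (b - L *: c) = mk c o by apply/rowP => i; rewrite !mxE; mlia.
rewrite inmacro_mk //; split => [/orP[//|/existsP[i /and3P[]]]|->//]; by rewrite tc.
Qed.

Lemma lab_free b t c o : isbox b t c -> inbox o ->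
  (forall k i, (k <= K)%N -> ~~ dent k i o) -> lab (b + vec o) = (t, b - L *: c).
Proof. by move=> hb ho hf; apply/lab_body => //; apply: body_free => //; case: hb. Qed.

(** By [thick] a body point has a neighbour of its own copy in every direction, so this point
    belongs to a bump. A bump is attached to its copy from behind, and the only direction left for
    that is [i]. *)
Lemma isolated z i :
  (forall l (d : int), l != i -> (d == 1) || (d == -1) -> lab (z + d *: ee l) <> lab z) ->
  lab (z + ee i) <> lab z ->
  exists c o, [/\ inbox o, z = (lab z).2 + mk c o, bump (lab z).1 c i o
    & lab (z - ee i) = lab z].
Proof.
move=> h1 h2; have : lab z = lab z by []; rewrite labP.
move ew : (z - (lab z).2) => w; rewrite [w]mkK; have := cmod_box w.
have : z = (lab z).2 + mk (cdiv w) (cmod w) by rewrite -mkK -ew addrC subrK.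
move: (cdiv w) (cmod w) => c o ez ho; rewrite inmacro_mk // => /orP[hb|/existsP[j hb]].
  have [l /andP[li _]] := third i i.
  have [d [hd hol hb']] := thick l ho hb.
  exfalso; apply: (h1 l d li hd); rewrite labP.
  have -> : z + d *: ee l - (lab z).2 = mk c (upd o l (o l + d)).
    by rewrite mk_upd {1}ez; apply/rowP => m; rewrite !mxE; mlia.
  by rewrite inmacro_mk ?hb' //; apply: upd_box.
have hz : lab (z - ee j) = lab z.
  rewrite labP; have -> : z - ee j - (lab z).2 = mk c o - ee j.
    by rewrite {1}ez; apply/rowP => m; rewrite !mxE; mlia.
  exact: bump_back.
have e : j = i.
  apply/eqP; apply: contraT => ji; exfalso; apply: (h1 j (-1) ji) => //.
  by rewrite scaleN1r.
by subst j; exists c, o.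
Qed.

Lemma vec_upd b o l (d : int) : b + vec o + d *: ee l = b + vec (upd o l (o l + d)).
Proof.
apply/rowP => m; rewrite !mxE /upd eqxx /=; case: (m =P l) => [->|_] /=; mlia.
Qed.

Lemma lab_neq b t c o : isbox b t c -> inbox o -> ~~ body t c o ->
  lab (b + vec o) <> (t, b - L *: c).
Proof. by move=> hb ho /negP h /lab_body - /(_ hb ho). Qed.

(** Holes must be filled. The inner end of the reference hole is isolated, so a bump of length two
    ends there; only reference bumps are that long, and its position puts both copies on the same
    lattice. The colour hole, filled by the same copy, then gives the equality of the colours. *)
Lemma back_step b t c i : isbox b t c -> ~~ mem t (c - ee i) ->
  exists t' c', [/\ isbox (b - L *: ee i) t' c', ~~ mem t' (c' + ee i)
    & cp t' i c' = cm t i c].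
Proof.
move=> hb hext; have sE := sideE.
pose a := (t, b - L *: c).
have hbx x y : 0 <= x <= 1 -> 3 <= y <= K%:Z + 5 -> inbox (hole y i x).
  by move=> hx hy; apply: hole_box; lia.
have sideq (s x : int) l (d : int) : 0 <= x <= 1 -> 3 <= s <= K%:Z + 5 ->
    l != i -> (d == 1) || (d == -1) ->
    lab (b + vec (hole s i x) + d *: ee l) = a.
  move=> hx hs li hd; rewrite vec_upd; have hsl : hole s i x l = s by rewrite /hole (negbTE li).
  rewrite hsl; apply: lab_free => //.
    by apply: upd_box; [apply: hbx | lia].
  by move=> k j kK; apply: hole_side => //; lia.
have h01 : 0 <= (1 : int) <= 1 by []. have h00 : 0 <= (0 : int) <= 1 by [].
have h33 : 3 <= (3 : int) <= K%:Z + 5 by lia.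
have nb (s x : int) : 0 <= x <= 1 -> 3 <= s <= K%:Z + 5 -> dent (cm t i c) i (hole s i x) ->
    lab (b + vec (hole s i x)) <> a.
  move=> hx hs hd; apply: lab_neq => //; first exact: hbx.
  by rewrite /body negb_and negb_forall; apply/orP; right; apply/existsP; exists i; rewrite (negbTE hext) negbK.
set z1 := b + vec (hole 3 i 1).
have n1 : lab z1 <> a.
  apply: nb => //; apply/orP; left; rewrite {2}/hole eqxx andbT; apply/forallP => l.
  by apply/implyP => li; rewrite /hole (negbTE li).
have [] := @isolated z1 i.
- by move=> l d li hd; rewrite sideq // => /esym /n1.
- have -> : lab (z1 + ee i) = a.
    rewrite -[ee i]scale1r vec_upd; apply: lab_free => //.
      by apply: upd_box; [apply: hbx | rewrite /hole eqxx; lia].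
    by apply: free_ge2 => m; rewrite /upd /hole eqxx; case: eqP => // ->.
  by move=> /esym /n1.
move=> c' [o' [ho' ez1 /and3P[m1 m2 m3] hz0]].
move: ez1 m1 m2 m3 hz0; case el : (lab z1) => [t' v'] /= ez1 m1 m2 m3 hz0.
have [d1 d2 d3] := dentP (cpK _ _ _) m3.
(* If [z1] were the first cell of a bump, the point behind it would be in the body of the new copy
   and have a lateral neighbour there; but the lateral neighbours at that depth belong to the old
   copy. *)
have o1 : o' i = 1.
  have := ho' i; case: (o' i =P 0) => e h0; last by lia.
  exfalso; have [l /andP[li _]] := third i i.
  have hb2 : inbox (upd o' i (L - 1)) by apply: upd_box => //; lia.
  have bd : body t' (c' - ee i) (upd o' i (L - 1)).
    apply: body_free => // k j kK; apply/negP => /(dentP kK)[+ _ _].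
    case: (j =P i) => [->|/eqP ne]; first by rewrite updE; lia.
    by rewrite updN //; have := d2 _ ne; lia.
  have [d [hd hol hb']] := thick l hb2 bd.
  have e1 : lab (z1 - ee i + d *: ee l) = lab z1.
    rewrite labP el /=.
    have -> : z1 - ee i + d *: ee l - v' = mk (c' - ee i) (upd (upd o' i (L - 1)) l (upd o' i (L - 1) l + d)).
      rewrite mk_upd {1}ez1; apply/rowP => m; rewrite !mxE /upd eqxx /=.
      case: (m =P i) => [->|_] /=; mlia.
    by rewrite inmacro_mk ?hb' //; apply: upd_box.
  apply: n1; rewrite -e1.
  have -> : z1 - ee i = b + vec (hole 3 i 0).
    apply/rowP => m; rewrite !mxE /hole eqxx /=; case: (m =P i) => [->|_] /=; mlia.
  exact: sideq.
have href l : l != i -> o' l = 3.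
  move=> li; case/orP: m3 => /andP[/forallP g1 g2]; last by move/eqP: g2; lia.
  by apply/eqP; have := g1 l; rewrite li.
have ev : v' = b - L *: c'.
  apply/rowP => m; move/rowP: ez1 => /(_ m); rewrite !mxE /hole.
  by case: (m =P i) => [->|/eqP ne]; [rewrite o1 | rewrite href //]; mlia.
have hbox' : isbox (b - L *: ee i) t' (c' - ee i).
  split => //; exists z1; rewrite el ev; congr pair; apply/rowP => m; rewrite !mxE; mlia.
exists t', (c' - ee i); rewrite subrK; split => //.
set k := cm t i c; have kK : (k <= K)%N by exact: cmK.
have h35 : 3 <= 5 + k%:Z <= K%:Z + 5 by lia.
pose z := b + vec (hole (5 + k%:Z) i 0).
have dk : dent k i (hole (5 + k%:Z) i 0).
  apply/orP; right; rewrite {2}/hole eqxx andbT; apply/forallP => l.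
  by apply/implyP => li; rewrite /hole (negbTE li).
have n2 : lab z <> a by apply: nb.
have [] := @isolated z i.
- by move=> l d li hd; rewrite sideq // => /esym /n2.
- have -> : lab (z + ee i) = a.
    rewrite -[ee i]scale1r vec_upd; apply: lab_free => //.
      by apply: upd_box; [apply: hbx | rewrite /hole eqxx; lia].
    move=> k' j kK'; apply/negP => hd; have [e1 e2 _] := dentP kK' hd.
    have ji : j = i.
      apply/eqP; apply: contraT => ji; move: e1; rewrite updN // /hole (negbTE ji); lia.
    subst j; case/orP: hd => /andP[/forallP g1 g2].
      have [l /andP[li _]] := third i i.
      by have := g1 l; rewrite li updN // /hole (negbTE li); lia.
    by move: g2; rewrite updE /hole eqxx.
  by move=> /esym /n2.
(* The filler of the colour hole continues backwards into the box just found, hence belongs to the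
   same copy. *)
move=> c'' [o'' [_ _ _ hz]].
have elz : lab z = (t', v').
  rewrite -hz; have -> : z - ee i = b - L *: ee i + vec (upd (hole (5 + k%:Z) i 0) i (L - 1)).
    apply/rowP => m; rewrite !mxE /upd /hole eqxx /=; case: (m =P i) => [->|_] /=; mlia.
  rewrite (lab_free hbox').
  + by congr pair; rewrite ev; apply/rowP => m; rewrite !mxE; mlia.
  + by apply: upd_box; [apply: hbx | lia].
  + move=> k' j kK'; apply/negP => /(dentP kK')[+ _ _].
    case: (j =P i) => [->|/eqP ne]; first by rewrite updE; lia.
    by rewrite updN // /hole (negbTE ne); lia.
have : lab z = lab z1 by rewrite el.
rewrite labP el /=.
have -> : z - v' = mk c' (hole (5 + k%:Z) i 0).
  by rewrite ev; apply/rowP => m; rewrite !mxE; mlia.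
rewrite inmacro_mk; last exact: hbx.
rewrite /body (negbTE m1) /= => /existsP[j /and3P[_ _ hd]].
have ji := dent_uniq (cpK _ _ _) kK hd dk; subst j.
have [l /andP[li _]] := third i i.
by case/orP: hd => /andP[/forallP/(_ l) + _]; rewrite li /hole (negbTE li) /=; lia.
Qed.


Definition box (b : pt) : Prop := exists t c, isbox b t c.

Lemma box_back b i : box b -> box (b - L *: ee i).
Proof.
move=> [t [c hb]]; case h : (mem t (c - ee i)).
  exists t, (c - ee i); case: hb => tc [z hz]; split => //; exists z.
  by rewrite hz; congr pair; apply/rowP => j; rewrite !mxE; mlia.
by have [|t' [c' [h1 _ _]]] := back_step hb (i := i); [rewrite h | exists t', c'].
Qed.

Lemma box_orth b (n : 'I_4 -> nat) : box b -> box (b - L *: (\row_i (n i)%:Z)).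
Proof.
move=> hb; suff H m : (m <= 4)%N -> box (b - L *: (\row_i (if (i < m)%N then n i else 0%N)%:Z)).
  have := H 4 isT; congr box; apply/rowP => i; rewrite !mxE ltn_ord //.
elim: m => [_|m IH hm].
  by rewrite (_ : (\row_i _) = 0) ?scaler0 ?subr0 //; apply/rowP => i; rewrite !mxE.
have {IH} := IH (ltnW hm); set b1 := b - _ => h1.
have H (k : nat) : box (b1 - L *: (k%:Z *: ee (Ordinal hm))).
  elim: k => [|k IHk]; first by rewrite scale0r scaler0 subr0.
  have := box_back (Ordinal hm) IHk; congr box; apply/rowP => j; rewrite !mxE; mlia.
have := H (n (Ordinal hm)); congr box; rewrite /b1; apply/rowP => j; rewrite !mxE eqxx /=.
rewrite [(j < m.+1)%N]ltnS [(j <= m)%N]leq_eqVlt -val_eqE /=; case: (eqVneq (val j) m) => [e|ne] /=; last by mlia.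
have -> : (j < m)%N = false by rewrite e ltnn.
have -> : j = Ordinal hm by apply: val_inj.
move: (n _) (fun_of_matrix _ _ _) L => x y z; lia.
Qed.

Lemma core_lab b t c o : isbox b t c -> inbox o -> (forall i, 2 <= o i) ->
  lab (b + vec o) = (t, b - L *: c).
Proof. by move=> hb ho h2; apply: lab_free => //; apply: free_ge2. Qed.

Lemma box_overlap b t c b' t' c' o o' : isbox b t c -> isbox b' t' c' ->
  inbox o -> inbox o' -> (forall i, 2 <= o i) -> (forall i, 2 <= o' i) ->
  b + vec o = b' + vec o' -> t = t' /\ b - L *: c = b' - L *: c'.
Proof.
move=> h h' ho ho' h2 h2' e; have := core_lab h ho h2; rewrite e (core_lab h' ho' h2').
by case.
Qed.

(** Boxes propagate backwards only, so in each coordinate the box that is ahead is moved back until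
    the two overlap. The shift by 4 leaves a common point with all offsets at least 2 in both boxes,
    where no dent can be; its label ties the two together. *)
Lemma box_align b b' : box b -> box b' -> exists w, b' = b + L *: w.
Proof.
move=> hb hb'; have sE := sideE.
pose q i := divz (b 0 i - b' 0 i + 4) L.
pose d i := modz (b 0 i - b' 0 i + 4) L - 4.
have dE i : b 0 i - b' 0 i = q i * L + d i.
  by have := divz_eq (b 0 i - b' 0 i + 4) L; rewrite /q /d; lia.
have dB i : - 4 <= d i < L - 4.
  have := ltz_pmod (b 0 i - b' 0 i + 4) Lgt0.
  by have := modz_ge0 (b 0 i - b' 0 i + 4) (lt0r_neq0 Lgt0); rewrite /d; lia.
pose n i : nat := if 0 <= q i then `|q i|%N else 0%N.
pose n' i : nat := if 0 <= q i then 0%N else `|q i|%N.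
have [t [c h1]] := box_orth n hb; have [t' [c' h2]] := box_orth n' hb'.
pose o i := if 0 <= d i then 2 else 2 - d i.
have [|||||_ e] := box_overlap h1 h2 (o := o) (o' := fun i => o i + d i).
- by move=> i; rewrite /o; have := dB i; case: ifP; lia.
- by move=> i; rewrite /o; have := dB i; case: ifP; lia.
- by move=> i; rewrite /o; case: ifP; lia.
- by move=> i; rewrite /o; case: ifP; lia.
- apply/rowP => i; rewrite !mxE; have := dE i; rewrite /n /n'.
  case: ifP => hq e.
    have -> : `|q i|%N%:Z = q i by lia.
    by move: e; move: (q i) (d i) (o i); mlia.
  have -> : `|q i|%N%:Z = - q i by lia.
  by move: e; move: (q i) (d i) (o i); mlia.
exists (c' - c + (\row_i (n' i)%:Z) - (\row_i (n i)%:Z)).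
apply/rowP => i; move/rowP: e => /(_ i); rewrite !mxE; mlia.
Qed.

Lemma mk_inj c c' o o' : inbox o -> inbox o' -> mk c o = mk c' o' -> c = c' /\ o =1 o'.
Proof.
move=> ho ho' e; split; first by apply/rowP => i; rewrite -(mk_div c ho) e mk_div.
by move=> i; rewrite -(mk_mod c ho) e mk_mod.
Qed.

Definition two : 'I_4 -> int := fun => 2.
Lemma two_box : inbox two. Proof. by move=> i; have := sideE; rewrite /two; lia. Qed.

(** A point with all offsets equal to 2 on the lattice of a known box cannot lie in a bump, whose
    depth is at most 1. So it lies in a box, and by alignment in the box at the expected place. *)
Lemma all_boxes : exists b, forall p, box (b + L *: p).
Proof.
have exbox z : (exists c o, [/\ inbox o, z = (lab z).2 + mk c o & isbox ((lab z).2 + L *: c) (lab z).1 c]) \/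
  exists c o i, [/\ inbox o, z = (lab z).2 + mk c o, o i <= 1 & isbox ((lab z).2 + L *: (c - ee i)) (lab z).1 (c - ee i)].
  have : lab z = lab z by []; rewrite labP.
  move ew : (z - (lab z).2) => w; rewrite [w]mkK; have := cmod_box w.
  have : z = (lab z).2 + mk (cdiv w) (cmod w) by rewrite -mkK -ew addrC subrK.
  move: (cdiv w) (cmod w) => c o ez ho; rewrite inmacro_mk // => /orP[/andP[tc _]|/existsP[j hb]].
    left; exists c, o; split => //; split => //; exists z.
    by rewrite addrK; case: (lab z).
  right; exists c, o, j; case/and3P: (hb) => h1 h2 h3; split => //.
    by have := bump01 ho hb; lia.
  by split => //; exists z; rewrite addrK; case: (lab z).
have [b0 hb0] : exists b, box b.
  by case: (exbox 0) => [[c [o [_ _ h]]]|[c [o [i [_ _ _ h]]]]]; eexists; do 2 eexists; exact: h.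
exists b0 => p; pose z := b0 + mk p two.
case: (exbox z) => [[c [o [ho ez hb]]]|[c [o [i [ho ez oi hb]]]]].
  have [w ew] := box_align hb0 (ex_intro _ _ (ex_intro _ _ hb)).
  have [e1 _] : p = w /\ two =1 o.
    apply: mk_inj => //; first exact: two_box.
    apply/rowP => j; move/rowP: ez => /(_ j); move/rowP: ew => /(_ j); rewrite !mxE.
    by rewrite /z ?mxE; mlia.
  by rewrite e1 -ew; do 2 eexists; exact: hb.
have [w ew] := box_align hb0 (ex_intro _ _ (ex_intro _ _ hb)).
have [_ /(_ i) e2] : p = w + ee i /\ two =1 o.
  apply: mk_inj => //; first exact: two_box.
  apply/rowP => j; move/rowP: ez => /(_ j); move/rowP: ew => /(_ j); rewrite !mxE.
  by rewrite /z ?mxE; mlia.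
by move: oi; rewrite -e2.
Qed.

Lemma isbox_uniq b t c t' c' : isbox b t c -> isbox b t' c' -> (t, c) = (t', c').
Proof.
move=> h h'; have [|||||->e] := box_overlap h h' (o := two) (o' := two) => //; try exact: two_box.
congr pair; apply/rowP => i; move/rowP: e => /(_ i); rewrite !mxE.
move=> e; have {}e : L * c 0 i = L * c' 0 i by move: e; mlia.
by apply: (mulfI (lt0r_neq0 Lgt0)).
Qed.

Lemma isbox_same b t c c' : isbox b t c -> mem t c' -> isbox (b + L *: (c' - c)) t c'.
Proof.
move=> [_ [z hz]] h; split => //; exists z; rewrite hz; congr pair.
by apply/rowP => i; rewrite !mxE; mlia.
Qed.

Lemma coloured_of_lab : exists Phi, coloured Phi.
Proof.
have [b hb] := all_boxes.
have hx p : exists a : T * pt, isbox (b + L *: p) a.1 a.2.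
  by have [t [c h]] := hb p; exists (t, c).
pose Phi p := proj1_sig (constructive_indefinite_description _ (hx p)).
have PhiP p : isbox (b + L *: p) (Phi p).1 (Phi p).2 by exact: (proj2_sig (constructive_indefinite_description _ (hx p))).
have Pu p t c : isbox (b + L *: p) t c -> Phi p = (t, c).
  by move=> h; have := isbox_uniq (PhiP p) h; case: (Phi p).
exists Phi; split => [p|p i]; first by case: (PhiP p).
rewrite /adj; case: ifP => h1.
  apply: Pu; have := isbox_same (PhiP p) h1; congr isbox.
  by apply/rowP => j; rewrite !mxE; mlia.
have h2 : ~~ mem (Phi (p + ee i)).1 ((Phi (p + ee i)).2 - ee i).
  apply/negP => h2; have := isbox_same (PhiP (p + ee i)) h2.
  set d := (Phi _).2.
  have -> : b + L *: (p + ee i) + L *: (d - ee i - d) = b + L *: p.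
    by apply/rowP => j; rewrite !mxE; mlia.
  move=> /Pu e; move: h1; rewrite e /= subrK; by case: (PhiP (p + ee i)) => ->.
split => //; have [t [c [h3 h4 h5]]] := back_step (PhiP (p + ee i)) h2.
have e : Phi p = (t, c).
  apply: Pu; move: h3; congr isbox; by apply/rowP => j; rewrite !mxE; mlia.
by rewrite e.
Qed.

End Backward.

Lemma backward : tileable S -> exists Phi, coloured Phi.
Proof.
move=> [F [F1 F2 F3]].
have F4 A : F A -> exists a : T * pt, A = translate (mac a.1) a.2.
  by case/F1 => P [v [/SE[t ->] ->]]; exists (t, v).
have [A0 [FA0 _]] := F3 0; have [a0 _] := F4 _ FA0.
(* The representation is chosen from the set [A] alone, so that two points have the same label
   exactly when they lie in the same copy. *)
pose rep A := epsilon (inhabits a0) (fun a => A = translate (mac a.1) a.2).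
have repP A : F A -> A = translate (mac (rep A).1) (rep A).2.
  by move/F4 => h; exact: (epsilon_spec (inhabits a0) _ h).
pose own z := proj1_sig (constructive_indefinite_description _ (F3 z)).
have ownP z : F (own z) /\ z \in own z by exact: (proj2_sig (constructive_indefinite_description _ (F3 z))).
apply: (@coloured_of_lab (fun z => rep (own z))) => z z'.
have [f1 f2] := ownP z; have [f1' f2'] := ownP z'.
rewrite -macE -mem_translate -repP //; split => [e|h].
  by rewrite (repP _ f1) -e -repP.
case: (eqVneq (own z) (own z')) => [->//|/eqP ne].
by have /fdisjointP/(_ _ h) := F2 _ _ f1 f1' ne; rewrite f2'.
Qed.

Theorem tileable_coloured : tileable S <-> exists Phi, coloured Phi.
Proof. by split; [exact: backward | case=> Phi; exact: forward]. Qed.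

(** * Connectedness of the tiles *)

Section Connected.
Context (t : T).

Definition joined (x y : pt) : Prop := exists s : seq pt,
  [/\ path (@adjacent 4) x s, last x s = y & {subset s <= mac t}].

Definition joint x y := joined x y /\ joined y x.

Lemma joined_trans x y z : joined x y -> joined y z -> joined x z.
Proof.
move=> [s [h1 h2 h3]] [s' [h1' h2' h3']]; exists (s ++ s'); split.
- by rewrite cat_path h1 h2.
- by rewrite last_cat h2.
- by move=> u; rewrite mem_cat => /orP[/h3|/h3'].
Qed.

Lemma joint_refl x : joint x x.
Proof. by split; exists [::]. Qed.

Lemma joint_trans x y z : joint x y -> joint y z -> joint x z.
Proof. by move=> [h1 h2] [h3 h4]; split; [exact: joined_trans h1 h3 | exact: joined_trans h4 h2]. Qed.

Lemma joint_sym x y : joint x y -> joint y x.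
Proof. by case. Qed.

Lemma joint_step x i : x \in mac t -> x - ee i \in mac t -> joint x (x - ee i).
Proof.
move=> h1 h2; split; [exists [:: x - ee i] | exists [:: x]]; split => //=.
- by rewrite andbT; apply/existsP; exists i; rewrite eqxx orbT.
- by move=> u; rewrite inE => /eqP ->.
- by rewrite andbT; apply/existsP; exists i; rewrite subrK eqxx.
- by move=> u; rewrite inE => /eqP ->.
Qed.

Lemma mac_body c o : inbox o -> body t c o -> mk c o \in mac t.
Proof. by move=> ho hb; rewrite macE inmacro_mk // hb. Qed.

Lemma joint_upd c o i x : inbox o -> inbox (upd o i x) -> body t c o -> body t c (upd o i x) ->
  x = o i + 1 \/ x = o i - 1 -> joint (mk c o) (mk c (upd o i x)).
Proof.
move=> h1 h2 b1 b2 [e|e]; subst x.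
  have e : mk c o = mk c (upd o i (o i + 1)) - ee i by rewrite mk_upd scale1r addrK.
  by apply: joint_sym; rewrite e; apply: joint_step; rewrite -?e; apply: mac_body.
have e : mk c (upd o i (o i - 1)) = mk c o - ee i by rewrite mk_upd scaleN1r.
by rewrite e; apply: joint_step; rewrite -?e; apply: mac_body.
Qed.

(** Moving away from a low facet never enters a hole: along the axis of a hole one would already be
    inside it, and sideways the new coordinate, at most 2, is below every lateral position. *)
Lemma body_up c o i : inbox o -> body t c o -> o i < 2 -> body t c (upd o i (o i + 1)).
Proof.
move=> ho /andP[tc /forallP hb] oi; rewrite /body tc; apply/forallP => m.
rewrite -implyNb; apply/implyP => em; apply/negP => hd.
have [h1 h2 h3] := dentP (cmK _ _ _) hd; have hoi := ho i.
case: (i =P m) => [e|/eqP ne]; last by have := h2 _ ne; rewrite updE; lia.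
subst m; rewrite updE in h1; have := hb i; rewrite (negbTE em) /= => /negP; apply.
case/orP: hd => /andP[/forallP g1 g2]; last by move: g2; rewrite updE; lia.
apply/orP; left; apply/andP; split; last by lia.
by apply/forallP => l; apply/implyP => li; have := g1 l; rewrite li updN.
Qed.

Lemma joint_ext c o o' : o =1 o' -> joint (mk c o) (mk c o').
Proof.
move=> e; rewrite (_ : mk c o' = mk c o); first exact: joint_refl.
by apply/rowP => i; rewrite !mxE e.
Qed.

(** Descent on the distance to the hub [two]. Coordinates below 2 are raised first; once all are at
    least 2 no hole is in the way and the others can be lowered. *)
Lemma body_joint c o : inbox o -> body t c o -> joint (mk c o) (mk c two).
Proof.
move=> ho hb; have sE := sideE.
move en : (\sum_i `|(o i - 2)|)%N => n; elim: n o ho hb en => [|n IH] o ho hb en.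
  apply: joint_ext => i; move/eqP: en; rewrite sum_nat_eq0 => /forallP/(_ i) /=.
  by rewrite /two; lia.
have hm i x : (`|x - 2| + 1 = `|o i - 2|)%N -> (\sum_j `|upd o i x j - 2|)%N = n.
  move=> hx; move: en; rewrite (bigD1 i) //= [in X in _ -> X](bigD1 i) //= updE.
  rewrite [in X in _ -> X](eq_bigr (fun j => `|o j - 2|%N)); first by lia.
  by move=> j ji; rewrite updN.
case: (altP (@existsP _ (fun i => o i < 2))) => [[i oi]|].
  have hoi := ho i; have b' := body_up ho hb oi.
  have ho' : inbox (upd o i (o i + 1)) by apply: upd_box => //; lia.
  apply: joint_trans (IH _ ho' b' _); first by apply: joint_upd => //; left.
  by apply: hm; lia.
move/existsPn => h2; have tc : mem t c by case/andP: hb.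
case: (altP (@existsP _ (fun i => 2 < o i))) => [[i oi]|/existsPn h3].
  have hoi := ho i.
  have ho' : inbox (upd o i (o i - 1)) by apply: upd_box => //; lia.
  have b' : body t c (upd o i (o i - 1)).
    apply: body_free => //; apply: free_ge2 => j; rewrite /upd; case: ifP => _; first by lia.
    by have := h2 j; lia.
  apply: joint_trans (IH _ ho' b' _); first by apply: joint_upd => //; right.
  by apply: hm; lia.
move: en; rewrite big1 // => i _; have := h2 i; have := h3 i; lia.
Qed.

Lemma hub_joint c i : mem t c -> mem t (c + ee i) -> joint (mk c two) (mk (c + ee i) two).
Proof.
move=> h1 h2; have sE := sideE.
have hb1 : inbox (upd two i (L - 1)) by apply: upd_box; [exact: two_box | lia].
have hb2 : inbox (upd two i 0) by apply: upd_box; [exact: two_box | lia].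
have b1 : body t c (upd two i (L - 1)).
  apply: body_free => //; apply: free_ge2 => j; rewrite /upd /two; case: ifP => _; lia.
have b2 : body t (c + ee i) (upd two i 0).
  rewrite /body h2; apply/forallP => m; case: (m =P i) => [->|/eqP mi]; first by rewrite addrK h1.
  apply/orP; right; apply/negP => /(dentP (cmK _ _ _))[+ _ _]; rewrite updN //.
apply: joint_trans (joint_sym (body_joint hb1 b1)) _.
apply: joint_trans _ (body_joint hb2 b2); apply: joint_sym.
have e : mk c (upd two i (L - 1)) = mk (c + ee i) (upd two i 0) - ee i.
  by apply/rowP => m; rewrite !mxE /upd eqxx /=; case: (m =P i) => [->|_] /=; mlia.
by rewrite e; apply: joint_step; rewrite -?e; apply: mac_body.
Qed.

Lemma macro_polyhypercube : (exists c, mem t c) -> polyhypercube (mac t).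
Proof.
move=> [c0 tc0].
have hub_body c : mem t c -> body t c two by move=> h; apply: body_free => //; exact: free_ge2.
split.
  apply/fset0Pn; exists (mk c0 two); apply: mac_body; [exact: two_box | exact: hub_body].
have H c : mem t c -> joint (mk c0 two) (mk c two).
  apply: (@conn t (fun c => joint (mk c0 two) (mk c two))).
    by exists c0; split => //; exact: joint_refl.
  move=> d i td tdi; split => h; apply: (joint_trans h); first exact: hub_joint.
  by apply: joint_sym; exact: hub_joint.
have H0 x : x \in mac t -> joint x (mk c0 two).
  rewrite macE [x]mkK; have := cmod_box x; move: (cdiv x) (cmod x) => c o ho.
  rewrite inmacro_mk // => /orP[hb|/existsP[i hb]].
    apply: joint_trans (body_joint ho hb) _; apply: joint_sym; apply: H; by case/andP: hb.
  have mb o' : inbox o' -> bump t c i o' -> mk c o' \in mac t.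
    by move=> ho' hb'; rewrite macE inmacro_mk //; apply/orP; right; apply/existsP; exists i.
  have Hb0 o' : inbox o' -> bump t c i o' -> o' i = 0 -> joint (mk c o') (mk c0 two).
    move=> ho' hb' e; have [h1 [h2 h3]] := bump_back0 ho' hb' e.
    apply: joint_trans (joint_step (i := i) (mb _ ho' hb') _) _; first by rewrite h3; exact: mac_body.
    rewrite h3; apply: joint_trans (body_joint h1 h2) _; apply: joint_sym; apply: H; by case/andP: h2.
  case: (bump01 ho hb) => e; first exact: Hb0.
  have [h1 [h2 h3]] := bump_back1 ho hb e.
  apply: joint_trans (joint_step (i := i) (mb _ ho hb) _) _; first by rewrite h3; exact: mb.
  by rewrite h3; apply: Hb0; rewrite ?updE.
by move=> x y /H0 hx /H0 hy; case: (joint_trans hx (joint_sym hy)).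
Qed.

End Connected.
End Macro.

(** * Reading a planar configuration off a tiling by three tiles *)

Local Open Scope nat_scope.

Variant kind := KA | KT | KF.

Record cell := Cell { knd : kind; cx : nat; cy : nat; cz : nat; cw : nat }.

(* For the residues a mod 5 and b mod 4 of the coordinates x and y: rcls is the
   net, filled by KT; qcls are the places of the arms, filled by KT at z = 0 and by
   KF elsewhere; KA fills the meshes. *)
Definition rcls a b := (a == 0) || (b == 0).
Definition qcls a b := ((a == 2) || (a == 4)) && ((b == 1) || (b == 3)).

Lemma int_line (P : int -> Prop) y0 : P y0 -> (forall y, P y -> P (y + 1)%R) ->
  (forall y, P y -> P (y - 1)%R) -> forall y, P y.
Proof.
move=> h0 hp hm y.
have Hp (k : nat) : P (y0 + k%:Z)%R.
  by elim: k => [|k IH]; [rewrite addr0 | rewrite intS addrCA addrC; apply: hp].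
have Hm (k : nat) : P (y0 - k%:Z)%R.
  elim: k => [|k IH]; first by rewrite subr0.
  have := hm _ IH; congr P; lia.
case: (lerP y0 y) => h.
  by have := Hp `|(y - y0)%R|%N; congr P; lia.
by have := Hm `|(y0 - y)%R|%N; congr P; lia.
Qed.

(** Binary expansions are unique; the induction halves both sides, a parity argument settling the
    cases with a zero exponent. *)
Lemma pow2_pairs a b c d : 2 ^ a + 2 ^ d = 2 ^ c + 2 ^ b ->
  (a = c /\ d = b) \/ (a = b /\ d = c).
Proof.
have pos m : 0 < 2 ^ m by rewrite expn_gt0.
elim: a b c d => [|a IH] b c d.
  case: d => [|d].
    case: c => [|c]; case: b => [|b]; rewrite ?[2 ^ _.+1]expnS ?expn0 => h.
    - by left.
    - have := pos b; lia.
    - have := pos c; lia.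
    - have := pos b; have := pos c; lia.
  case: c => [|c]; case: b => [|b]; rewrite ?[2 ^ _.+1]expnS ?expn0 => h.
  - have := pos d; lia.
  - left; split => //; apply/eqP; rewrite eqSS -(eqn_exp2l _ _ (ltnSn 1)); lia.
  - right; split => //; apply/eqP; rewrite eqSS -(eqn_exp2l _ _ (ltnSn 1)); lia.
  - lia.
case: d => [|d].
  case: c => [|c]; case: b => [|b]; rewrite ?[2 ^ _.+1]expnS ?expn0 => h.
  - have := pos a; lia.
  - right; split => //; apply/eqP; rewrite eqSS -(eqn_exp2l _ _ (ltnSn 1)); lia.
  - left; split => //; apply/eqP; rewrite eqSS -(eqn_exp2l _ _ (ltnSn 1)); lia.
  - lia.
case: c => [|c]; case: b => [|b]; rewrite ?[2 ^ _.+1]expnS ?expn0 => h.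
- have := pos a; have := pos d; lia.
- lia.
- lia.
- by case: (IH b c d) => [|[-> ->]|[-> ->]]; [lia | left | right].
Qed.

Section Tiles.
Context (n : nat) (HR VR : nat -> nat -> bool).

Definition height := n ^ 4.
(** Marks are at most 3 * 2 ^ n, so a sum of two of them is below the width 8 * 2 ^ n: a congruence
    between such sums is an equality. *)
Definition width := 2 ^ (n + 3).

(** A slice z of the tile A stands for a 2 x 2 block: its four digits in base n are the symbols at
    the corners (0, 0), (1, 0), (0, 1) and (1, 1). *)
Definition dg1 z := z %/ n ^ 3.
Definition dg2 z := z %/ n ^ 2 %% n.
Definition dg3 z := z %/ n %% n.
Definition dg4 z := z %% n.
Definition okblock z :=
  [&& HR (dg1 z) (dg2 z), HR (dg3 z) (dg4 z), VR (dg1 z) (dg3 z) & VR (dg2 z) (dg4 z)].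
(** In a block that violates a neighbour relation one mark is raised to 3 * 2 ^ n, which no powers
    of 2 below 2 ^ n can balance. *)
Definition alpha a b z :=
  if b == 1 then if a == 2 then if okblock z then 2 ^ dg1 z else 3 * 2 ^ n else 2 ^ dg2 z
  else if a == 2 then 2 ^ dg3 z else 2 ^ dg4 z.

(** T has its node at the coordinates (1, 1), whence the shift by one. F is given the residues of
    one arm place but fits all four, since the colours around arm places do not mention residues. *)
Definition clsx s := match knd s with KA => cx s | KT => (cx s + 4) %% 5 | KF => 2 end.
Definition clsy s := match knd s with KA => cy s | KT => (cy s + 3) %% 4 | KF => 1 end.

Definition memC s := [&& cz s < height, cw s < width &
  match knd s with
  | KA => [&& 0 < cx s < 5, 0 < cy s < 4 & ~~ qcls (cx s) (cy s)]
  | KT => [&& cx s < 5, cy s < 4 &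
     rcls (clsx s) (clsy s) || qcls (clsx s) (clsy s) && (cz s == 0)]
  | KF => [&& cx s == 0, cy s == 0 & cz s == 0] end].

(** Colours 0 and 1 are a marked and an unmarked facet and 2 is neutral, around arm places. The
    others, up to 42, name the residues of the place on the upper side of the facet; their last bit
    compares phases: whether z = 0 inside the net and along w, whether w = 0 along z. *)
Definition code_cls a b (t : bool) := 3 + 2 * (5 * b + a) + t.

Definition holec (t : bool) : nat := ~~ t.

Definition cp0 s := let a := clsx s in let b := clsy s in let a' := (a + 1) %% 5 in
  if qcls a' b then holec (cw s == alpha a' b (cz s))
  else if qcls a b then 2 else code_cls a' b [&& rcls a b, rcls a' b & cz s == 0].
Definition cm0 s := let a := clsx s in let b := clsy s in let a' := (a + 4) %% 5 in
  if qcls a b then holec (cw s == 0)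
  else if qcls a' b then 2 else code_cls a b [&& rcls a b, rcls a' b & cz s == 0].
Definition cp1 s := let a := clsx s in let b := clsy s in let b' := (b + 1) %% 4 in
  if qcls a b || qcls a b' then 2 else code_cls a b' [&& rcls a b, rcls a b' & cz s == 0].
Definition cm1 s := let a := clsx s in let b := clsy s in let b' := (b + 3) %% 4 in
  if qcls a b || qcls a b' then 2 else code_cls a b [&& rcls a b, rcls a b' & cz s == 0].
Definition c2 s := let a := clsx s in let b := clsy s in
  if qcls a b then 2 else code_cls a b (cw s == 0).
Definition c3 s := let a := clsx s in let b := clsy s in
  if qcls a b then 2 else code_cls a b (cz s == 0).

Definition sx s := Cell (knd s) (cx s).+1 (cy s) (cz s) (cw s).
Definition sy s := Cell (knd s) (cx s) (cy s).+1 (cz s) (cw s).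
Definition sz s := Cell (knd s) (cx s) (cy s) (cz s).+1 (cw s).
Definition sw s := Cell (knd s) (cx s) (cy s) (cz s) (cw s).+1.

(* Adjacency of s and t along a direction where [up] is the shift inside a
   tile and p and q are the colours of the two facets that meet. *)
Definition adjC (up : cell -> cell) (p q : cell -> nat) s t : Prop :=
  if memC (up s) then t = up s else (forall u, up u = t -> ~~ memC u) /\ p s = q t.

Definition coloured4 (f : int -> int -> int -> int -> cell) : Prop := forall X Y Z W,
  [/\ memC (f X Y Z W),
      adjC sx cp0 cm0 (f X Y Z W) (f (X + 1)%R Y Z W),
      adjC sy cp1 cm1 (f X Y Z W) (f X (Y + 1)%R Z W),
      adjC sz c2 c2 (f X Y Z W) (f X Y (Z + 1)%R W) &
      adjC sw c3 c3 (f X Y Z W) (f X Y Z (W + 1)%R)].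

Definition sft : Prop := exists c : int -> int -> nat, forall i j,
  [/\ c i j < n, HR (c i j) (c (i + 1)%R j) & VR (c i j) (c i (j + 1)%R)].

Lemma cls_lt s : memC s -> (clsx s < 5) /\ (clsy s < 4).
Proof. by rewrite /memC /clsx /clsy; case: s => [[]] x y z w /=; lia. Qed.

Definition nonq s := ~~ qcls (clsx s) (clsy s).

Lemma code_cls_inj a b t a' b' t' : a < 5 -> a' < 5 ->
  code_cls a b t = code_cls a' b' t' -> [/\ a = a', b = b' & t = t'].
Proof. by rewrite /code_cls; case: t; case: t' => /= *; split => //; lia. Qed.

Lemma holec_code t a b t' : holec t <> code_cls a b t'.
Proof. by rewrite /holec /code_cls; case: t; lia. Qed.

Lemma two_code a b t : 2 <> code_cls a b t.
Proof. rewrite /code_cls; lia. Qed.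

Lemma mod5lt x : x %% 5 < 5. Proof. exact: ltn_pmod. Qed.

Lemma fwd0 s t : memC s -> memC t -> adjC sx cp0 cm0 s t -> nonq s ->
  ~~ qcls ((clsx s + 1) %% 5) (clsy s) ->
  [/\ clsx t = (clsx s + 1) %% 5, clsy t = clsy s &
     rcls (clsx s) (clsy s) -> rcls (clsx t) (clsy t) -> (cz s == 0) = (cz t == 0)].
Proof.
move=> ms mt; have [s1 s2] := cls_lt ms; have [t1 t2] := cls_lt mt.
rewrite /adjC; case: ifP => h.
  move=> -> ns _; have [-> ->] : clsx (sx s) = (clsx s + 1) %% 5 /\ clsy (sx s) = clsy s; last by [].
  move: ms h ns; rewrite /memC /nonq /clsx /clsy /sx.
  by case: s {s1 s2} => [[]] x y z w /=; rewrite /qcls; lia.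
case=> _; rewrite /cp0 /cm0 /nonq => e h1 h2; move: e.
rewrite (negbTE h1) (negbTE h2); case: ifP => _; first by move=> h0; case: (holec_code (esym h0)).
case: ifP => _; first by move=> h0; case: (two_code (esym h0)).
case/(code_cls_inj (mod5lt _) t1) => e1 e2 e3; rewrite -e1 -e2 in e3 *; split => // r1 r2.
move: e3; rewrite r1 r2 /=; have -> : ((clsx s + 1) %% 5 + 4) %% 5 = clsx s by lia.
by rewrite r1.
Qed.

Lemma bwd0 s t : memC s -> memC t -> adjC sx cp0 cm0 s t -> nonq t ->
  ~~ qcls ((clsx t + 4) %% 5) (clsy t) -> clsx s = (clsx t + 4) %% 5 /\ clsy s = clsy t.
Proof.
move=> ms mt; have [s1 s2] := cls_lt ms; have [t1 t2] := cls_lt mt.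
rewrite /adjC; case: ifP => h.
  move=> ->; move: ms h; rewrite /memC /nonq /clsx /clsy /sx.
  by case: s {s1 s2} => [[]] x y z w /=; rewrite /qcls; lia.
case=> _; rewrite /cp0 /cm0 /nonq => e h1 h2; move: e.
rewrite (negbTE h1) (negbTE h2); case: ifP => _; first by move=> h0; case: (holec_code h0).
case: ifP => _; first by move=> h0; case: (two_code h0).
by case/(code_cls_inj (mod5lt _) t1) => <- -> _; split => //; lia.
Qed.

Lemma fwd1 s t : memC s -> memC t -> adjC sy cp1 cm1 s t -> nonq s ->
  ~~ qcls (clsx s) ((clsy s + 1) %% 4) ->
  [/\ clsx t = clsx s, clsy t = (clsy s + 1) %% 4 &
     rcls (clsx s) (clsy s) -> rcls (clsx t) (clsy t) -> (cz s == 0) = (cz t == 0)].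
Proof.
move=> ms mt; have [s1 s2] := cls_lt ms; have [t1 t2] := cls_lt mt.
rewrite /adjC; case: ifP => h.
  move=> -> ns _; have [-> ->] : clsx (sy s) = clsx s /\ clsy (sy s) = (clsy s + 1) %% 4; last by [].
  move: ms h ns; rewrite /memC /nonq /clsx /clsy /sy.
  by case: s {s1 s2} => [[]] x y z w /=; rewrite /qcls; lia.
case=> _; rewrite /cp1 /cm1 /nonq => e h1 h2; move: e.
rewrite (negbTE h1) (negbTE h2) /=; case: ifP => _; first by move=> h0; case: (two_code (esym h0)).
case/(code_cls_inj s1 t1) => e1 e2 e3; rewrite -e1 -e2 in e3 *; split => // r1 r2.
move: e3; rewrite r1 r2 /=; have -> : ((clsy s + 1) %% 4 + 3) %% 4 = clsy s by lia.
by rewrite r1.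
Qed.

Lemma bwd1 s t : memC s -> memC t -> adjC sy cp1 cm1 s t -> nonq t ->
  ~~ qcls (clsx t) ((clsy t + 3) %% 4) -> clsx s = clsx t /\ clsy s = (clsy t + 3) %% 4.
Proof.
move=> ms mt; have [s1 s2] := cls_lt ms; have [t1 t2] := cls_lt mt.
rewrite /adjC; case: ifP => h.
  move=> ->; move: ms h; rewrite /memC /nonq /clsx /clsy /sy.
  by case: s {s1 s2} => [[]] x y z w /=; rewrite /qcls; lia.
case=> _; rewrite /cp1 /cm1 /nonq => e h1 h2; move: e.
rewrite (negbTE h1) (negbTE h2) /=; case: ifP => _; first by move=> h0; case: (two_code h0).
by case/(code_cls_inj s1 t1) => <- e2 _; split => //; lia.
Qed.

Lemma fwdz s t : memC s -> memC t -> adjC sz c2 c2 s t -> nonq s || nonq t ->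
  [/\ clsx t = clsx s, clsy t = clsy s & (cw s == 0) = (cw t == 0)].
Proof.
move=> ms mt; have [s1 s2] := cls_lt ms; have [t1 t2] := cls_lt mt.
rewrite /adjC; case: ifP => h; first by move=> ->.
case=> _; rewrite /c2 /nonq => + h1.
case: ifP => qs; case: ifP => qt; move: h1; rewrite ?qs ?qt //= => _.
by case/(code_cls_inj s1 t1).
Qed.

Lemma fwdw s t : memC s -> memC t -> adjC sw c3 c3 s t -> nonq s || nonq t ->
  [/\ clsx t = clsx s, clsy t = clsy s & (cz s == 0) = (cz t == 0)].
Proof.
move=> ms mt; have [s1 s2] := cls_lt ms; have [t1 t2] := cls_lt mt.
rewrite /adjC; case: ifP => h; first by move=> ->.
case=> _; rewrite /c3 /nonq => + h1.
case: ifP => qs; case: ifP => qt; move: h1; rewrite ?qs ?qt //= => _.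
by case/(code_cls_inj s1 t1).
Qed.

Lemma memC_sz s : memC s -> nonq s -> memC (sz s) = ((cz s).+1 < height).
Proof.
rewrite /memC /nonq /clsx /clsy /sz; case: s => [[]] x y z w /= => /and3P[h1 h2 h3] //.
  by move: h2 h3 => -> ->; rewrite !andbT.
by rewrite h2 /= => h4; move: h3; rewrite (negbTE h4) !orbF => ->; rewrite andbT.
Qed.

Lemma memC_sw s : memC s -> nonq s -> memC (sw s) = ((cw s).+1 < width).
Proof.
by rewrite /memC /nonq /clsx /clsy /sw; case: s => [[]] x y z w /= /and3P[h1 h2 h3] //;
  rewrite h1 h3 andbT.
Qed.

Lemma zstep s t : memC s -> memC t -> nonq s -> nonq t -> adjC sz c2 c2 s t ->
  cz t = (cz s).+1 %% height.
Proof.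
move=> ms mt ns nt; rewrite /adjC memC_sz //; case: ifP => h; first by move=> ->; rewrite modn_small.
have hs : cz s < height by case/and3P: ms.
have -> : (cz s).+1 = height by lia.
rewrite modnn => -[hu _]; case e: (cz t) => [//|z].
exfalso; have := hu (Cell (knd t) (cx t) (cy t) z (cw t)).
rewrite /sz /= -e => /(_ _)/negP; case; first by case: (t).
move: mt nt e; rewrite /memC /nonq /clsx /clsy; case: t {hu} => k x y z' w /= + + ez; subst z'.
move=> /and3P[h1 -> h3] nq; rewrite (ltnW h1) /=; move: h3 nq; case: k => //=.
by move=> /and3P[-> -> h3] h4; move: h3; rewrite (negbTE h4) /= !orbF.
Qed.

Lemma wstep s t : memC s -> memC t -> nonq s -> nonq t -> adjC sw c3 c3 s t ->
  cw t = (cw s).+1 %% width.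
Proof.
move=> ms mt ns nt; rewrite /adjC memC_sw //; case: ifP => h; first by move=> ->; rewrite modn_small.
have hs : cw s < width by case/and3P: ms.
have -> : (cw s).+1 = width by lia.
rewrite modnn => -[hu _]; case e: (cw t) => [//|z].
exfalso; have := hu (Cell (knd t) (cx t) (cy t) (cz t) z).
rewrite /sw /= -e => /(_ _)/negP; case; first by case: (t).
move: mt e; rewrite /memC /clsx /clsy; case: t {hu nt} => k x y z' w /= + ez; subst w.
by move=> /and3P[-> h2 h3]; rewrite (ltnW h2).
Qed.

(** * From a coloured filling of the 4-dimensional lattice to the planar configuration *)

Section Sound.
Context (HRirr : forall a, ~~ HR a a) (VRirr : forall a, ~~ VR a a).

Section Aligned.
Context (f : int -> int -> int -> int -> cell) (fP : coloured4 f).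

Definition good X Y Z W := (clsx (f X Y Z W))%:Z = (X %% 5)%Z /\ (clsy (f X Y Z W))%:Z = (Y %% 4)%Z.
Definition nq (X Y : int) := ~~ qcls `|(X %% 5)%Z| `|(Y %% 4)%Z|.

Lemma good_cls X Y Z W : good X Y Z W ->
  clsx (f X Y Z W) = `|(X %% 5)%Z| /\ clsy (f X Y Z W) = `|(Y %% 4)%Z|.
Proof. by case; lia. Qed.

Lemma fmem X Y Z W : memC (f X Y Z W). Proof. by case: (fP X Y Z W). Qed.
Lemma fx X Y Z W X' : X' = (X + 1)%R -> adjC sx cp0 cm0 (f X Y Z W) (f X' Y Z W).
Proof. by move=> ->; case: (fP X Y Z W). Qed.
Lemma fy X Y Z W Y' : Y' = (Y + 1)%R -> adjC sy cp1 cm1 (f X Y Z W) (f X Y' Z W).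
Proof. by move=> ->; case: (fP X Y Z W). Qed.
Lemma fz X Y Z W Z' : Z' = (Z + 1)%R -> adjC sz c2 c2 (f X Y Z W) (f X Y Z' W).
Proof. by move=> ->; case: (fP X Y Z W). Qed.
Lemma fw X Y Z W W' : W' = (W + 1)%R -> adjC sw c3 c3 (f X Y Z W) (f X Y Z W').
Proof. by move=> ->; case: (fP X Y Z W). Qed.

Lemma goodx X Y Z W : nq X Y -> nq (X + 1)%R Y -> good X Y Z W <-> good (X + 1)%R Y Z W.
Proof.
move=> n1 n2; split => g; have [g1 g2] := good_cls g; move: n1 n2; rewrite /nq => n1 n2.
  have := fwd0 (fmem X Y Z W) (fmem _ _ _ _) (fx Y Z W erefl).
  rewrite /nonq g1 g2 => /(_ n1) [|e1 e2 _]; last by rewrite /good e1 e2; lia.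
  by have -> : (`|(X %% 5)%Z| + 1) %% 5 = `|((X + 1)%R %% 5)%Z| by lia.
have := bwd0 (fmem X Y Z W) (fmem _ _ _ _) (fx Y Z W erefl).
rewrite /nonq g1 g2 => /(_ n2) [|e1 e2]; last by rewrite /good e1 e2; lia.
by have -> : (`|((X + 1)%R %% 5)%Z| + 4) %% 5 = `|(X %% 5)%Z| by lia.
Qed.

Lemma goody X Y Z W : nq X Y -> nq X (Y + 1)%R -> good X Y Z W <-> good X (Y + 1)%R Z W.
Proof.
move=> n1 n2; split => g; have [g1 g2] := good_cls g; move: n1 n2; rewrite /nq => n1 n2.
  have := fwd1 (fmem X Y Z W) (fmem _ _ _ _) (fy X Z W erefl).
  rewrite /nonq g1 g2 => /(_ n1) [|e1 e2 _]; last by rewrite /good e1 e2; lia.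
  by have -> : (`|(Y %% 4)%Z| + 1) %% 4 = `|((Y + 1)%R %% 4)%Z| by lia.
have := bwd1 (fmem X Y Z W) (fmem _ _ _ _) (fy X Z W erefl).
rewrite /nonq g1 g2 => /(_ n2) [|e1 e2]; last by rewrite /good e1 e2; lia.
by have -> : (`|((Y + 1)%R %% 4)%Z| + 3) %% 4 = `|(Y %% 4)%Z| by lia.
Qed.

Lemma goodz X Y Z W : nq X Y -> good X Y Z W <-> good X Y (Z + 1)%R W.
Proof.
rewrite /nq => n1; split => g; have [g1 g2] := good_cls g;
  have := fwdz (fmem X Y Z W) (fmem _ _ _ _) (fz X Y W erefl);
  rewrite /nonq /good g1 g2 n1 ?orbT => /(_ isT) [e1 e2 _]; first by rewrite e1 e2; lia.
by rewrite -e1 -e2; lia.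
Qed.

Lemma goodw X Y Z W : nq X Y -> good X Y Z W <-> good X Y Z (W + 1)%R.
Proof.
rewrite /nq => n1; split => g; have [g1 g2] := good_cls g;
  have := fwdw (fmem X Y Z W) (fmem _ _ _ _) (fw X Y Z erefl);
  rewrite /nonq /good g1 g2 n1 ?orbT => /(_ isT) [e1 e2 _]; first by rewrite e1 e2; lia.
by rewrite -e1 -e2; lia.
Qed.

Lemma iff_line (P : int -> Prop) y0 y : (forall z, P z <-> P (z + 1)%R) -> P y0 -> P y.
Proof.
move=> h h0; apply: (int_line h0) => z; first by move/h.
by move=> hz; apply/h; rewrite subrK.
Qed.

Context (Xb Yb : int) (nqb : nq Xb Yb) (goodb : good Xb Yb 0 0).

(** Every place other than an arm place lies on a row with Y even or on a column with X = 0, 1 or 3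
    modulo 5. These lines avoid the arm places and cross each other, so the residues propagate from
    one place to all. *)
Lemma all_good X Y Z W : nq X Y -> good X Y Z W.
Proof.
have rowY (X0 Y0 X1 : int) : (Y0 %% 4 == 0)%Z || (Y0 %% 4 == 2)%Z -> good X0 Y0 0 0 -> good X1 Y0 0 0.
  move=> h; apply: (@iff_line (fun x => good x Y0 0 0)) => z; apply: goodx; rewrite /nq /qcls; lia.
have colX (X0 Y0 Y1 : int) : [|| X0 %% 5 == 0, X0 %% 5 == 1 | X0 %% 5 == 3]%Z -> good X0 Y0 0 0 -> good X0 Y1 0 0.
  move=> h; apply: (@iff_line (fun y => good X0 y 0 0)) => z; apply: goody; rewrite /nq /qcls; lia.
have dich (X0 Y0 : int) : nq X0 Y0 -> ((Y0 %% 4 == 0)%Z || (Y0 %% 4 == 2)%Z) \/ [|| X0 %% 5 == 0, X0 %% 5 == 1 | X0 %% 5 == 3]%Z.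
  by rewrite /nq /qcls; lia.
have g0 : good 0 0 0 0.
  case: (dich _ _ nqb) => h; first by apply: (colX 0%R Yb 0%R) => //; apply: rowY goodb.
  by apply: (rowY Xb) => //; apply: colX goodb.
move=> hn; have g1 : good X Y 0 0.
  case: (dich _ _ hn) => h; first by apply: (rowY 0%R) => //; apply: colX g0.
  by apply: (colX X 0%R) => //; apply: rowY g0.
apply: (@iff_line (fun z => good X Y z W) 0%R) => [z|]; first exact: goodz.
by apply: (@iff_line (fun w => good X Y 0 w) 0%R) => // w; exact: goodw.
Qed.

Lemma all_nonq X Y Z W : nq X Y -> nonq (f X Y Z W).
Proof. by move=> h; have [e1 e2] := good_cls (all_good Z W h); rewrite /nonq e1 e2. Qed.

Lemma witer X Y Z W (j : nat) : nq X Y -> cw (f X Y Z (W + j%:Z)%R) = (cw (f X Y Z W) + j) %% width.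
Proof.
move=> h; elim: j => [|j IH].
  by rewrite addr0 addn0 modn_small //; case/and3P: (fmem X Y Z W).
rewrite (wstep (fmem X Y Z (W + j%:Z)%R) (fmem _ _ _ _)) ?all_nonq //; last by apply: fw; lia.
by rewrite IH -addn1 modnDml; congr (_ %% _); lia.
Qed.

Lemma ziter X Y Z W (j : nat) : nq X Y -> cz (f X Y (Z + j%:Z)%R W) = (cz (f X Y Z W) + j) %% height.
Proof.
move=> h; elim: j => [|j IH].
  by rewrite addr0 addn0 modn_small //; case/and3P: (fmem X Y Z W).
rewrite (zstep (fmem X Y (Z + j%:Z)%R W) (fmem _ _ _ _)) ?all_nonq //; last by apply: fz; lia.
by rewrite IH -addn1 modnDml; congr (_ %% _); lia.
Qed.

(** The colour only compares whether z = 0, but does so at every height. As z advances cyclically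
    along Z, equal zeros mean equal phases. *)
Lemma wsame X Y Z W : nq X Y -> cz (f X Y Z (W + 1)%R) = cz (f X Y Z W).
Proof.
move=> h; have hs z : (cz (f X Y z W) == 0) = (cz (f X Y z (W + 1)%R) == 0).
  by have [] := fwdw (fmem X Y z W) (fmem X Y z (W + 1)%R) (fw X Y z erefl); rewrite ?all_nonq.
have l1 : cz (f X Y Z W) < height by case/and3P: (fmem X Y Z W).
have l2 : cz (f X Y Z (W + 1)%R) < height by case/and3P: (fmem X Y Z (W + 1)%R).
have := hs (Z + (height - cz (f X Y Z W))%:Z)%R; rewrite !ziter // subnKC 1?ltnW // modnn eqxx.
move/esym/eqP => e; apply/eqP; rewrite -[X in X == _](modn_small l2) -[X in _ == X](modn_small l1).
by rewrite -(eqn_modDr (height - cz (f X Y Z W))) e subnKC 1?ltnW // modnn.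
Qed.

Lemma cz_const X Y Z W W' : nq X Y -> cz (f X Y Z W) = cz (f X Y Z W').
Proof.
move=> h; apply: (@iff_line (fun w => cz (f X Y Z w) = cz (f X Y Z W')) W' W) => // w.
by rewrite wsame.
Qed.

Lemma kindT X Y Z W : rcls `|(X %% 5)%Z| `|(Y %% 4)%Z| ->
  [/\ knd (f X Y Z W) = KT, (cx (f X Y Z W))%:Z = ((X + 1)%R %% 5)%Z & (cy (f X Y Z W))%:Z = ((Y + 1)%R %% 4)%Z].
Proof.
move=> r; have h : nq X Y by move: r; rewrite /nq /rcls /qcls; lia.
have := good_cls (all_good Z W h); have := fmem X Y Z W; move: r.
rewrite /memC /clsx /clsy /rcls /qcls; case: (f X Y Z W) => [[]] x y z w /=.
- by move=> r /and3P[_ _ +] [e1 e2]; lia.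
- by move=> r /and3P[_ _ /and3P[h1 h2 _]] [e1 e2]; split => //; lia.
- by move=> r _ [e1 e2]; lia.
Qed.

Lemma kindA X Y Z W : ~~ rcls `|(X %% 5)%Z| `|(Y %% 4)%Z| -> nq X Y ->
  [/\ knd (f X Y Z W) = KA, (cx (f X Y Z W))%:Z = (X %% 5)%Z & (cy (f X Y Z W))%:Z = (Y %% 4)%Z].
Proof.
move=> r h.
have := good_cls (all_good Z W h); have := fmem X Y Z W; move: r h.
rewrite /memC /nq /clsx /clsy; case: (f X Y Z W) => [[]] x y z w /=.
- by move=> r _ /and3P[_ _ _] [e1 e2]; split => //; lia.
- by move=> r h /and3P[_ _ /and3P[_ _ +]] [e1 e2]; rewrite e1 e2 (negbTE r) (negbTE h).
- by move=> r h _ [e1 e2]; move: h; rewrite -e1 -e2.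
Qed.

(* All the tiles T have the same height modulo the period. *)
Lemma rsync : exists Z, forall X Y W, rcls `|(X %% 5)%Z| `|(Y %% 4)%Z| -> cz (f X Y Z W) = 0.
Proof.
have n0 : nq 0 0 by [].
pose Z := (height - cz (f 0 0 0 0))%:Z; exists Z => X Y W r.
have h : nq X Y by move: r; rewrite /nq /rcls /qcls; lia.
have e0 : cz (f 0 0 Z 0) == 0.
  have l1 : cz (f 0 0 0 0) < height by case/and3P: (fmem 0 0 0 0).
  by rewrite -[Z]add0r ziter // subnKC 1?ltnW // modnn.
have hx (x y : int) : rcls `|(x %% 5)%Z| `|(y %% 4)%Z| -> rcls `|((x + 1)%R %% 5)%Z| `|(y %% 4)%Z| ->
    (cz (f x y Z 0) == 0) <-> (cz (f (x + 1)%R y Z 0) == 0).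
  move=> r1 r2; have h1 : nq x y by move: r1; rewrite /nq /rcls /qcls; lia.
  have h2 : nq (x + 1)%R y by move: r2; rewrite /nq /rcls /qcls; lia.
  have [a1 a2] := good_cls (all_good Z 0 h1); have [b1 b2] := good_cls (all_good Z 0 h2).
  have [||_ _] := fwd0 (fmem x y Z 0) (fmem _ _ _ _) (fx y Z 0 erefl).
  - exact: all_nonq.
  - by rewrite a1 a2; have -> : (`|(x %% 5)%Z| + 1) %% 5 = `|((x + 1)%R %% 5)%Z| by clear; lia.
  - by rewrite a1 a2 b1 b2 r1 r2 => /(_ isT isT) ->.
have hy (x y : int) : rcls `|(x %% 5)%Z| `|(y %% 4)%Z| -> rcls `|(x %% 5)%Z| `|((y + 1)%R %% 4)%Z| ->
    (cz (f x y Z 0) == 0) <-> (cz (f x (y + 1)%R Z 0) == 0).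
  move=> r1 r2; have h1 : nq x y by move: r1; rewrite /nq /rcls /qcls; lia.
  have h2 : nq x (y + 1)%R by move: r2; rewrite /nq /rcls /qcls; lia.
  have [a1 a2] := good_cls (all_good Z 0 h1); have [b1 b2] := good_cls (all_good Z 0 h2).
  have [||_ _] := fwd1 (fmem x y Z 0) (fmem _ _ _ _) (fy x Z 0 erefl).
  - exact: all_nonq.
  - by rewrite a1 a2; have -> : (`|(y %% 4)%Z| + 1) %% 4 = `|((y + 1)%R %% 4)%Z| by clear; lia.
  - by rewrite a1 a2 b1 b2 r1 r2 => /(_ isT isT) ->.
have row (X0 Y0 X1 : int) : (Y0 %% 4 == 0)%Z -> cz (f X0 Y0 Z 0) == 0 -> cz (f X1 Y0 Z 0) == 0.
  move=> h1; apply: (@iff_line (fun x => cz (f x Y0 Z 0) == 0)) => z; apply: hx; rewrite /rcls; lia.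
have col (X0 Y0 Y1 : int) : (X0 %% 5 == 0)%Z -> cz (f X0 Y0 Z 0) == 0 -> cz (f X0 Y1 Z 0) == 0.
  move=> h1; apply: (@iff_line (fun y => cz (f X0 y Z 0) == 0)) => z; apply: hy; rewrite /rcls; lia.
rewrite (cz_const Z W 0 h); apply/eqP; move: r; rewrite /rcls => r.
have [r1|r1] : (Y %% 4 == 0)%Z \/ (X %% 5 == 0)%Z by lia.
  by apply: (row 0%R) => //; apply: col e0.
by apply: (col _ 0%R) => //; apply: row e0.
Qed.

Lemma intern (up : cell -> cell) p q s t u : adjC up p q s t -> memC u -> up s = u -> t = u.
Proof. by rewrite /adjC => h mu e; move: h; rewrite e mu. Qed.

Lemma intern_back (up : cell -> cell) p q s t u : injective up ->
  adjC up p q s t -> memC u -> up u = t -> s = u.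
Proof.
move=> inj; rewrite /adjC; case: ifP => _; first by move=> -> _ /inj.
by case=> h _ mu /h; rewrite mu.
Qed.

Lemma sx_inj : injective sx. Proof. by move=> [????? ] [?????] [-> -> -> -> ->]. Qed.
Lemma sy_inj : injective sy. Proof. by move=> [????? ] [?????] [-> -> -> -> ->]. Qed.

Context (Z0 : int) (Z0P : forall X Y W, rcls `|(X %% 5)%Z| `|(Y %% 4)%Z| -> cz (f X Y Z0 W) = 0).

Definition wT (i j W : int) := cw (f (5 * i)%R (4 * j)%R Z0 W).
Definition wA (i j W : int) := cw (f (5 * i + 1)%R (4 * j + 1)%R Z0 W).
Definition kA (i j : int) := cz (f (5 * i + 1)%R (4 * j + 1)%R Z0 0).

Lemma ix X X' Y W s : f X Y Z0 W = s -> X' = (X + 1)%R -> memC (sx s) -> f X' Y Z0 W = sx s.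
Proof. by move=> e1 e2 m; apply: (intern (fx Y Z0 W e2) m); rewrite e1. Qed.

Lemma iy X Y Y' W s : f X Y Z0 W = s -> Y' = (Y + 1)%R -> memC (sy s) -> f X Y' Z0 W = sy s.
Proof. by move=> e1 e2 m; apply: (intern (fy X Z0 W e2) m); rewrite e1. Qed.

Lemma ibx X X' Y W u : f X' Y Z0 W = sx u -> X' = (X + 1)%R -> memC u -> f X Y Z0 W = u.
Proof. by move=> e1 e2 m; apply: (intern_back sx_inj (fx Y Z0 W e2) m). Qed.

Lemma iby X Y Y' W u : f X Y' Z0 W = sy u -> Y' = (Y + 1)%R -> memC u -> f X Y Z0 W = u.
Proof. by move=> e1 e2 m; apply: (intern_back sy_inj (fy X Z0 W e2) m). Qed.

Lemma arms i j W : [/\ f (5 * i + 2)%R (4 * j + 1)%R Z0 W = Cell KT 3 2 0 (wT i j W),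
  f (5 * i - 1)%R (4 * j + 1)%R Z0 W = Cell KT 0 2 0 (wT i j W),
  f (5 * i + 2)%R (4 * j - 1)%R Z0 W = Cell KT 3 0 0 (wT i j W)
  & f (5 * i - 1)%R (4 * j - 1)%R Z0 W = Cell KT 0 0 0 (wT i j W)].
Proof.
have r : rcls `|((5 * i)%R %% 5)%Z| `|((4 * j)%R %% 4)%Z| by rewrite /rcls; lia.
have e0 : f (5 * i)%R (4 * j)%R Z0 W = Cell KT 1 1 0 (wT i j W).
  have [e1 e2 e3] := kindT Z0 W r; have e4 := Z0P W r; rewrite /wT.
  by move: e1 e2 e3 e4; case: (f _ _ _ _) => k x y z w /= -> e2 e3 ->; congr Cell; lia.
have := fmem (5 * i)%R (4 * j)%R Z0 W; rewrite e0 => /and3P[/= hh hw _].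
have m x y z : x < 5 -> y < 4 -> z = 0 -> rcls ((x + 4) %% 5) ((y + 3) %% 4) || qcls ((x + 4) %% 5) ((y + 3) %% 4) ->
    memC (Cell KT x y z (wT i j W)).
  by move=> h1 h2 -> h3; rewrite /memC /= hh hw h1 h2 /clsx /clsy /= andbT.
have r1 : f (5 * i + 1)%R (4 * j)%R Z0 W = Cell KT 2 1 0 (wT i j W).
  by apply: (ix e0) => //; exact: m.
have r2 : f (5 * i + 2)%R (4 * j)%R Z0 W = Cell KT 3 1 0 (wT i j W).
  by apply: (ix r1); [lia | exact: m].
have l1 : f (5 * i - 1)%R (4 * j)%R Z0 W = Cell KT 0 1 0 (wT i j W).
  by apply: ibx; [exact: e0 | lia | exact: m].
split.
- by apply: (iy r2); [lia | exact: m].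
- by apply: (iy l1); [lia | exact: m].
- by apply: iby; [exact: r2 | lia | exact: m].
- by apply: iby; [exact: l1 | lia | exact: m].
Qed.

Lemma island i j W : [/\ f (5 * i + 1)%R (4 * j + 1)%R Z0 W = Cell KA 1 1 (kA i j) (wA i j W),
  f (5 * i + 3)%R (4 * j + 1)%R Z0 W = Cell KA 3 1 (kA i j) (wA i j W),
  f (5 * i + 1)%R (4 * j + 3)%R Z0 W = Cell KA 1 3 (kA i j) (wA i j W)
  & f (5 * i + 3)%R (4 * j + 3)%R Z0 W = Cell KA 3 3 (kA i j) (wA i j W)].
Proof.
have r : ~~ rcls `|((5 * i + 1)%R %% 5)%Z| `|((4 * j + 1)%R %% 4)%Z| by rewrite /rcls; lia.
have h : nq (5 * i + 1)%R (4 * j + 1)%R by rewrite /nq /qcls; lia.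
have e0 : f (5 * i + 1)%R (4 * j + 1)%R Z0 W = Cell KA 1 1 (kA i j) (wA i j W).
  have [e1 e2 e3] := kindA Z0 W r h; rewrite /wA /kA (cz_const Z0 0 W h).
  by move: e1 e2 e3; case: (f _ _ _ _) => k x y z w /= -> e2 e3; congr Cell; lia.
have := fmem (5 * i + 1)%R (4 * j + 1)%R Z0 W; rewrite e0 => /and3P[/= hh hw _].
have m x y : 0 < x < 5 -> 0 < y < 4 -> ~~ qcls x y -> memC (Cell KA x y (kA i j) (wA i j W)).
  by move=> h1 h2 h3; rewrite /memC /= hh hw h1 h2 h3.
have r1 : f (5 * i + 1)%R (4 * j + 2)%R Z0 W = Cell KA 1 2 (kA i j) (wA i j W).
  by apply: (iy e0); [lia | exact: m].
have r2 : f (5 * i + 2)%R (4 * j + 2)%R Z0 W = Cell KA 2 2 (kA i j) (wA i j W).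
  by apply: (ix r1); [lia | exact: m].
have r3 : f (5 * i + 3)%R (4 * j + 2)%R Z0 W = Cell KA 3 2 (kA i j) (wA i j W).
  by apply: (ix r2); [lia | exact: m].
split => //.
- by apply: iby; [exact: r3 | lia | exact: m].
- by apply: (iy r1); [lia | exact: m].
- by apply: (iy r3); [lia | exact: m].
Qed.

Lemma contact s t : adjC sx cp0 cm0 s t -> knd s = KA -> qcls (cx s).+1 (cy s) ->
  qcls (clsx t) (clsy t) -> (cw s == alpha (cx s).+1 (cy s) (cz s)) = (cw t == 0).
Proof.
move=> h ks q1 q2; move: h; rewrite /adjC.
have -> : memC (sx s) = false.
  by rewrite /memC /sx /= ks q1 /= !andbF.
case=> _; rewrite /cp0 /cm0 q2 /clsx /clsy ks.
have -> : (cx s + 1) %% 5 = (cx s).+1 by move: q1; rewrite /qcls; lia.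
rewrite q1 /holec; by case: (_ == _); case: (_ == _).
Qed.

Lemma contacts i j W : [/\ (wA i j W == alpha 2 1 (kA i j)) = (wT i j W == 0),
   (wA i j W == alpha 4 1 (kA i j)) = (wT (i + 1) j W == 0),
   (wA i j W == alpha 2 3 (kA i j)) = (wT i (j + 1) W == 0) &
   (wA i j W == alpha 4 3 (kA i j)) = (wT (i + 1) (j + 1) W == 0)].
Proof.
have [i1 i2 i3 i4] := island i j W.
have [a1 _ _ _] := arms i j W.
have [_ a2 _ _] := arms (i + 1) j W.
have [_ _ a3 _] := arms i (j + 1) W.
have [_ _ _ a4] := arms (i + 1) (j + 1) W.
have cont x y X Y X' t : f X Y Z0 W = Cell KA x y (kA i j) (wA i j W) ->
  f X' Y Z0 W = t -> X' = (X + 1)%R -> qcls x.+1 y -> qcls (clsx t) (clsy t) ->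
  (wA i j W == alpha x.+1 y (kA i j)) = (cw t == 0).
  move=> e1 e2 e3 q1 q2; have := @contact (f X Y Z0 W) (f X' Y Z0 W) (fx _ _ _ e3).
  by rewrite e1 e2; apply.
split.
- by rewrite (cont 1 1 _ _ _ _ i1 a1) //; lia.
- rewrite (cont 3 1 _ _ (5 * (i + 1) - 1)%R _ i2 a2) //; lia.
- have e : (4 * (j + 1) - 1 = 4 * j + 3)%R by lia.
  by rewrite e in a3; rewrite (cont 1 3 _ _ _ _ i3 a3) //; lia.
- have e : (4 * (j + 1) - 1 = 4 * j + 3)%R by lia.
  by rewrite e in a4; rewrite (cont 3 3 _ _ (5 * (i + 1) - 1)%R _ i4 a4) //; lia.
Qed.

(** A position along W of the mark of the four arms at the node (i, j). *)
Definition tau (i j : int) : nat := width - wT i j 0.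
Definition uA (i j : int) : nat := wA i j 0.

Lemma wT_tau i j : wT i j (tau i j)%:Z = 0.
Proof.
have h : nq (5 * i)%R (4 * j)%R by rewrite /nq /qcls; lia.
have l1 : wT i j 0 < width by case/and3P: (fmem (5 * i)%R (4 * j)%R Z0 0).
by rewrite /tau -[_%:Z]add0r /wT witer // subnKC ?modnn // ltnW.
Qed.

Lemma wA_shift i j (t : nat) : wA i j t%:Z = (uA i j + t) %% width.
Proof.
have h : nq (5 * i + 1)%R (4 * j + 1)%R by rewrite /nq /qcls; lia.
by rewrite /uA /wA -[t%:Z]add0r witer.
Qed.

Lemma faces i j : [/\ (uA i j + tau i j) %% width = alpha 2 1 (kA i j),
   (uA i j + tau (i + 1) j) %% width = alpha 4 1 (kA i j),
   (uA i j + tau i (j + 1)) %% width = alpha 2 3 (kA i j) &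
   (uA i j + tau (i + 1) (j + 1)) %% width = alpha 4 3 (kA i j)].
Proof.
split; rewrite -wA_shift; apply/eqP.
- by have [-> _ _ _] := contacts i j (tau i j)%:Z; rewrite wT_tau.
- by have [_ -> _ _] := contacts i j (tau (i + 1) j)%:Z; rewrite wT_tau.
- by have [_ _ -> _] := contacts i j (tau i (j + 1))%:Z; rewrite wT_tau.
- by have [_ _ _ ->] := contacts i j (tau (i + 1) (j + 1))%:Z; rewrite wT_tau.
Qed.

Lemma kA_lt i j : kA i j < height.
Proof. by case/and3P: (fmem (5 * i + 1)%R (4 * j + 1)%R Z0 0). Qed.

Lemma n_gt0 : 0 < n.
Proof. by have := kA_lt 0 0; rewrite /height; case: (n). Qed.

Lemma dg_lt i j : [/\ dg1 (kA i j) < n, dg2 (kA i j) < n, dg3 (kA i j) < n & dg4 (kA i j) < n].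
Proof.
have n0 := n_gt0; split; rewrite ?ltn_pmod // ltn_divLR ?expn_gt0 ?n0 // -expnS.
exact: kA_lt.
Qed.

Lemma pow_lt a : a < n -> 2 ^ a < 2 ^ n.
Proof. by move=> h; rewrite ltn_exp2l. Qed.

Lemma alpha_le a b i j : alpha a b (kA i j) <= 3 * 2 ^ n.
Proof.
have [h1 h2 h3 h4] := dg_lt i j.
rewrite /alpha; do 3 ?case: ifP => _;
  have := pow_lt h1; have := pow_lt h2; have := pow_lt h3; have := pow_lt h4; lia.
Qed.

(** Two neighbouring meshes touch the same two arms, with marks at [t] and [t']. Both differences of
    marks, A1 - A2 and B1 - B2, are therefore t - t' modulo the width. *)
Lemma balance u u' t t' A1 A2 B1 B2 : (u + t) %% width = A1 -> (u + t') %% width = A2 ->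
  (u' + t) %% width = B1 -> (u' + t') %% width = B2 ->
  A1 <= 3 * 2 ^ n -> A2 <= 3 * 2 ^ n -> B1 <= 3 * 2 ^ n -> B2 <= 3 * 2 ^ n ->
  A1 + B2 = A2 + B1.
Proof.
move=> e1 e2 e3 e4 h1 h2 h3 h4.
have hw : width = 8 * 2 ^ n by rewrite /width expnD mulnC.
have p : 0 < 2 ^ n by rewrite expn_gt0.
rewrite -[LHS](@modn_small _ width) ?hw; last by lia.
rewrite -[RHS](@modn_small _ (8 * 2 ^ n)); last by lia.
rewrite -hw -e1 -e2 -e3 -e4 modnDml modnDmr modnDml modnDmr; congr (_ %% _); lia.
Qed.

(** If the block were bad, 3 * 2 ^ n plus a power of 2 would be a sum of two powers of 2 below 2 ^ n
    each. *)
Lemma okA i j : okblock (kA i j).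
Proof.
have [f1 f2 f3 f4] := faces i j; have [g1 g2 g3 g4] := faces i (j - 1).
rewrite !subrK in g3 g4.
have := balance f1 f2 g3 g4 (alpha_le _ _ _ _) (alpha_le _ _ _ _) (alpha_le _ _ _ _) (alpha_le _ _ _ _).
rewrite /alpha /=; case: ifP => // _.
have [h1 h2 h3 h4] := dg_lt i j; have [h1' h2' h3' h4'] := dg_lt i (j - 1).
have p2 := pow_lt h2; have p3 := pow_lt h3'; have p : 0 < 2 ^ n by rewrite expn_gt0.
clear -p p2 p3; move: p p2 p3; move: (2 ^ n) (2 ^ dg2 _) (2 ^ dg3 _) (2 ^ dg4 _) => *; lia.
Qed.

(** The other pairing of the exponents would make two horizontal neighbours of a correct block
    equal, against the irreflexivity of [HR]. *)
Lemma dg13 i j : dg3 (kA i j) = dg1 (kA i (j + 1)).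
Proof.
have [f1 f2 f3 f4] := faces i (j + 1); have [g1 g2 g3 g4] := faces i j.
have := balance f1 f2 g3 g4 (alpha_le _ _ _ _) (alpha_le _ _ _ _) (alpha_le _ _ _ _) (alpha_le _ _ _ _).
rewrite /alpha /= okA => /pow2_pairs [[e1 _]|[]//].
by have /and4P[] := okA i (j + 1); rewrite e1 (negbTE (HRirr _)).
Qed.

Lemma dg12 i j : dg2 (kA i j) = dg1 (kA (i + 1) j).
Proof.
have [f1 f2 f3 f4] := faces (i + 1) j; have [g1 g2 g3 g4] := faces i j.
have := balance f1 f3 g2 g4 (alpha_le _ _ _ _) (alpha_le _ _ _ _) (alpha_le _ _ _ _) (alpha_le _ _ _ _).
rewrite /alpha /= okA => /pow2_pairs [[e1 _]|[]//].
by have /and4P[_ _] := okA (i + 1) j; rewrite e1 (negbTE (VRirr _)).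
Qed.

Lemma sft_aligned : sft.
Proof.
exists (fun i j => dg1 (kA i j)) => i j; have [h _ _ _] := dg_lt i j; split => //.
  by rewrite -dg12; case/and4P: (okA i j).
by rewrite -dg13; case/and4P: (okA i j).
Qed.

End Aligned.

(** Two consecutive places along x cannot both be arm places, so one of the two at 0 and -1 is not;
    a translation makes its residues those of its coordinates. *)
Lemma sft_of_coloured f : coloured4 f -> sft.
Proof.
move=> fP.
have [X0 n0] : exists X0, nonq (f X0 0 0 0)%R.
  case h : (nonq (f 0 0 0 0)%R); first by exists 0%R.
  exists (-1)%R; have [m1 a1 _ _ _] := fP (-1)%R 0%R 0%R 0%R; have [m2 _ _ _ _] := fP 0%R 0%R 0%R 0%R.
  move: a1 m1 m2 h; rewrite addNr; move: (f _ _ _ _) (f _ _ _ _) => t s.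
  rewrite /adjC; case: ifP => [ms -> _|ms [_ e] m1 m2 /negbFE qt].
    move=> _ h; move: ms h => /and3P[_ _]; rewrite /nonq /clsx /clsy /sx.
    by case: s => [[]] x y z w /=; rewrite /rcls /qcls; lia.
  move: e; rewrite /cp0 /cm0 qt; case: ifP => hq.
    by move=> _; rewrite /nonq; move: hq; rewrite /qcls; have := cls_lt m1; lia.
  by case: ifP => _; [rewrite /holec; case: (_ == _) | move=> h0; case: (holec_code (esym h0))].
pose a := clsx (f X0 0 0 0)%R; pose b := clsy (f X0 0 0 0)%R.
pose g X Y Z W := f (X + (X0 - a%:Z))%R (Y - b%:Z)%R Z W.
have gP : coloured4 g.
  move=> X Y Z W; have := fP (X + (X0 - a%:Z))%R (Y - b%:Z)%R Z W.
  by rewrite /g [(X + 1 + _)%R]addrAC [(Y + 1 - _)%R]addrAC.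
have [m1 _ _ _ _] := fP X0 0%R 0%R 0%R; have [l1 l2] := cls_lt m1.
have eg : g a%:Z b%:Z 0%R 0%R = f X0 0%R 0%R 0%R by rewrite /g subrr addrC subrK.
have e1 : `|(a %% 5)%Z| = a by rewrite /a; lia.
have e2 : `|(b %% 4)%Z| = b by rewrite /b; lia.
have nb : nq a%:Z b%:Z by rewrite /nq e1 e2; exact: n0.
have gb : good g a%:Z b%:Z 0 0 by rewrite /good eg -/a -/b; split; lia.
have [Z0 hZ] := rsync gP nb gb.
exact: (sft_aligned gP nb gb hZ).
Qed.

End Sound.
End Tiles.

(** * Tiling from a planar configuration *)

Definition imod (m : nat) (x : int) : nat := `|modz x m%:Z|.

Lemma imod_lt m x : 0 < m -> imod m x < m.
Proof.
rewrite /imod => m0; have h1 := ltz_pmod x (d := m%:Z); have h2 := modz_ge0 x (d := m%:Z).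
have h1' := h1 ltac:(lia); have h2' := h2 ltac:(lia); lia.
Qed.

Lemma imodS m x : 0 < m -> imod m (x + 1)%R = if (imod m x).+1 < m then (imod m x).+1 else 0.
Proof.
move=> m0; have l := imod_lt x m0.
have h2 : (0 <= modz x m%:Z)%R by apply: modz_ge0; lia.
have e : modz x m%:Z = (imod m x)%:Z by rewrite /imod; lia.
have -> : imod m (x + 1)%R = imod m ((imod m x).+1%:Z).
  have -> : ((imod m x).+1%:Z = modz x m%:Z + 1)%R by rewrite e; lia.
  by rewrite /imod modzDml.
case: ifP => h; first by rewrite [LHS]/imod modz_nat /= modn_small.
have -> : (imod m x).+1 = m by lia.
by rewrite /imod modz_nat /= modnn.
Qed.

Lemma imod0 m x a : a < m -> (imod m (x - a%:Z)%R == 0) = (imod m x == a).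
Proof.
move=> am; have m0 : 0 < m by lia.
have h2 : (0 <= modz x m%:Z)%R by apply: modz_ge0; lia.
have l := imod_lt x m0; have e : modz x m%:Z = (imod m x)%:Z by rewrite /imod; lia.
have -> : imod m (x - a%:Z)%R = imod m ((imod m x)%:Z - a%:Z)%R.
  by rewrite /imod -[in LHS]modzDml e.
move: (imod m x) l => y ly; case: (leqP a y) => h.
  have -> : (y%:Z - a%:Z)%R = (y - a)%N%:Z by lia.
  by rewrite /imod modz_nat /= modn_small; lia.
have -> : imod m (y%:Z - a%:Z)%R = imod m (m + y - a)%N%:Z.
  by rewrite /imod -[in LHS](modzDr _ m%:Z); congr (`|modz _ _|); lia.
by rewrite /imod modz_nat /= modn_small; lia.
Qed.

Section Complete.
Context (n : nat) (HR VR : nat -> nat -> bool) (c : int -> int -> nat).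
Context (cP : forall i j, [/\ c i j < n, HR (c i j) (c (i + 1)%R j) & VR (c i j) (c i (j + 1)%R)]).

Local Notation height := (height n).
Local Notation width := (width n).
Local Notation alpha := (alpha n HR VR).
Local Notation memC := (memC n).
Local Notation cp0 := (cp0 n HR VR).

Lemma npos : 0 < n. Proof. by have [h _ _] := cP 0 0; lia. Qed.
Lemma height_gt0 : 0 < height. Proof. by rewrite expn_gt0 npos. Qed.
Lemma width_gt0 : 0 < width. Proof. by rewrite expn_gt0. Qed.

Definition kk i j := ((c i j * n + c (i + 1)%R j) * n + c i (j + 1)%R) * n + c (i + 1)%R (j + 1)%R.

Lemma kk_dg i j : [/\ dg1 n (kk i j) = c i j, dg2 n (kk i j) = c (i + 1)%R j,
  dg3 n (kk i j) = c i (j + 1)%R & dg4 n (kk i j) = c (i + 1)%R (j + 1)%R].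
Proof.
have n0 := npos; have [h1 _ _] := cP i j; have [h2 _ _] := cP (i + 1)%R j.
have [h3 _ _] := cP i (j + 1)%R; have [h4 _ _] := cP (i + 1)%R (j + 1)%R.
have d x y : y < n -> (x * n + y) %/ n = x by move=> h; rewrite divnMDl // divn_small // addn0.
have m x y : y < n -> (x * n + y) %% n = y by move=> h; rewrite modnMDl modn_small.
rewrite /dg1 /dg2 /dg3 /dg4 /kk; split; last by rewrite m.
- by rewrite !expnS expn0 muln1 !divnMA !d.
- by rewrite !expnS expn0 muln1 !divnMA !d // m.
- by rewrite d // m.
Qed.

Lemma kk_lt i j : kk i j < height.
Proof.
have n0 := npos; have [h1 _ _] := cP i j; have [h2 _ _] := cP (i + 1)%R j.
have [h3 _ _] := cP i (j + 1)%R; have [h4 _ _] := cP (i + 1)%R (j + 1)%R.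
have s x y m : x < m -> y < n -> x * n + y < m * n.
  move=> hx hy; have : x.+1 * n <= m * n by rewrite leq_mul2r hx orbT.
  by rewrite mulSn; lia.
by rewrite /kk /height !expnSr expn0 mul1n; apply: (s) => //; apply: (s) => //; apply: (s).
Qed.

Lemma alpha_kk i j a b : qcls a b -> alpha a b (kk i j) = 2 ^ c (i + (a == 4)%N%:Z)%R (j + (b == 3)%N%:Z)%R.
Proof.
have [d1 d2 d3 d4] := kk_dg i j; have [_ h1 h2] := cP i j.
have [_ h3 _] := cP i (j + 1)%R; have [_ _ h4] := cP (i + 1)%R j.
rewrite /alpha /okblock d1 d2 d3 d4 h1 h2 h3 h4 /=.
by rewrite /qcls => /andP[/orP[] /eqP -> /orP[] /eqP ->] /=; rewrite ?addr0.
Qed.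

Lemma dg_lt' k : k < height -> [/\ dg1 n k < n, dg2 n k < n, dg3 n k < n & dg4 n k < n].
Proof.
by move=> h; have n0 := npos; split; rewrite ?ltn_pmod // ltn_divLR ?expn_gt0 ?n0 // -expnS.
Qed.

Lemma alpha_lt a b k : k < height -> alpha a b k < width.
Proof.
move=> /dg_lt' [h1 h2 h3 h4]; have p x : x < n -> 2 ^ x < 2 ^ n by move=> h; rewrite ltn_exp2l.
have e : width = 8 * 2 ^ n by rewrite /width expnD mulnC.
have q : 0 < 2 ^ n by rewrite expn_gt0.
rewrite e /alpha; do 3 ?case: ifP => _;
  have := p _ h1; have := p _ h2; have := p _ h3; have := p _ h4; lia.
Qed.

Lemma pow_c_lt i j : 2 ^ c i j < width.
Proof.
have [h _ _] := cP i j; rewrite /width ltn_exp2l //; lia.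
Qed.

(** The place with residues (a, b) in the mesh (i, j). The arm at a = 4 comes from the node of
    column i + 1, the one at b = 3 from row j + 1. T is shifted along w so that its mark is at 2 ^
    lam, A along z so that its slice at height 0 is the block [kk], and F along w so that its mark
    meets that of A in the slice at hand. *)
Definition cell4 (i j : int) (a b : nat) (Z W : int) : cell :=
  let lam := c (i + (a == 4)%N%:Z)%R (j + (b == 3)%N%:Z)%R in
  if rcls a b then Cell KT (if a == 4 then 0 else a.+1) (if b == 3 then 0 else b.+1) (imod height Z) (imod width (W - (2 ^ lam)%:Z)%R)
  else if qcls a b then
    if imod height Z == 0 then Cell KT (if a == 4 then 0 else a.+1) (if b == 3 then 0 else b.+1) 0 (imod width (W - (2 ^ lam)%:Z)%R)
    else Cell KF 0 0 0 (imod width (W - (alpha a b (imod height (Z + (kk i j)%:Z)%R))%:Z)%R)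
  else Cell KA a b (imod height (Z + (kk i j)%:Z)%R) (imod width W).

Lemma cell4_mem i j a b Z W : a < 5 -> b < 4 -> memC (cell4 i j a b Z W).
Proof.
move=> ha hb; have h0 := height_gt0; have w0 := width_gt0.
rewrite /cell4; case: ifP => r; last (case: ifP => q; first case: ifP => _);
  rewrite /memC /= ?h0 ?imod_lt //=; move: r; rewrite /clsx /clsy /= /rcls => r.
- by apply/and3P; split; case: (a =P 4); case: (b =P 3); lia.
- by apply/and3P; split; move: q; rewrite /qcls; case: (a =P 4); case: (b =P 3); lia.
- by rewrite q; lia.
Qed.

Lemma alpha_arm i j a b Z : qcls a b -> imod height Z = 0 ->
  alpha a b (imod height (Z + (kk i j)%:Z)%R) = 2 ^ c (i + (a == 4)%N%:Z)%R (j + (b == 3)%N%:Z)%R.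
Proof.
move=> q e; rewrite -alpha_kk //; congr alpha.
have h0 := height_gt0.
have e0 : modz Z height%:Z = 0%R by move: e; rewrite /imod; lia.
by rewrite /imod -modzDml e0 add0r modz_nat /= modn_small // kk_lt.
Qed.

Ltac start := rewrite /cell4 /rcls /qcls /=.
Ltac finish := rewrite /cm0 /cm1 /cp0 /cp1 /c2 /c3 /clsx /clsy /rcls /qcls /code_cls /=.

Lemma cell4_x i j a b Z W : a < 5 -> b < 4 ->
  adjC n sx cp0 cm0 (cell4 i j a b Z W)
    (if a == 4 then cell4 (i + 1)%R j 0 b Z W else cell4 i j a.+1 b Z W).
Proof.
have h0 := height_gt0; have w0 := width_gt0.
have aq (d e : nat) y : qcls d e ->
  holec (imod width W == alpha d e (imod height y)) = holec (imod width (W - (alpha d e (imod height y))%:Z)%R == 0).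
  by move=> _; rewrite imod0 // alpha_lt // imod_lt.
have aq2 (d e : nat) : qcls d e -> imod height Z = 0 ->
  holec (imod width W == alpha d e (imod height (Z + (kk i j)%:Z)%R)) =
  holec (imod width (W - (2 ^ c (i + (d == 4)%N%:Z)%R (j + (e == 3)%N%:Z)%R)%:Z)%R == 0).
  by move=> q e0; rewrite alpha_arm // imod0 // pow_c_lt.
case: a => [|[|[|[|[|//]]]]] _; case: b => [|[|[|[|//]]]] _; start;
  try (case: (boolP (imod height Z == 0)) => [/eqP ez|/negbTE ez]); rewrite /adjC /memC /= ?imod_lt //= /clsx /clsy /rcls /qcls /= ?andbF ?andbT /= ?h0 /= ?addr0 ?ez //=;
  split; try (by move=> [[] x y z w] //= [] *; subst; rewrite /memC /= /clsx /clsy /rcls /qcls /= ?ez /= ?andbF); finish;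
  first [by rewrite ?aq | by move: (aq2 2 1 isT ez); rewrite /= ?addr0 | by move: (aq2 2 3 isT ez); rewrite /= ?addr0
    | by move: (aq2 4 1 isT ez); rewrite /= ?addr0 | by move: (aq2 4 3 isT ez); rewrite /= ?addr0 | idtac].
Qed.

Lemma cell4_y i j a b Z W : a < 5 -> b < 4 ->
  adjC n sy cp1 cm1 (cell4 i j a b Z W)
    (if b == 3 then cell4 i (j + 1)%R a 0 Z W else cell4 i j a b.+1 Z W).
Proof.
have h0 := height_gt0; have w0 := width_gt0.
case: a => [|[|[|[|[|//]]]]] _; case: b => [|[|[|[|//]]]] _; start;
  try (case: (boolP (imod height Z == 0)) => [/eqP ez|/negbTE ez]); rewrite /adjC /memC /= ?imod_lt //= /clsx /clsy /rcls /qcls /= ?andbF ?andbT /= ?h0 /= ?addr0 ?ez //=;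
  split; try (by move=> [[] x y z w] //= [] *; subst; rewrite /memC /= /clsx /clsy /rcls /qcls /= ?andbF ?ez /= ?andbF); finish;
  by rewrite ?ez.
Qed.

Lemma cell4_z i j a b Z W : a < 5 -> b < 4 ->
  adjC n sz c2 c2 (cell4 i j a b Z W) (cell4 i j a b (Z + 1)%R W).
Proof.
move=> ha hb; have h0 := height_gt0; have w0 := width_gt0.
have m0 := cell4_mem i j Z W ha hb; have m1 := cell4_mem i j (Z + 1)%R W ha hb.
have eS : (Z + 1 + (kk i j)%:Z = Z + (kk i j)%:Z + 1)%R by lia.
move: m0 m1; rewrite /cell4 eS !imodS //.
case: (boolP (rcls a b)) => r.
  move=> m0 _; rewrite /adjC; case: ifP => h.
    by rewrite /sz /=; case/and3P: h => /= -> _ _.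
  case: (ltnP (imod height Z).+1 height) => h1.
    move: h; rewrite memC_sz //= ?h1 // /nonq /clsx /clsy /=.
    have -> : ((if a == 4 then 0 else a.+1) + 4) %% 5 = a by case: (a =P 4); lia.
    have -> : ((if b == 3 then 0 else b.+1) + 3) %% 4 = b by case: (b =P 3); lia.
    by move: r; rewrite /rcls /qcls; lia.
  by split => // -[? ? ? ? ?] [].
case: (boolP (qcls a b)) => q.
  move=> m0 m1; rewrite /adjC.
  have hq : qcls (((if a == 4 then 0 else a.+1) + 4) %% 5) (((if b == 3 then 0 else b.+1) + 3) %% 4).
    have -> : ((if a == 4 then 0 else a.+1) + 4) %% 5 = a by case: (a =P 4); lia.
    by have -> : ((if b == 3 then 0 else b.+1) + 3) %% 4 = b by case: (b =P 3); lia.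
  have hr : ~~ rcls (((if a == 4 then 0 else a.+1) + 4) %% 5) (((if b == 3 then 0 else b.+1) + 3) %% 4).
    by move: hq; rewrite /rcls /qcls; lia.
  have -> : memC (sz (if imod height Z == 0 then Cell KT (if a == 4 then 0 else a.+1) (if b == 3 then 0 else b.+1) 0 (imod width (W - (2 ^ c (i + (a == 4)%N%:Z)%R (j + (b == 3)%N%:Z)%R)%:Z)%R)
     else Cell KF 0 0 0 (imod width (W - (alpha a b (imod height (Z + (kk i j)%:Z)%R))%:Z)%R))) = false.
    by case: (imod height Z == 0); rewrite /memC /= ?andbF // /clsx /clsy /= (negbTE hr) /= !andbF.
  split; first by case: ifP => _; case: ifP => _ u //; case: u => k x y z w [].
  have c2q k x y z w : (k = KT /\ x = (if a == 4 then 0 else a.+1) /\ y = (if b == 3 then 0 else b.+1)) \/ k = KF -> c2 (Cell k x y z w) = 2.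
    by rewrite /c2 /clsx /clsy /= => -[[-> [-> ->]]|->] //; rewrite hq.
  transitivity 2; first by case: ifP => _; apply: c2q; [left | right].
  by symmetry; case: ifP => _; apply: c2q; [left | right].
move=> m0 _; rewrite /adjC; case: ifP => h.
  by rewrite /sz /=; case/and3P: h => /= -> _ _.
case: ifP => h1.
  by move: h; rewrite memC_sz //= ?h1.
by split => // -[? ? ? ? ?] [].
Qed.

Lemma cell4_w i j a b Z W : a < 5 -> b < 4 ->
  adjC n sw c3 c3 (cell4 i j a b Z W) (cell4 i j a b Z (W + 1)%R).
Proof.
move=> ha hb; have h0 := height_gt0; have w0 := width_gt0.
have m0 := cell4_mem i j Z W ha hb.
have eS (x : nat) : (W + 1 - x%:Z = W - x%:Z + 1)%R by lia.
have gen k x y z w : memC (Cell k x y z w) ->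
    adjC n sw c3 c3 (Cell k x y z w) (Cell k x y z (if w.+1 < width then w.+1 else 0)).
  move=> m; rewrite /adjC; case: ifP => h; first by case/and3P: h => /= _ -> _.
  have -> : w.+1 < width = false by move: m h; rewrite /memC /= => /and3P[-> _ ->]; rewrite andbT.
  by split => // -[? ? ? ? ?] [].
move: m0; rewrite /cell4 !eS !imodS //.
case: (rcls a b); first exact: gen.
case: (qcls a b); last exact: gen.
by case: (imod height Z == 0); exact: gen.
Qed.

Definition config X Y Z W := cell4 (divz X 5) (divz Y 4) `|(X %% 5)%Z| `|(Y %% 4)%Z| Z W.

Lemma config_coloured : coloured4 n HR VR config.
Proof.
move=> X Y Z W; have ha : `|(X %% 5)%Z| < 5 by lia. have hb : `|(Y %% 4)%Z| < 4 by lia.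
split.
- exact: cell4_mem.
- have := cell4_x (divz X 5) (divz Y 4) Z W ha hb; congr adjC; rewrite /config; case: ifP => h.
    have -> : divz (X + 1)%R 5 = (divz X 5 + 1)%R by lia.
    by have -> : `|((X + 1)%R %% 5)%Z| = 0 by lia.
  have -> : divz (X + 1)%R 5 = divz X 5 by lia.
  by have -> : `|((X + 1)%R %% 5)%Z| = `|(X %% 5)%Z|.+1 by lia.
- have := cell4_y (divz X 5) (divz Y 4) Z W ha hb; congr adjC; rewrite /config; case: ifP => h.
    have -> : divz (Y + 1)%R 4 = (divz Y 4 + 1)%R by lia.
    by have -> : `|((Y + 1)%R %% 4)%Z| = 0 by lia.
  have -> : divz (Y + 1)%R 4 = divz Y 4 by lia.
  by have -> : `|((Y + 1)%R %% 4)%Z| = `|(Y %% 4)%Z|.+1 by lia.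
- exact: cell4_z.
- exact: cell4_w.
Qed.

End Complete.

Theorem coloured_sft n HR VR : (forall a, ~~ HR a a) -> (forall a, ~~ VR a a) ->
  (exists f, coloured4 n HR VR f) <-> sft n HR VR.
Proof.
move=> h1 h2; split; first by case=> f; exact: sft_of_coloured.
by case=> c cP; exists (config n HR VR c); exact: config_coloured.
Qed.

(** * Cells as vectors of the 4-dimensional lattice *)

Section Vectors.
Context (n : nat) (HR VR : nat -> nat -> bool).

Definition o0 : 'I_4 := @Ordinal 4 0 isT.
Definition o1 : 'I_4 := @Ordinal 4 1 isT.
Definition o2 : 'I_4 := @Ordinal 4 2 isT.
Definition o3 : 'I_4 := @Ordinal 4 3 isT.

Lemma ord4_ind (P : 'I_4 -> Prop) : P o0 -> P o1 -> P o2 -> P o3 -> forall i, P i.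
Proof.
move=> p0 p1 p2 p3 [[|[|[|[|//]]]] h].
- by rewrite (_ : Ordinal h = o0) //; apply: val_inj.
- by rewrite (_ : Ordinal h = o1) //; apply: val_inj.
- by rewrite (_ : Ordinal h = o2) //; apply: val_inj.
- by rewrite (_ : Ordinal h = o3) //; apply: val_inj.
Qed.

Definition cell_of (k : kind) (c : pt) : cell :=
  Cell k `|c 0%R o0| `|c 0%R o1| `|c 0%R o2| `|c 0%R o3|.
Definition vec_of (s : cell) : pt := (\row_i nth 0 [:: (cx s)%:Z; (cy s)%:Z; (cz s)%:Z; (cw s)%:Z] i)%R.

Definition memV (k : kind) (c : pt) : bool := [forall i, 0 <= c ord0 i]%R && memC n (cell_of k c).

Definition up (i : 'I_4) : cell -> cell :=
  match val i with 0 => sx | 1 => sy | 2 => sz | _ => sw end.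
Definition cpC (i : nat) : cell -> nat :=
  match i with 0 => cp0 n HR VR | 1 => cp1 | 2 => c2 | _ => c3 end.
Definition cmC (i : nat) : cell -> nat :=
  match i with 0 => cm0 | 1 => cm1 | 2 => c2 | _ => c3 end.
(* The reduction modulo 43 does not change the colours of genuine cells. *)
Definition cpV (k : kind) (i : 'I_4) (c : pt) : nat := cpC i (cell_of k c) %% 43.
Definition cmV (k : kind) (i : 'I_4) (c : pt) : nat := cmC i (cell_of k c) %% 43.

Lemma cpV_le k i c : cpV k i c <= 42. Proof. by rewrite -ltnS ltn_pmod. Qed.
Lemma cmV_le k i c : cmV k i c <= 42. Proof. by rewrite -ltnS ltn_pmod. Qed.

Lemma code_cls_lt a b t : a < 5 -> b < 4 -> code_cls a b t < 43.
Proof. by rewrite /code_cls; case: t; lia. Qed.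

Lemma holec_lt t : holec t < 43. Proof. by case: t. Qed.

Lemma cpC_lt s i : memC n s -> cpC i s < 43.
Proof.
move=> /cls_lt [h1 h2]; case: i => [|[|[|i]]] /=; rewrite /cp0 /cp1 /c2 /c3;
  repeat case: ifP => // _; rewrite ?holec_lt // code_cls_lt ?ltn_pmod //.
Qed.

Lemma cmC_lt s i : memC n s -> cmC i s < 43.
Proof.
move=> /cls_lt [h1 h2]; case: i => [|[|[|i]]] /=; rewrite /cm0 /cm1 /c2 /c3;
  repeat case: ifP => // _; rewrite ?holec_lt // code_cls_lt ?ltn_pmod //.
Qed.

Lemma vec_ofK k (c : pt) : (forall i, 0 <= c ord0 i)%R -> vec_of (cell_of k c) = c.
Proof.
move=> h; apply/rowP; apply: ord4_ind; rewrite mxE /= gez0_abs //; exact: h.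
Qed.

Lemma cell_ofK s : cell_of (knd s) (vec_of s) = s.
Proof. by case: s => k x y z w; rewrite /cell_of !mxE. Qed.

Lemma vec_of_ge0 s i : (0 <= vec_of s ord0 i)%R.
Proof. by move: i; apply: ord4_ind; rewrite mxE. Qed.

Lemma vec_of_mem s : memV (knd s) (vec_of s) = memC n s.
Proof.
by rewrite /memV cell_ofK; case: forallP => // h; exfalso; apply: h => i; exact: vec_of_ge0.
Qed.

Lemma memVP k c : memV k c -> exists s, [/\ memC n s, knd s = k & c = vec_of s].
Proof. by case/andP => /forallP h m; exists (cell_of k c); rewrite vec_ofK. Qed.

Lemma vec_of_up i s : vec_of (up i s) = (vec_of s + ee i)%R.
Proof.
by apply/rowP; move: i; apply: ord4_ind; apply: ord4_ind; case: s => k x y z w; rewrite !mxE /=; lia.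
Qed.

Lemma knd_up i s : knd (up i s) = knd s.
Proof. by move: i; apply: ord4_ind. Qed.

Lemma vec_of_inj s t : knd s = knd t -> vec_of s = vec_of t -> s = t.
Proof. by move=> e1 e2; rewrite -(cell_ofK s) e2 e1 cell_ofK. Qed.

Lemma mem_back i t : memV (knd t) (vec_of t - ee i)%R = false <-> (forall u, up i u = t -> ~~ memC n u).
Proof.
split => [h u e|h].
  by rewrite -vec_of_mem; move: h; rewrite -e vec_of_up addrK knd_up => ->.
apply/negP => /memVP[u [m e1 e2]]; have := h u; rewrite m => /(_ _)/negP; case=> //.
by apply: vec_of_inj; rewrite ?knd_up // vec_of_up -e2 subrK.
Qed.

Lemma adj_adjC i s t : memC n s -> memC n t ->
  (adj memV cpV cmV i (knd s, vec_of s) (knd t, vec_of t) <-> adjC n (up i) (cpC i) (cmC i) s t).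
Proof.
move=> ms mt; rewrite /adj /adjC /= -vec_of_up -(knd_up i s) vec_of_mem; case: ifP => h.
  split; last by move=> ->.
  by case=> e1 e2; apply: vec_of_inj.
rewrite /cpV /cmV !cell_ofK (knd_up i s) cell_ofK !modn_small ?cpC_lt ?cmC_lt //.
by split => -[h1 h2]; split => //; [apply/mem_back/negbTE | apply/negPf/mem_back].
Qed.

Definition vec4 (X Y Z W : int) : pt := (\row_i nth 0 [:: X; Y; Z; W] i)%R.

Lemma vec4S X Y Z W : [/\ vec4 (X + 1)%R Y Z W = (vec4 X Y Z W + ee o0)%R,
  vec4 X (Y + 1)%R Z W = (vec4 X Y Z W + ee o1)%R, vec4 X Y (Z + 1)%R W = (vec4 X Y Z W + ee o2)%R
  & vec4 X Y Z (W + 1)%R = (vec4 X Y Z W + ee o3)%R].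
Proof.
by split; apply/rowP; apply: ord4_ind; rewrite !mxE /=; lia.
Qed.

Lemma vec4K (v : pt) : vec4 (v ord0 o0) (v ord0 o1) (v ord0 o2) (v ord0 o3) = v.
Proof. by apply/rowP; apply: ord4_ind; rewrite mxE. Qed.

Lemma coloured_coloured4 : (exists Phi, coloured memV cpV cmV Phi) <-> (exists f, coloured4 n HR VR f).
Proof.
split.
  move=> [Phi [ok1 ok2]].
  have sP p : memC n (cell_of (Phi p).1 (Phi p).2) /\ Phi p = (knd (cell_of (Phi p).1 (Phi p).2), vec_of (cell_of (Phi p).1 (Phi p).2)).
    by have /andP[/forallP h m] := ok1 p; rewrite vec_ofK //; case: (Phi p) m.
  pose g p := cell_of (Phi p).1 (Phi p).2.
  have ok3 p i : adjC n (up i) (cpC i) (cmC i) (g p) (g (p + ee i)%R).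
    have [m1 e1] := sP p; have [m2 e2] := sP (p + ee i)%R.
    by apply/adj_adjC => //; rewrite /g -e1 -e2.
  exists (fun X Y Z W => g (vec4 X Y Z W)) => X Y Z W; have [-> -> -> ->] := vec4S X Y Z W.
  split; [by case: (sP (vec4 X Y Z W)) | exact: (ok3 _ o0) | exact: (ok3 _ o1) | exact: (ok3 _ o2) | exact: (ok3 _ o3)].
move=> [f fP]; pose g (p : pt) := f (p ord0 o0) (p ord0 o1) (p ord0 o2) (p ord0 o3).
have gE X Y Z W : g (vec4 X Y Z W) = f X Y Z W by rewrite /g !mxE.
have gm p : memC n (g p) by case: (fP (p ord0 o0) (p ord0 o1) (p ord0 o2) (p ord0 o3)).
exists (fun p => (knd (g p), vec_of (g p))); split => [p|p i] /=; first by rewrite vec_of_mem.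
apply/adj_adjC => //; rewrite -{1 2}[p]vec4K gE; set X := p _ _; set Y := p _ _; set Z := p _ _; set W := p _ _.
have [e0 e1 e2 e3] := vec4S X Y Z W; have [_ a0 a1 a2 a3] := fP X Y Z W.
by move: i; apply: ord4_ind; rewrite -?e0 -?e1 -?e2 -?e3 gE.
Qed.

End Vectors.

(** * The three polyhypercubes *)

Section ThreeTiles.
Context (n : nat) (HR VR : nat -> nat -> bool) (n0 : 0 < n).

Lemma height0 : 0 < height n. Proof. by rewrite expn_gt0 n0. Qed.
Lemma width0 : 0 < width n. Proof. by rewrite expn_gt0. Qed.

Definition root_cell (k : kind) := match k with KF => Cell KF 0 0 0 0 | _ => Cell k 1 1 0 0 end.

Lemma root_cell_mem k : memC n (root_cell k).
Proof. by case: k; rewrite /memC /= height0 width0. Qed.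

(** From any cell one can decrease w, then z (a cell at an arm place already has z = 0), and finally
    walk within the planar shape of the tile, checked cell by cell. *)
Lemma cell_path k (P : cell -> Prop) :
  (forall s i, memC n s -> memC n (up i s) -> knd s = k -> (P s <-> P (up i s))) ->
  forall s, memC n s -> knd s = k -> (P s <-> P (root_cell k)).
Proof.
move=> h; have hh := height0; have hw := width0.
have hW x y z w : memC n (Cell k x y z w) -> P (Cell k x y z w) <-> P (Cell k x y z 0).
  elim: w => [//|w IH] m; have m' : memC n (Cell k x y z w).
    by move: m; rewrite /memC /clsx /clsy /= => /and3P[-> h2 ->]; rewrite (ltnW h2).
  by rewrite -(IH m'); symmetry; exact: (h (Cell k x y z w) o3).
have hZ x y z : memC n (Cell k x y z 0) -> nonq (Cell k x y z 0) -> P (Cell k x y z 0) <-> P (Cell k x y 0 0).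
  elim: z => [//|z IH] m q; have m' : memC n (Cell k x y z 0).
    move: m q; rewrite /nonq /memC /clsx /clsy /= => /and3P[h1 _ h3]; rewrite (ltnW h1) hw.
    move: h3; case: (k) => /=; [by move=> -> | | by case/and3P].
    by move=> /and3P[-> -> h3] /negbTE q; move: h3; rewrite q !orbF => ->.
  by rewrite -(IH m') //; symmetry; exact: (h (Cell k x y z 0) o2).
have hxy s : memC n s -> knd s = k -> P s <-> P (Cell k (cx s) (cy s) 0 0).
  case: s => k' x y z w m /= e; subst k'; rewrite hW //.
  have m' : memC n (Cell k x y z 0) by move: m; rewrite /memC /clsx /clsy /= => /and3P[h1 _ h3]; rewrite h1 hw.
  case q : (nonq (Cell k x y z 0)); first exact: hZ.
  have -> // : z = 0.
  move: m' q; rewrite /memC /nonq /clsx /clsy /=; case: (k) => /= /and3P[_ _ h1].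
  - by move/negbFE => h2; move: h1; rewrite h2 !andbF.
  - move/negbFE => h2; case/and3P: h1 => _ _; rewrite h2 /=; move: h2; rewrite /rcls /qcls.
    by case: (z =P 0) => //; lia.
  - by case/and3P: h1 => _ _ /eqP.
move=> s m e; rewrite hxy //; case: s m e => k' x y z w m /= e; subst k'.
have sX a b : memC n (Cell k a b 0 0) -> memC n (Cell k a.+1 b 0 0) -> P (Cell k a b 0 0) <-> P (Cell k a.+1 b 0 0).
  by move=> m1 m2; exact: (h (Cell k a b 0 0) o0).
have sY a b : memC n (Cell k a b 0 0) -> memC n (Cell k a b.+1 0 0) -> P (Cell k a b 0 0) <-> P (Cell k a b.+1 0 0).
  by move=> m1 m2; exact: (h (Cell k a b 0 0) o1).
clear hW hZ hxy h; case: k m sX sY => m sX sY.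
- have mm a b : 0 < a < 5 -> 0 < b < 4 -> ~~ qcls a b -> memC n (Cell KA a b 0 0).
    by move=> h1 h2 h3; rewrite /memC /= hh hw h1 h2 h3.
  have e1 := sY 1 1 (mm 1 1 isT isT isT) (mm 1 2 isT isT isT).
  have e2 := sY 1 2 (mm 1 2 isT isT isT) (mm 1 3 isT isT isT).
  have e3 := sX 1 2 (mm 1 2 isT isT isT) (mm 2 2 isT isT isT).
  have e4 := sX 2 2 (mm 2 2 isT isT isT) (mm 3 2 isT isT isT).
  have e5 := sX 3 2 (mm 3 2 isT isT isT) (mm 4 2 isT isT isT).
  have e6 := sY 3 1 (mm 3 1 isT isT isT) (mm 3 2 isT isT isT).
  have e7 := sY 3 2 (mm 3 2 isT isT isT) (mm 3 3 isT isT isT).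
  case/and3P: m => _ _ /= /and3P[]; case: x => [|[|[|[|[|//]]]]] // _; case: y => [|[|[|[|//]]]] // _ _; tauto.
- have mm a b : a < 5 -> b < 4 -> rcls (clsx (Cell KT a b 0 0)) (clsy (Cell KT a b 0 0)) || qcls (clsx (Cell KT a b 0 0)) (clsy (Cell KT a b 0 0)) -> memC n (Cell KT a b 0 0).
    by move=> h1 h2 h3; rewrite /memC /= hh hw h1 h2 andbT.
  have e1 := sX 0 1 (mm 0 1 isT isT isT) (mm 1 1 isT isT isT).
  have e2 := sX 1 1 (mm 1 1 isT isT isT) (mm 2 1 isT isT isT).
  have e3 := sX 2 1 (mm 2 1 isT isT isT) (mm 3 1 isT isT isT).
  have e4 := sX 3 1 (mm 3 1 isT isT isT) (mm 4 1 isT isT isT).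
  have e5 := sY 1 0 (mm 1 0 isT isT isT) (mm 1 1 isT isT isT).
  have e6 := sY 1 1 (mm 1 1 isT isT isT) (mm 1 2 isT isT isT).
  have e7 := sY 1 2 (mm 1 2 isT isT isT) (mm 1 3 isT isT isT).
  have e8 := sY 3 1 (mm 3 1 isT isT isT) (mm 3 2 isT isT isT).
  have e9 := sY 3 0 (mm 3 0 isT isT isT) (mm 3 1 isT isT isT).
  have e10 := sY 0 1 (mm 0 1 isT isT isT) (mm 0 2 isT isT isT).
  have e11 := sY 0 0 (mm 0 0 isT isT isT) (mm 0 1 isT isT isT).
  case/and3P: m => _ _ /= /and3P[]; case: x => [|[|[|[|[|//]]]]] // _; case: y => [|[|[|[|//]]]] // _; rewrite /clsx /clsy /= => // _; tauto.
- by case/and3P: m => _ _ /and3P[/= /eqP -> /eqP -> _].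
Qed.

Lemma memV_connected k : cell_connected (memV n) k.
Proof.
move=> P [c [mc pc]] hs c' mc'.
have [s [ms ks es]] := memVP mc; have [s' [ms' ks' es']] := memVP mc'.
pose Q s := P (vec_of s).
have H : forall s i, memC n s -> memC n (up i s) -> knd s = k -> (Q s <-> Q (up i s)).
  move=> t i m1 m2 e; rewrite /Q vec_of_up; apply: hs; first by rewrite -e vec_of_mem.
  by rewrite -vec_of_up -e -(knd_up i) vec_of_mem.
have h1 := cell_path H ms ks; have h2 := cell_path H ms' ks'.
by rewrite es'; apply/h2/h1; rewrite /Q -es.
Qed.

Context (mac : kind -> {fset pt}).
Context (macE : forall k v, (v \in mac k) = inmacro (memV n) (cpV n HR VR) (@cmV) 42 k v).

(** The hub of a cube is in no dent, so the set [mac k] remembers its cells. This tells the three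
    sets apart, as the input must consist of exactly three tiles. *)
Lemma mac_core k c : mk 42 c two \in mac k = memV n k c.
Proof.
rewrite macE inmacro_mk; last exact: two_box.
have free j i : j <= 42 -> ~~ dent j i two by apply: free_ge2.
rewrite /body; case: (memV n k c) => /=.
  by apply/orP; left; apply/forallP => i; rewrite free ?orbT // cmV_le.
by apply/existsPn => i; rewrite /bump (negbTE (free _ _ _)) ?andbF // cpV_le.
Qed.

Lemma mac_neq : [/\ mac KA != mac KT, mac KA != mac KF & mac KT != mac KF].
Proof.
have hh := height0; have hw := width0.
have m k k' s : memC n s -> knd s = k -> (forall t, memC n t -> knd t = k' -> vec_of t <> vec_of s) -> mac k != mac k'.
  move=> ms ks h; apply/eqP => e; have := mac_core k (vec_of s); rewrite e mac_core -ks vec_of_mem ms.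
  by move=> /memVP[t [mt kt et]]; apply: (h t mt kt).
have coord s t : vec_of s = vec_of t -> cx s = cx t /\ cy s = cy t.
  move=> e; split; first by move/rowP: e => /(_ o0); rewrite !mxE /= => -[].
  by move/rowP: e => /(_ o1); rewrite !mxE /= => -[].
split.
- rewrite eq_sym; apply: (m KT KA (Cell KT 0 0 0 0)) => //; first by rewrite /memC /= hh hw.
  by move=> t /and3P[_ _ +] kt /coord[/= e1 e2]; rewrite kt e1.
- apply: (m KA KF (root_cell KA)) => //; first exact: root_cell_mem.
  by move=> t /and3P[_ _ +] kt /coord[/= e1 e2]; rewrite kt e1.
- apply: (m KT KF (root_cell KT)) => //; first exact: root_cell_mem.
  by move=> t /and3P[_ _ +] kt /coord[/= e1 e2]; rewrite kt e1.
Qed.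

Lemma mac_poly k : polyhypercube (mac k).
Proof.
apply: (macro_polyhypercube (@cpV_le n HR VR) (@cmV_le) macE (@memV_connected)).
by exists (vec_of (root_cell k)); rewrite -[k in memV n k](_ : knd (root_cell k) = k) ?vec_of_mem ?root_cell_mem //; case: k.
Qed.

Theorem tileable_sft (S : {fset {fset pt}}) : (forall P, P \in S <-> exists k, P = mac k) ->
  (forall a, ~~ HR a a) -> (forall a, ~~ VR a a) -> tileable S <-> sft n HR VR.
Proof.
move=> SE h1 h2; rewrite -(coloured_sft n h1 h2) -coloured_coloured4.
exact: (tileable_coloured (@cpV_le n HR VR) (@cmV_le) macE SE (@memV_connected)).
Qed.

End ThreeTiles.

(** * Hierarchical tilings of the plane *)

Definition podd (z : int) : bool := ((z %% 2)%Z == 1%R).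

Lemma poddS z : podd (z + 1)%R = ~~ podd z. Proof. rewrite /podd; lia. Qed.
Lemma poddB z : podd (z - 1)%R = ~~ podd z. Proof. rewrite /podd; lia. Qed.

Section Wang.
Context (G : finType) (Hr : rel G) (St : bool -> rel G) (Ini Lft Lst : pred G).

(* A tuple is the information carried by a cross: its quadrant in the parent
   cross, whether its level is at least the threshold, what each of its corners
   requires, and the symbols of the two vertical and the two horizontal lines
   that bound its block (false is west or south, true is east or north). *)
Definition tup : Type := ((bool * bool) * bool * {ffun bool * bool -> option (bool * bool)} *
  ({ffun bool -> G} * {ffun bool -> G}))%type.
Definition qx (s : tup) : bool := s.1.1.1.1.
Definition qy (s : tup) : bool := s.1.1.1.2.
Definition lf (s : tup) : bool := s.1.1.2.
Definition ct (s : tup) (dx dy : bool) := s.1.2 (dx, dy).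
Definition lx (s : tup) (d : bool) : G := s.2.1 d.
Definition ly (s : tup) (d : bool) : G := s.2.2 d.

(** The first bit of a requirement says which line is the earlier one, true meaning the vertical;
    the second says whether the threshold is reached. *)
Definition okcorner (s : tup) (d : bool * bool) : bool :=
  match ct s d.1 d.2 with
  | None => true
  | Some (true, f) => St f (lx s d.1) (ly s d.2)
  | Some (false, f) => St f (ly s d.2) (lx s d.1)
  end.
(** The side [~~ qx s] faces the centre of the parent. The line there is an arm of the parent, one
    level above the cross, for which the cross is the last cell. *)
Definition okT (s : tup) : bool :=
  [&& [forall d, okcorner s d], Lst (lx s (~~ qx s)) & Lst (ly s (~~ qy s))].
Definition ok0 (s : tup) : bool :=
  [&& okT s, [forall d, Lft (lx s d) && Lft (ly s d)],
      Ini (lx s (~~ qx s)) & Ini (ly s (~~ qy s))].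

(* The corner (dx, dy) of the child with quadrant (qx c, qy c) is a corner of
   the parent p, its centre, or the end of one of its arms. *)
Definition inherit (p c : tup) (d : bool * bool) : option (bool * bool) :=
  if d.1 == qx c then
    if d.2 == qy c then ct p d.1 d.2 else if d.1 != qx p then Some (false, lf p) else None
  else if d.2 == qy c then if d.2 != qy p then Some (true, lf p) else None else None.
Definition okPC (p c : tup) : bool :=
  [&& [forall d, ct c d.1 d.2 == inherit p c d], Hr (ly c (qy c)) (ly p (qy c))
    & Hr (lx c (qx c)) (lx p (qx c))].

(* An edge knows the cross whose arm goes through it, whether it lies to the east
   or north of the centre of that cross, and whether it lies on the inner half of
   the arm. *)
Definition col : Type := (tup * bool * bool)%type.
Definition ctup (c : col) : tup := c.1.1.
Definition csd (c : col) : bool := c.1.2.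
Definition cin (c : col) : bool := c.2.

Definition wtile : Type := ((bool * bool) * (col * col * (col * col)))%type.
Definition bx (t : wtile) := t.1.1.
Definition by_ (t : wtile) := t.1.2.
Definition eW (t : wtile) : col := t.2.1.1.
Definition eE (t : wtile) : col := t.2.1.2.
Definition eS (t : wtile) : col := t.2.2.1.
Definition eN (t : wtile) : col := t.2.2.2.

(** [fl] tells whether the edges at the centre lie on the inner halves of the arms. It is false at
    level 0 only, where an arm is a single edge. *)
Definition isC (fl : bool) (t : wtile) : bool :=
  let s := ctup (eW t) in
  [&& eW t == (s, false, fl), eE t == (s, true, fl), eS t == (s, false, fl) & eN t == (s, true, fl)].

(** The crosses facing each other across the tile are then the northern and the southern child of
    one parent, so the tile lies halfway on an arm of that parent. *)
Definition flipH (t : wtile) : bool := qy (ctup (eN t)) && ~~ qy (ctup (eS t)).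
Definition flipV (t : wtile) : bool := qx (ctup (eE t)) && ~~ qx (ctup (eW t)).

(** A horizontal arm passes where two vertical arms end. The quadrants of their crosses alternate,
    which places the crosses of the next level. At a flip the passing arm changes between its inner
    and its outer half and its cross is compared with both children; the two horizontal arms thus
    reach all four. *)
Definition isH (t : wtile) : bool :=
  let u := ctup (eN t) in let d := ctup (eS t) in
  [&& (eE t).1 == (eW t).1, ~~ csd (eN t), ~~ cin (eN t), csd (eS t) & ~~ cin (eS t)] &&
  [&& qx u == qx d, qy u != qy d, [forall e, lx u e == lx d e], ly u false == ly d true &
    if flipH t then [&& csd (eW t) == qx u, cin (eW t) == qx u, cin (eE t) == ~~ qx u,
      okPC (ctup (eW t)) u & okPC (ctup (eW t)) d]
    else cin (eW t) == cin (eE t)].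

Definition isV (t : wtile) : bool :=
  let r := ctup (eE t) in let l := ctup (eW t) in
  [&& (eN t).1 == (eS t).1, csd (eW t), ~~ cin (eW t), ~~ csd (eE t) & ~~ cin (eE t)] &&
  [&& qy l == qy r, qx l != qx r, [forall e, ly l e == ly r e], lx l true == lx r false &
    if flipV t then [&& csd (eS t) == qy l, cin (eS t) == qy l & cin (eN t) == ~~ qy l]
    else cin (eS t) == cin (eN t)].

Definition validT (t : wtile) : bool :=
  if bx t then if by_ t then isC false t && ok0 (ctup (eW t)) else isH t
  else if by_ t then isV t else [|| isC true t && okT (ctup (eW t)), isH t | isV t].

(** Modes 0, 1, 2 are centres of crosses: of level 0, below the threshold, from the threshold on.
    Mode 3 is a horizontal flip, where the row has the level of the parent and the column that of
    the children; this is how levels are counted. *)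
Definition tmode (t : wtile) : nat :=
  if isC true t then if lf (ctup (eW t)) then 2 else 1
  else if isC false t then 0 else if isH t && flipH t then 3 else 4.

(* kh and kv are the levels, truncated at N, of the row and of the column. *)
Definition modeok (N m kh kv : nat) : bool :=
  match m with
  | 0 => (kh == 0) && (kv == 0)
  | 1 => (kh == kv) && (kh < N)
  | 2 => (kh == N) && (kv == N)
  | 3 => kh == minn kv.+1 N
  | _ => true
  end.

(** * Renormalisation: every valid configuration is a hierarchy of crosses *)

Section Sound.
Context (N : nat) (N0 : 0 < N).

Record wang (t : int -> int -> wtile) (kh kv : int -> nat) : Prop := Wang {
  wang_valid : forall x y, validT (t x y);
  wang_mode : forall x y, modeok N (tmode (t x y)) (kh y) (kv x);
  wang_E : forall x y, eE (t x y) = eW (t (x + 1)%R y);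
  wang_N : forall x y, eN (t x y) = eS (t x (y + 1)%R);
  wang_bx : forall x y, bx (t x y) = podd x;
  wang_by : forall x y, by_ (t x y) = podd y }.

Definition crs (t : int -> int -> wtile) i j : tup := ctup (eW (t i j)).

(** The invariant of the renormalisation: after k steps the configuration on the remaining points
    looks like a valid one whose smallest crosses, at the odd points, have level k. *)
Record level (k : nat) (t : int -> int -> wtile) (kh kv : int -> nat) : Prop := Level {
  lC : forall i j, podd i -> podd j -> exists fl, isC fl (t i j);
  lT : forall i j, podd i -> podd j -> if k is 0 then ok0 (crs t i j) else okT (crs t i j) && (lf (crs t i j) == (N <= k));
  lH : forall i j, podd i -> ~~ podd j -> [/\ isH (t i j), ctup (eN (t i j)) = crs t i (j + 1)%R
    & ctup (eS (t i j)) = crs t i (j - 1)%R];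
  lV : forall i j, ~~ podd i -> podd j -> [/\ isV (t i j), ctup (eE (t i j)) = crs t (i + 1)%R j
    & ctup (eW (t i j)) = crs t (i - 1)%R j];
  lX : forall i j, ~~ podd i -> ~~ podd j -> [|| isC true (t i j) && okT (ctup (eW (t i j))), isH (t i j) | isV (t i j)];
  lE : forall i j, ~~ podd j -> eE (t i j) = eW (t (i + 1)%R j);
  lN : forall i j, ~~ podd i -> eN (t i j) = eS (t i (j + 1)%R);
  lmode : forall i j, modeok N (tmode (t i j)) (kh j) (kv i);
  lkh : forall j, podd j -> kh j = minn k N;
  lkv : forall i, podd i -> kv i = minn k N }.


Lemma isC_edges fl t : isC fl t -> [/\ eW t = (ctup (eW t), false, fl), eE t = (ctup (eW t), true, fl),
  eS t = (ctup (eW t), false, fl) & eN t = (ctup (eW t), true, fl)].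
Proof. by case/and4P => /eqP e1 /eqP e2 /eqP e3 /eqP e4; split. Qed.

Lemma isC_mode0 t : isC false t -> tmode t = 0.
Proof.
move=> h; rewrite /tmode h; case: ifP => // h'.
by have [e1 _ _ _] := isC_edges h; have [e2 _ _ _] := isC_edges h'; move: e2; rewrite e1 /=; case.
Qed.

Lemma isH_mode t : isH t -> flipH t -> tmode t = 3.
Proof.
move=> h f; rewrite /tmode h f /=.
have C fl : isC fl t = false.
  by apply/negP => /isC_edges [_ _ _ e]; case/andP: h => /and5P[_ + _ _ _] _; rewrite e.
by rewrite !C.
Qed.

Lemma level0 t kh kv : wang t kh kv -> level 0 t kh kv.
Proof.
move=> w; have c0 i j : podd i -> podd j -> isC false (t i j) && ok0 (crs t i j).
  by move=> hi hj; have := wang_valid w i j; rewrite /validT (wang_bx w) (wang_by w) hi hj.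
split.
- by move=> i j hi hj; exists false; case/andP: (c0 i j hi hj).
- by move=> i j hi hj; case/andP: (c0 i j hi hj).
- move=> i j hi hj; have := wang_valid w i j; rewrite /validT (wang_bx w) (wang_by w) hi (negbTE hj) => h; split => //.
    rewrite (wang_N w); have /andP[/isC_edges[_ _ -> _] _] := c0 i (j + 1)%R hi ltac:(by rewrite poddS).
    by [].
  have /andP[/isC_edges[_ _ _ e] _] := c0 i (j - 1)%R hi ltac:(by rewrite poddB).
  by have := wang_N w i (j - 1)%R; rewrite subrK e => <-.
- move=> i j hi hj; have := wang_valid w i j; rewrite /validT (wang_bx w) (wang_by w) hj (negbTE hi) => h; split => //.
    by rewrite (wang_E w).
  have /andP[/isC_edges[_ e _ _] _] := c0 (i - 1)%R j ltac:(by rewrite poddB) hj.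
  by have := wang_E w (i - 1)%R j; rewrite subrK e => <-.
- by move=> i j hi hj; have := wang_valid w i j; rewrite /validT (wang_bx w) (wang_by w) (negbTE hi) (negbTE hj).
- by move=> i j _; exact: (wang_E w).
- by move=> i j _; exact: (wang_N w).
- by move=> i j; exact: (wang_mode w).
- move=> j hj; have /andP[h _] := c0 1%R j isT hj.
  by have := wang_mode w 1%R j; rewrite (isC_mode0 h) /= min0n => /andP[/eqP].
- move=> i hi; have /andP[h _] := c0 i 1%R hi isT.
  by have := wang_mode w i 1%R; rewrite (isC_mode0 h) /= min0n => /andP[_ /eqP].
Qed.

Section Next.
Context (k : nat) (t : int -> int -> wtile) (kh kv : int -> nat) (lev : level k t kh kv).

Local Notation c := (crs t).
(** The even points are kept at each step. The quadrant of the cross at (1, 1) decides how to index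
    them so that the centres between four siblings get odd indices. *)
Definition offx : int := if qx (c 1%R 1%R) then 1%R else 0%R.
Definition offy : int := if qy (c 1%R 1%R) then 1%R else 0%R.
Definition nt i j := t (2 * (i + offx))%R (2 * (j + offy))%R.
Definition nkh j := kh (2 * (j + offy))%R.
Definition nkv i := kv (2 * (i + offx))%R.

Lemma q_x i j : podd i -> podd j -> qx (c (i + 2)%R j) = ~~ qx (c i j) /\ qy (c (i + 2)%R j) = qy (c i j).
Proof.
move=> hi hj; have [h e1 e2] := lV lev (i := (i + 1)%R) (j := j) ltac:(by rewrite poddS negbK) hj.
have e3 : (i + 1 + 1 = i + 2)%R by lia.
move: e1 e2; rewrite e3 addrK => e1 e2.
by case/andP: h => _ /and5P[]; rewrite e1 e2 => /eqP -> h _ _ _; split => //; move: h; case: (qx _); case: (qx _).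
Qed.

Lemma q_y i j : podd i -> podd j -> qy (c i (j + 2)%R) = ~~ qy (c i j) /\ qx (c i (j + 2)%R) = qx (c i j).
Proof.
move=> hi hj; have [h e1 e2] := lH lev (i := i) (j := (j + 1)%R) hi ltac:(by rewrite poddS negbK).
have e3 : (j + 1 + 1 = j + 2)%R by lia.
move: e1 e2; rewrite e3 addrK => e1 e2.
by case/andP: h => _ /and5P[]; rewrite e1 e2 => /eqP -> h _ _ _; split => //; move: h; case: (qy _); case: (qy _).
Qed.

Lemma podd_mid (x : int) : podd (2 * x + 1)%R. Proof. rewrite /podd; lia. Qed.
Lemma podd_even (x : int) : podd (2 * x)%R = false. Proof. rewrite /podd; lia. Qed.

Lemma quad p q : qx (c (2 * (p + offx) + 1)%R (2 * (q + offy) + 1)%R) = podd p /\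
  qy (c (2 * (p + offx) + 1)%R (2 * (q + offy) + 1)%R) = podd q.
Proof.
have H p' q' : qx (c (2 * p' + 1)%R (2 * q' + 1)%R) = podd p' (+) qx (c 1%R 1%R) /\
               qy (c (2 * p' + 1)%R (2 * q' + 1)%R) = podd q' (+) qy (c 1%R 1%R).
  have sx (z : int) : (2 * (z + 1) + 1 = 2 * z + 1 + 2)%R by lia.
  have Hx q0 : qx (c (2 * p' + 1)%R (2 * q0 + 1)%R) = podd p' (+) qx (c 1%R (2 * q0 + 1)%R) /\
     qy (c (2 * p' + 1)%R (2 * q0 + 1)%R) = qy (c 1%R (2 * q0 + 1)%R).
    apply: (@iff_line (fun z => qx (c (2 * z + 1)%R (2 * q0 + 1)%R) = podd z (+) qx (c 1%R (2 * q0 + 1)%R) /\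
     qy (c (2 * z + 1)%R (2 * q0 + 1)%R) = qy (c 1%R (2 * q0 + 1)%R)) 0%R) => [z|//].
    rewrite sx; have [-> ->] := q_x (podd_mid z) (podd_mid q0); rewrite poddS addNb.
    by split => -[h1 h2]; split => //; [rewrite h1 | apply: negb_inj].
  have Hy : qy (c 1%R (2 * q' + 1)%R) = podd q' (+) qy (c 1%R 1%R) /\ qx (c 1%R (2 * q' + 1)%R) = qx (c 1%R 1%R).
    apply: (@iff_line (fun z => qy (c 1%R (2 * z + 1)%R) = podd z (+) qy (c 1%R 1%R) /\
     qx (c 1%R (2 * z + 1)%R) = qx (c 1%R 1%R)) 0%R) => [z|//].
    rewrite sx; have [-> ->] := q_y (i := 1%R) isT (podd_mid z); rewrite poddS addNb.
    by split => -[h1 h2]; split => //; [rewrite h1 | apply: negb_inj].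
  by have [-> ->] := Hx q'; case: Hy => -> ->.
have [-> ->] := H (p + offx)%R (q + offy)%R; rewrite /offx /offy.
by split; case: ifP => _; rewrite ?addr0 ?poddS ?addbT ?negbK ?addbF.
Qed.

Lemma quad' p q : [/\ qx (c (2 * (p + offx) - 1)%R (2 * (q + offy) + 1)%R) = ~~ podd p,
  qy (c (2 * (p + offx) - 1)%R (2 * (q + offy) + 1)%R) = podd q,
  qx (c (2 * (p + offx) + 1)%R (2 * (q + offy) - 1)%R) = podd p &
  qy (c (2 * (p + offx) + 1)%R (2 * (q + offy) - 1)%R) = ~~ podd q].
Proof.
have e (x o : int) : (2 * (x + o) - 1 = 2 * ((x - 1) + o) + 1)%R by lia.
rewrite !e; have [-> ->] := quad (p - 1)%R q; have [-> ->] := quad p (q - 1)%R.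
by rewrite !poddB.
Qed.

(* The wire between two consecutive nodes of the next level passes through a
   node of this level. *)
Lemma midH I J : (eW (nt (I + 1)%R J)).1 = (eE (nt I J)).1 /\
    if podd J then [/\ csd (eE (nt I J)) = podd I, cin (eE (nt I J)) = podd I,
        cin (eW (nt (I + 1)%R J)) = ~~ podd I, nkh J = minn k.+1 N &
        okPC (ctup (eE (nt I J))) (c (2 * (I + offx) + 1)%R (2 * (J + offy) + 1)%R) &&
        okPC (ctup (eE (nt I J))) (c (2 * (I + offx) + 1)%R (2 * (J + offy) - 1)%R)]
    else eW (nt (I + 1)%R J) = eE (nt I J).
Proof.
have [h e1 e2] := lH lev (i := (2 * (I + offx) + 1)%R) (j := (2 * (J + offy))%R) (podd_mid _) ltac:(by rewrite podd_even).
have a1 : eE (nt I J) = eW (t (2 * (I + offx) + 1)%R (2 * (J + offy))%R) by rewrite /nt (lE lev) ?podd_even.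
have a2 : eW (nt (I + 1)%R J) = eE (t (2 * (I + offx) + 1)%R (2 * (J + offy))%R).
  by rewrite (lE lev) ?podd_even // /nt; congr (eW (t _ _)); lia.
have [q1 q2] := quad I J; have [_ _ q3 q4] := quad' I J.
have fl : flipH (t (2 * (I + offx) + 1)%R (2 * (J + offy))%R) = podd J.
  by rewrite /flipH e1 e2 q2 q4 negbK andbb.
have md := lmode lev (2 * (I + offx) + 1)%R (2 * (J + offy))%R.
split; first by rewrite a1 a2; case/andP: h => /and5P[/eqP -> _ _ _ _] _.
case: ifP => hJ.
  move: md; rewrite isH_mode ?fl // (lkv lev (podd_mid _)) => /eqP md.
  case/andP: h => _ /and5P[_ _ _ _]; rewrite fl hJ e1 e2 q1 a1 a2 => /and5P[/eqP f1 /eqP f2 /eqP f3 f4 f5].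
  split => //; last by rewrite f4.
  by rewrite /nkh md; clear; lia.
rewrite a1 a2; case/andP: h => /and5P[/eqP h1 _ _ _ _] /and5P[_ _ _ _]; rewrite fl hJ /cin => /eqP h2.
by move: h1 h2; case: (eE _) => x y; case: (eW _) => x' y' /= -> ->.
Qed.

Lemma midV I J : 
  [/\ (eS (nt I (J + 1)%R)).1 = (eN (nt I J)).1 &
    if podd I then [/\ csd (eN (nt I J)) = podd J, cin (eN (nt I J)) = podd J & cin (eS (nt I (J + 1)%R)) = ~~ podd J]
    else eS (nt I (J + 1)%R) = eN (nt I J)].
Proof.
have [h e1 e2] := lV lev (j := (2 * (J + offy) + 1)%R) (i := (2 * (I + offx))%R) ltac:(by rewrite podd_even) (podd_mid _).
have a1 : eN (nt I J) = eS (t (2 * (I + offx))%R (2 * (J + offy) + 1)%R) by rewrite /nt (lN lev) ?podd_even.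
have a2 : eS (nt I (J + 1)%R) = eN (t (2 * (I + offx))%R (2 * (J + offy) + 1)%R).
  by rewrite (lN lev) ?podd_even // /nt; congr (eS (t _ _)); lia.
have [q1 q2] := quad I J; have [q3 q4 _ _] := quad' I J.
have fl : flipV (t (2 * (I + offx))%R (2 * (J + offy) + 1)%R) = podd I.
  by rewrite /flipV e1 e2 q1 q3 negbK andbb.
split; first by rewrite a1 a2; case/andP: h => /and5P[/eqP -> _ _ _ _] _.
case: ifP => hI.
  case/andP: h => _ /and5P[_ _ _ _]; rewrite fl hI e2 q4 a1 a2 => /and3P[/eqP f1 /eqP f2 /eqP f3].
  by split.
rewrite a1 a2; case/andP: h => /and5P[/eqP h1 _ _ _ _] /and5P[_ _ _ _]; rewrite fl hI /cin => /eqP h2.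
by move: h1 h2; case: (eN _) => x y; case: (eS _) => x' y' /= -> ->.
Qed.

Lemma nX I J : [|| isC true (nt I J) && okT (ctup (eW (nt I J))), isH (nt I J) | isV (nt I J)].
Proof. by apply: (lX lev); rewrite podd_even. Qed.

(** The flips nearby orient the wires: the northern edge lies on the northern side of its centre and
    the western edge on the western side, whereas [isH] and [isV] require the opposite of the one
    and of the other. *)
Lemma nC I J : podd I -> podd J -> isC true (nt I J) && okT (ctup (eW (nt I J))).
Proof.
move=> hI hJ; have [_ vN] := midV I J; have [hW1 hW] := midH (I - 1)%R J.
move: vN hW1 hW; rewrite hI hJ subrK poddB hI => -[v1 _ _] hW1 [w1 _ _ _ _].
case/or3P: (nX I J) => // /andP[/and5P[_ h1 h2 h3 h4] _]; first by move: h1; rewrite v1.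
by move: h1; rewrite /csd hW1 -/(csd _) w1.
Qed.

Lemma nH I J : podd I -> ~~ podd J -> [/\ isH (nt I J), ctup (eN (nt I J)) = crs nt I (J + 1)%R
    & ctup (eS (nt I J)) = crs nt I (J - 1)%R].
Proof.
move=> hI hJ; have [v0 vN] := midV I J; have [v0' vS] := midV I (J - 1)%R.
move: vN vS v0'; rewrite hI subrK poddB hJ (negbTE hJ) => -[v1 _ v2] [v3 v4 v5] v0'.
have /andP[/isC_edges[_ _ cS cN] _] := nC hI (J := (J + 1)%R) ltac:(by rewrite poddS).
have /andP[/isC_edges[_ _ cS' cN'] _] := nC hI (J := (J - 1)%R) ltac:(by rewrite poddB).
split.
- case/or3P: (nX I J) => // /andP[].
    by case/isC_edges => _ _ _ e; move: v1; rewrite e.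
  case/and5P => /eqP e _ _ _ _; move: v1; rewrite /csd e v0' -/(csd _) v3 //.
- by rewrite /ctup -v0 cS.
- by rewrite /ctup v0' cN'.
Qed.

Lemma nV I J : ~~ podd I -> podd J -> [/\ isV (nt I J), ctup (eE (nt I J)) = crs nt (I + 1)%R J
    & ctup (eW (nt I J)) = crs nt (I - 1)%R J].
Proof.
move=> hI hJ; have [v0 vN] := midH I J; have [v0' vS] := midH (I - 1)%R J.
move: vN vS v0'; rewrite hJ subrK poddB hI (negbTE hI) => -[v1 _ v2 _ _] [v3 v4 v5 _ _] v0'.
have /andP[/isC_edges[cW cE _ _] _] := nC (I := (I + 1)%R) ltac:(by rewrite poddS) hJ.
have /andP[/isC_edges[cW' cE' _ _] _] := nC (I := (I - 1)%R) ltac:(by rewrite poddB) hJ.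
split.
- case/or3P: (nX I J) => // /andP[].
    by case/isC_edges => _ e _ _; move: v1; rewrite e.
  case/and5P => /eqP e _ _ _ _; move: v1; rewrite /csd e v0' -/(csd _) v3 //.
- by rewrite /ctup -v0 cW.
- by rewrite /ctup v0' cE'.
Qed.

Lemma isC_mode1 u : isC true u -> tmode u = if lf (ctup (eW u)) then 2 else 1.
Proof. by rewrite /tmode => ->. Qed.

Lemma next_kv I J : podd I -> podd J -> nkv I = nkh J /\ lf (crs nt I J) = (nkh J == N).
Proof.
move=> hI hJ; have /andP[h _] := nC hI hJ.
have := lmode lev (2 * (I + offx))%R (2 * (J + offy))%R; rewrite isC_mode1 // -/(nkh J) -/(nkv I) /crs.
rewrite -/(nt I J); case: (lf _) => /= /andP[h1 h2]; first by rewrite (eqP h1) (eqP h2) eqxx.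
by split; [rewrite (eqP h1) | apply/esym/eqP; move: h2 => /[swap] ->; rewrite ltnn].
Qed.

Lemma next_kh J : podd J -> nkh J = minn k.+1 N.
Proof. by move=> hJ; have [_] := midH 1%R J; rewrite hJ => -[]. Qed.

Lemma next_level : level k.+1 nt nkh nkv.
Proof.
split.
- by move=> I J hI hJ; exists true; case/andP: (nC hI hJ).
- move=> I J hI hJ; case/andP: (nC hI hJ) => _ ->; have [_ ->] := next_kv hI hJ.
  by rewrite next_kh //=; apply/eqP; lia.
- exact: nH.
- exact: nV.
- by move=> I J _ _; exact: nX.
- by move=> I J hJ; have [_] := midH I J; rewrite (negbTE hJ).
- by move=> I J hI; have [_] := midV I J; rewrite (negbTE hI).
- by move=> I J; exact: (lmode lev).
- exact: next_kh.
- by move=> I hI; have [-> _] := next_kv hI (J := 1%R) isT; rewrite next_kh.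
Qed.

(* The four children of the cross (I, J) of the next level. *)
Lemma children I J (e d : bool) : podd I -> podd J ->
  okPC (crs nt I J) (c (2 * (I + offx) + (if e then 1 else -1))%R (2 * (J + offy) + (if d then 1 else -1))%R).
Proof.
move=> hI hJ; have /andP[/isC_edges[_ eC _ _] _] := nC hI hJ.
have [w0 w] := midH I J; have [w0' w'] := midH (I - 1)%R J.
move: w w' w0'; rewrite hJ subrK => -[_ _ _ _ /andP[a1 a2]] [_ _ _ _ /andP[a3 a4]] w0'.
have e1 : (2 * (I - 1 + offx) + 1 = 2 * (I + offx) - 1)%R by lia.
move: a1 a2 a3 a4; rewrite e1 eC /crs [ctup (eE (nt (I - 1)%R J))]/ctup -w0'.
by case: e; case: d.
Qed.

End Next.

Record state := State { stt : int -> int -> wtile; skh : int -> nat; skv : int -> nat }.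

Definition next (s : state) := State (nt (stt s)) (nkh (stt s) (skh s)) (nkv (stt s) (skv s)).

(** Positions are forgotten: crosses of each level are indexed by pairs of integers, and the offsets
    [a k], [b k] say which indices of level k are siblings. They depend on the tiling and need not
    come from a common origin. *)
Record hierarchy (C : nat -> int -> int -> tup) (a b : nat -> int) : Prop := Hierarchy {
  hq : forall k p q (e d : bool), let s := C k (2 * p + a k + e%:Z)%R (2 * q + b k + d%:Z)%R in
    [/\ qx s = e, qy s = d & okPC (C k.+1 p q) s];
  hx : forall k p q, [/\ forall d, lx (C k p (q + 1)%R) d = lx (C k p q) d &
    lx (C k (p + 1)%R q) false = lx (C k p q) true];
  hy : forall k p q, [/\ forall d, ly (C k (p + 1)%R q) d = ly (C k p q) d &
    ly (C k p (q + 1)%R) false = ly (C k p q) true];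
  hT : forall k p q, okT (C k p q) /\ lf (C k.+1 p q) = (N <= k.+1);
  h0 : forall p q, ok0 (C 0 p q) }.

Lemma wang_hierarchy t kh kv : wang t kh kv -> exists C a b, hierarchy C a b.
Proof.
move=> w; pose F k := iter k next (State t kh kv).
have lev k : level k (stt (F k)) (skh (F k)) (skv (F k)).
  by elim: k => [|k IH]; [exact: level0 | exact: next_level IH].
exists (fun k p q => crs (stt (F k)) (2 * p + 1)%R (2 * q + 1)%R),
  (fun k => offx (stt (F k))), (fun k => offy (stt (F k))); split.
- move=> k p q e d s.
  have [q1 q2] := quad (lev k) (2 * p + e%:Z)%R (2 * q + d%:Z)%R.
  have es : s = crs (stt (F k)) (2 * (2 * p + e%:Z + offx (stt (F k))) + 1)%R (2 * (2 * q + d%:Z + offy (stt (F k))) + 1)%R.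
    by rewrite /s; congr crs; lia.
  rewrite es q1 q2; split; [case: (e); rewrite /podd; lia | case: (d); rewrite /podd; lia|].
  have := children (lev k) e d (podd_mid p) (podd_mid q).
  by congr okPC; congr crs; [case: (e) | case: (d)]; lia.
- move=> k p q; have [h e1 e2] := lH (lev k) (i := (2 * p + 1)%R) (j := (2 * q + 2)%R) (podd_mid _) ltac:(rewrite /podd; lia).
  have [h' e1' e2'] := lV (lev k) (i := (2 * p + 2)%R) (j := (2 * q + 1)%R) ltac:(rewrite /podd; lia) (podd_mid _).
  split => [d|].
    case/andP: h => _ /and5P[_ _ /forallP/(_ d)/eqP + _ _]; rewrite e1 e2.
    have -> : (2 * q + 2 + 1 = 2 * (q + 1) + 1)%R by lia.
    by have -> : (2 * q + 2 - 1 = 2 * q + 1)%R by lia.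
  case/andP: h' => _ /and5P[_ _ _ /eqP + _]; rewrite e1' e2'.
  have -> : (2 * p + 2 + 1 = 2 * (p + 1) + 1)%R by lia.
  by have -> : (2 * p + 2 - 1 = 2 * p + 1)%R by lia.
- move=> k p q; have [h e1 e2] := lV (lev k) (i := (2 * p + 2)%R) (j := (2 * q + 1)%R) ltac:(rewrite /podd; lia) (podd_mid _).
  have [h' e1' e2'] := lH (lev k) (i := (2 * p + 1)%R) (j := (2 * q + 2)%R) (podd_mid _) ltac:(rewrite /podd; lia).
  split => [d|].
    case/andP: h => _ /and5P[_ _ /forallP/(_ d)/eqP + _ _]; rewrite e1 e2.
    have -> : (2 * p + 2 + 1 = 2 * (p + 1) + 1)%R by lia.
    by have -> : (2 * p + 2 - 1 = 2 * p + 1)%R by lia.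
  case/andP: h' => _ /and5P[_ _ _ /eqP + _]; rewrite e1' e2'.
  have -> : (2 * q + 2 + 1 = 2 * (q + 1) + 1)%R by lia.
  by have -> : (2 * q + 2 - 1 = 2 * q + 1)%R by lia.
- move=> k p q; split; last by have /andP[_ /eqP] := lT (lev k.+1) (podd_mid p) (podd_mid q).
  case: k => [|k]; first by have /and4P[] := lT (lev 0) (podd_mid p) (podd_mid q).
  by have /andP[] := lT (lev k.+1) (podd_mid p) (podd_mid q).
- by move=> p q; exact: (lT (lev 0) (podd_mid p) (podd_mid q)).
Qed.

End Sound.
End Wang.

(** * Runs inside a hierarchy *)

Section Run.
Context (G : finType) (Hr : rel G) (St : bool -> rel G) (Ini Lft Lst : pred G).

Record run (N : nat) (g : nat -> nat -> G) : Prop := Run {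
  run_Hr : forall j t, j.+1 < t -> Hr (g j t) (g j.+1 t);
  run_St : forall j t, j < t -> St (N <= t) (g j t) (g j t.+1);
  run_Ini : Ini (g 0 1);
  run_Lft : forall t, 0 < t -> Lft (g 0 t);
  run_Lst : forall t, Lst (g t t.+1) }.

Local Notation tup := (tup G).
Local Notation hierarchy := (hierarchy Hr St Ini Lft Lst).

(** Reflection in the diagonal exchanges the two kinds of lines, so that only steps from a vertical
    to a horizontal line need a proof. *)
Definition tr (s : tup) : tup :=
  ((qy s, qx s), lf s, [ffun d => omap (fun x => (~~ x.1, x.2)) (ct s d.2 d.1)], (s.2.2, s.2.1)).

Lemma forallT (P : pred (bool * bool)) : [forall d : bool * bool, P (d.2, d.1)] = [forall d, P d].
Proof.
by apply/forallP/forallP => h [x y]; [exact: (h (y, x)) | exact: (h (y, x))].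
Qed.

Lemma ct_tr s dx dy : ct (tr s) dx dy = omap (fun x => (~~ x.1, x.2)) (ct s dy dx).
Proof. by rewrite /ct /tr ffunE. Qed.

Lemma okT_tr s : okT St Lst (tr s) = okT St Lst s.
Proof.
rewrite /okT; congr (_ && _); last by rewrite andbC.
rewrite -[RHS]forallT; apply: eq_forallb => -[x y]; rewrite /okcorner ct_tr /=.
by case: (ct s y x) => [[[] f]|].
Qed.

Lemma ok0_tr s : ok0 St Ini Lft Lst (tr s) = ok0 St Ini Lft Lst s.
Proof.
rewrite /ok0 okT_tr; congr (_ && _); congr (_ && _); last by rewrite andbC.
by apply: eq_forallb => d; rewrite andbC.
Qed.

Lemma okPC_tr p s : okPC Hr (tr p) (tr s) = okPC Hr p s.
Proof.
rewrite /okPC; congr (_ && _); last by rewrite andbC.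
rewrite -[RHS]forallT; apply: eq_forallb => -[x y]; rewrite ct_tr /inherit ct_tr /=.
have inj : injective (omap (fun x : bool * bool => (~~ x.1, x.2))).
  by move=> [[[] ?]|] [[[] ?]|] //= [->].
rewrite -[RHS](inj_eq inj); congr (_ == _).
by case: (x == qy s); case: (y == qx s) => //=; case: ifP.
Qed.

Lemma hierarchy_tr N C a b : hierarchy N C a b -> hierarchy N (fun k p q => tr (C k q p)) b a.
Proof.
move=> h; split.
- move=> k p q e d /=; have [h1 h2 h3] := hq h k q p d e; split; [exact: h2 | exact: h1 | by rewrite okPC_tr].
- by move=> k p q; exact: (hy h k q p).
- by move=> k p q; exact: (hx h k q p).
- by move=> k p q; rewrite okT_tr; exact: (hT h k q p).
- by move=> p q; rewrite ok0_tr; exact: (h0 h).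
Qed.

(* The index at level m - d of the line whose index is p at level m. *)
Fixpoint down (a : nat -> int) (m : nat) (p : int) (d : nat) : int :=
  if d is d'.+1 then (2 * down a m p d' + a (m - d)%N + 1)%R else p.

(** The chain of crosses above the cross of index 0. Using nested crosses makes the central line of
    each end on a central line of the next, so that the successive times meet. *)
Fixpoint ancestor (a : nat -> int) (k : nat) : int :=
  if k is k'.+1 then divz (ancestor a k' - a k') 2 else 0%R.

Lemma ancestorE a k : exists e : bool, ancestor a k = (2 * ancestor a k.+1 + a k + e%:Z)%R.
Proof. exists (podd (ancestor a k - a k)%R); rewrite /= /podd; lia. Qed.

(* The symbol at level j of the central vertical line of a cross of level t. *)
Definition line (C : nat -> int -> int -> tup) a j t : G :=
  lx (C j (down a t.-1 (2 * ancestor a t + a t.-1)%R (t.-1 - j)) 0%R) true.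

Section Lines.
Context (N : nat) (C : nat -> int -> int -> tup) (a b : nat -> int) (h : hierarchy N C a b).

Lemma lx_row j p q d : lx (C j p q) d = lx (C j p 0%R) d.
Proof.
apply: (@iff_line (fun z => lx (C j p z) d = lx (C j p 0%R) d) 0%R q) => // z.
by have [-> _] := hx h j p z.
Qed.

Lemma lx_false j p q : lx (C j p q) false = lx (C j (p - 1)%R 0%R) true.
Proof. by rewrite lx_row; have [_] := hx h j (p - 1)%R 0%R; rewrite subrK. Qed.

Lemma line_Hr j t : j.+1 < t -> Hr (line C a j t) (line C a j.+1 t).
Proof.
move=> jt; rewrite /line; have -> : t.-1 - j = (t.-1 - j.+1).+1 by lia.
set d := t.-1 - j.+1; rewrite /=; have -> : t.-1 - d.+1 = j by rewrite /d; lia.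
set p := down _ _ _ _; have [h1 _ /and3P[_ _ h3]] := hq h j p 0%R true false.
by move: h3; rewrite h1 lx_row.
Qed.

Lemma line_Lst t : Lst (line C a t t.+1).
Proof.
rewrite /line /= subnn /=; have [h1 _ _] := hq h t (ancestor a t.+1) 0%R false false.
have [/and3P[_ h3 _] _] := hT h t (2 * ancestor a t.+1 + a t + 0)%R (2 * 0 + b t + 0)%R.
by move: h3; rewrite h1 lx_row addr0.
Qed.

Lemma line_Lft t : Lft (line C a 0 t).
Proof. by have /and4P[_ /forallP/(_ true)/andP[]] := h0 h (down a t.-1 (2 * ancestor a t + a t.-1)%R (t.-1 - 0)) 0%R. Qed.

Lemma line_Ini : Ini (line C a 0 1).
Proof.
rewrite /line /=; have [h1 _ _] := hq h 0 (ancestor a 1) 0%R false false.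
have /and4P[_ _ h3 _] := h0 h (2 * ancestor a 1 + a 0 + 0)%R (2 * 0 + b 0 + 0)%R.
by move: h3; rewrite h1 lx_row addr0.
Qed.

End Lines.

Section Step.
Context (N : nat) (C : nat -> int -> int -> tup) (a b : nat -> int) (h : hierarchy N C a b).

Lemma ct_child k p q (e d dx dy : bool) :
  ct (C k (2 * p + a k + e%:Z)%R (2 * q + b k + d%:Z)%R) dx dy =
  if dx == e then if dy == d then ct (C k.+1 p q) dx dy else
      if dx != qx (C k.+1 p q) then Some (false, lf (C k.+1 p q)) else None
  else if dy == d then if dy != qy (C k.+1 p q) then Some (true, lf (C k.+1 p q)) else None else None.
Proof.
have [h1 h2 /and3P[/forallP/(_ (dx, dy))/eqP /= -> _ _]] := hq h k p q e d.
by rewrite /inherit /= h1 h2.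
Qed.

Lemma ly_col j p q d : ly (C j p q) d = ly (C j 0%R q) d.
Proof. exact: (lx_row (hierarchy_tr h) j q p d). Qed.

(** The vertical arm of K towards the centre of its parent ends on the central horizontal line of
    that parent. The requirement created at this end is inherited by the corners of the crosses of
    all lower levels there, hence by one of level j, which knows both symbols. *)
Lemma line_St j t : j < t ->
  St (N <= t) (line C a j t) (line (fun k p q => tr (C k q p)) b j t.+1).
Proof.
case: t => // t jt; set P := ancestor a t.+1; set Q := ancestor b t.+1.
set K := C t.+1 P Q; set dy := ~~ qy K.
pose px d := down a t (2 * P + a t)%R d.
pose py d := down b t.+1 (2 * ancestor b t.+2 + b t.+1)%R d.+1.
have [e eQ] := ancestorE b t.+1.
have qK : qy K = e.
  have [e' eP] := ancestorE a t.+1.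
  by have [_ <- _] := hq h t.+1 (ancestor a t.+2) (ancestor b t.+2) e' e; rewrite /K /P /Q eP eQ.
have py0 : py 0 = (2 * (2 * ancestor b t.+2 + b t.+1) + b t + 1)%R by rewrite /py [LHS]/= subSS subn0.
have pyS d : py d.+1 = (2 * py d + b (t - d.+1)%N + 1)%R by [].
have H d : d <= t -> ct (C (t - d) (px d + 1)%R (py d + (~~ dy)%:Z)%R) false dy = Some (true, lf K).
  elim: d => [_|d IH dt].
    have -> : (px 0 + 1 = 2 * P + a t + true%:Z)%R by [].
    have -> : (py 0 + (~~ dy)%:Z = 2 * Q + b t + dy%:Z)%R.
      by rewrite py0 /Q eQ /dy qK; case: (e); lia.
    by rewrite subn0 ct_child eqxx /= -/K /dy qK; case: (e).
  have {}IH := IH (ltnW dt).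
  have -> : (px d.+1 + 1 = 2 * (px d + 1) + a (t - d.+1)%N + false%:Z)%R by rewrite /px /=; lia.
  have -> : (py d.+1 + (~~ dy)%:Z = 2 * (py d + (~~ dy)%:Z) + b (t - d.+1)%N + dy%:Z)%R.
    by rewrite pyS; case: (dy); lia.
  by rewrite ct_child eqxx /= eqxx subnSK // IH.
have {}H := H (t - j) ltac:(lia); have ej : t - (t - j) = j by lia.
move: H; rewrite ej => H.
have [/and3P[/forallP/(_ (false, dy)) + _ _] _] := hT h j (px (t - j)%N + 1)%R (py (t - j)%N + (~~ dy)%:Z)%R.
rewrite /okcorner H /= (lx_false h) addrK /K (hT h t P Q).2.
suff -> : ly (C j (px (t - j)%N + 1)%R (py (t - j)%N + (~~ dy)%:Z)%R) dy =
  line (fun k p q => tr (C k q p)) b j t.+2 by [].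
rewrite /line /= subSn // -/(py (t - j)).
case: (dy) => /=; first by rewrite addr0 ly_col.
have := lx_false (hierarchy_tr h) j (py (t - j)%N + 1)%R (px (t - j)%N + 1)%R.
by rewrite addrK.
Qed.

End Step.

Lemma hierarchy_run N C a b : hierarchy N C a b -> exists g, run N g.
Proof.
move=> h; have h' := hierarchy_tr h.
pose gx := line C a; pose gy := line (fun k p q => tr (C k q p)) b.
have sxy j t : j < t -> St (N <= t) (gx j t) (gy j t.+1) by move=> jt; exact: (line_St h jt).
have trK s : tr (tr s) = s.
  case: s => [[[[x y] f] u] [v w]]; rewrite /tr; congr (_, _, _, _).
  by apply/ffunP => -[d1 d2]; rewrite ffunE /ct ffunE /=; case: (u _) => [[[] ?]|].
have syx j t : j < t -> St (N <= t) (gy j t) (gx j t.+1).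
  by move=> jt; have := line_St h' jt; rewrite /line trK.
(* Time passes from vertical lines to horizontal ones and back. *)
exists (fun j t => if odd t then gy j t else gx j t); split.
- by move=> j t jt; case: ifP => _; [exact: line_Hr h' _ _ jt | exact: line_Hr h _ _ jt].
- by move=> j t jt /=; case: (odd t) => /=; [exact: syx | exact: sxy].
- exact: line_Ini h'.
- by move=> t _; case: ifP => _; [exact: line_Lft h' t | exact: line_Lft h t].
- by move=> t; case: ifP => _; [exact: line_Lst h' t | exact: line_Lst h t].
Qed.

Theorem wang_run N t kh kv : 0 < N -> wang Hr St Ini Lft Lst N t kh kv -> exists g, run N g.
Proof. by move=> N0 /(wang_hierarchy N0) [C [a [b]]]; exact: hierarchy_run. Qed.

End Run.

(** * A hierarchy containing a given run *)

Section Explicit_hierarchy.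

Local Notation v := (logn 2).

Lemma v_odd u : odd u -> v u = 0.
Proof. by move=> h; apply: logn_coprime; rewrite coprime2n. Qed.

Lemma v_pow k u : 0 < u -> v (2 ^ k * u) = k + v u.
Proof. by move=> h; rewrite lognM ?expn_gt0 // pfactorK. Qed.

Lemma v_cross k i : v (2 ^ k * (2 * i + 1)) = k.
Proof. by rewrite v_pow ?v_odd ?addn0 //; lia. Qed.

Lemma v_line k r : 0 < r -> k < v (2 ^ k.+1 * r).
Proof. by move=> h; rewrite v_pow //; lia. Qed.

Lemma cross_ex x : 0 < x -> exists i, x = 2 ^ v x * (2 * i + 1).
Proof.
move=> h; have [m c e] := pfactor_coprime (isT : prime 2) h.
by exists m./2; rewrite {1}e mulnC; congr (_ * _); move: c; rewrite coprime2n; lia.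
Qed.

Lemma line_ex k y : 0 < y -> k < v y -> exists2 r, 0 < r & y = 2 ^ k.+1 * r.
Proof.
move=> y0 h; exists (y %/ 2 ^ k.+1); first by rewrite divn_gt0 ?expn_gt0 // dvdn_leq // pfactor_dvdn.
by rewrite mulnC divnK // pfactor_dvdn.
Qed.

(** On a line of level m the arms of its crosses cover all edges; this is the centre of the one
    through the edge from x to x + 1. *)
Definition cen m x := x %/ 2 ^ m.+1 * 2 ^ m.+1 + 2 ^ m.

Definition arm m x : nat * bool * bool := (cen m x, cen m x <= x,
  (0 < m) && (cen m x - 2 ^ m.-1 <= x < cen m x + 2 ^ m.-1)).

Lemma cenE m b r : r < 2 ^ m.+1 -> cen m (2 ^ m.+1 * b + r) = 2 ^ m * (2 * b + 1).
Proof.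
move=> h; rewrite /cen [_ * b]mulnC divnMDl ?expn_gt0 // divn_small // addn0 expnS; nia.
Qed.

Lemma half_pow m : 0 < m -> 2 ^ m = 2 * 2 ^ m.-1.
Proof. by case: m => // m _; rewrite expnS. Qed.

Lemma arm_center m i : let x := 2 ^ m * (2 * i + 1) in
  arm m x.-1 = (x, false, 0 < m) /\ arm m x = (x, true, 0 < m).
Proof.
move=> x; have p0 : 0 < 2 ^ m by rewrite expn_gt0.
have ex : x = 2 ^ m.+1 * i + 2 ^ m by rewrite /x expnS; nia.
have ex' : x.-1 = 2 ^ m.+1 * i + (2 ^ m).-1 by lia.
have c1 : cen m x = x by rewrite {1}ex cenE // expnS; lia.
have c2 : cen m x.-1 = x by rewrite ex' cenE // expnS; lia.
have hp : (0 < m) -> 2 ^ m = 2 * 2 ^ m.-1 by exact: half_pow.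
have hq : 0 < 2 ^ m.-1 by rewrite expn_gt0.
rewrite /arm c1 c2; clear c1 c2 ex'; move: hp hq ex p0; move: (2 ^ m.-1) (2 ^ m) (_ * i) => p q c hp hq ex p0.
by split; congr (_, _, _); lia.
Qed.

Lemma arm_end m r : 0 < r -> let x := 2 ^ m.+1 * r in
  arm m x.-1 = (2 ^ m * (2 * r.-1 + 1), true, false) /\ arm m x = (2 ^ m * (2 * r + 1), false, false).
Proof.
case: r => // r _ x; have p0 : 0 < 2 ^ m by rewrite expn_gt0.
have ex : x = 2 ^ m.+1 * r.+1 + 0 by rewrite addn0.
have ex' : x.-1 = 2 ^ m.+1 * r + (2 * 2 ^ m).-1 by rewrite /x expnS; nia.
have c1 : cen m x = 2 ^ m * (2 * r.+1 + 1) by rewrite {1}ex cenE // expn_gt0.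
have c2 : cen m x.-1 = 2 ^ m * (2 * r + 1) by rewrite ex' cenE // expnS; lia.
have e : 2 ^ m * (2 * r.+1 + 1) = x + 2 ^ m by rewrite /x expnS; nia.
have e' : 2 ^ m * (2 * r + 1) + 2 ^ m = x by rewrite /x expnS; nia.
have hp : (0 < m) -> 2 ^ m = 2 * 2 ^ m.-1 by exact: half_pow.
have hq : 0 < 2 ^ m.-1 by rewrite expn_gt0.
rewrite /arm c1 c2 /=; clear c1 c2 ex ex'; move: e e' hp hq p0; clearbody x.
move: (2 ^ m * (2 * r.+1 + 1)) (2 ^ m * (2 * r + 1)) (2 ^ m.-1) (2 ^ m) => c c' p q e e' hp hq p0.
by split; congr (_, _, _); lia.
Qed.

(** Centres and ends of arms of level m have valuation at least m and the half-way points have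
    valuation m - 1; nothing changes at other points. *)
Lemma arm_inner m x : 0 < x -> v x < m ->
  (arm m x.-1).1 = (arm m x).1 /\ ((v x).+1 < m -> (arm m x.-1).2 = (arm m x).2).
Proof.
move=> x0 h; have p0 : 0 < 2 ^ m by rewrite expn_gt0.
pose b := x %/ 2 ^ m.+1; pose r := x %% 2 ^ m.+1.
have ex : x = 2 ^ m.+1 * b + r by rewrite mulnC; exact: divn_eq.
have r2 : r < 2 ^ m.+1 by rewrite ltn_pmod // expn_gt0.
have r0 : 0 < r.
  rewrite lt0n; apply/negP => /eqP e; move: ex; rewrite e addn0 => e'.
  have : 2 ^ m.+1 %| x by rewrite e' dvdn_mulr.
  by rewrite pfactor_dvdn // => h'; lia.
have ex' : x.-1 = 2 ^ m.+1 * b + r.-1 by lia.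
have cE : cen m x.-1 = cen m x by rewrite ex' {1}ex !cenE //; lia.
have cP : cen m x = 2 ^ m * (2 * b + 1) by rewrite {1}ex cenE.
rewrite /arm cE; split.
  have nx : x != cen m x by apply: contraTneq h => e; rewrite e cP v_cross ltnn.
  by congr (_, _); move: nx; lia.
move=> h2 /=; congr (_ && _); have m0 : 0 < m by lia.
have hp := half_pow m0.
have n1 : x != cen m x - 2 ^ m.-1.
  apply: contraTneq h2 => e; rewrite -leqNgt e cP {1}hp -[2 * _ * _]mulnA mulnCA -{2}[2 ^ m.-1]muln1 -mulnBr.
  by rewrite (_ : 2 * (2 * b + 1) - 1 = 2 * (2 * b) + 1) ?v_cross; lia.
have n2 : x != cen m x + 2 ^ m.-1.
  apply: contraTneq h2 => e; rewrite -leqNgt e cP {1}hp -[2 * _ * _]mulnA mulnCA -{2}[2 ^ m.-1]muln1 -mulnDr.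
  by rewrite v_cross; lia.
by move: n1 n2; lia.
Qed.

(* A child of a cross of level k.+1 lies half-way on its arm. *)
Lemma arm_flip k i (e : bool) : let x := 2 ^ k * (2 * (2 * i + e) + 1) in
  arm k.+1 x.-1 = (2 ^ k.+1 * (2 * i + 1), e, e) /\ arm k.+1 x = (2 ^ k.+1 * (2 * i + 1), e, ~~ e).
Proof.
move=> x; have p0 : 0 < 2 ^ k by rewrite expn_gt0.
have ex : x = 2 ^ k.+2 * i + (2 * 2 ^ k * e + 2 ^ k) by rewrite /x !expnS; nia.
have ex' : x.-1 = 2 ^ k.+2 * i + (2 * 2 ^ k * e + 2 ^ k).-1 by lia.
have c1 : cen k.+1 x = 2 ^ k.+1 * (2 * i + 1) by rewrite {1}ex cenE // !expnS; case: (e); lia.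
have c2 : cen k.+1 x.-1 = 2 ^ k.+1 * (2 * i + 1) by rewrite ex' cenE // !expnS; case: (e); lia.
have e1 : 2 ^ k.+1 * (2 * i + 1) = 2 ^ k.+2 * i + 2 * 2 ^ k by rewrite !expnS; nia.
rewrite /arm c1 c2 /= e1; clear c1 c2 e1; move: ex ex'; clearbody x; move: (2 ^ k.+2 * i) (2 ^ k) p0 => a p p0 -> ->.
by split; congr (_, _, _); case: e; lia.
Qed.

(** * The Wang tiling in which the level of a line is the 2-adic valuation of its coordinate *)

Section Explicit.
Context (G : finType) (Hr : rel G) (St : bool -> rel G) (Ini Lft Lst : pred G).
Context (N : nat) (N0 : 0 < N) (g : nat -> nat -> G) (gP : run Hr St Ini Lft Lst N g).

Definition lside (x : nat) (d : bool) : nat := if d then x + 2 ^ v x else x - 2 ^ v x.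
(** The parity of i in x = 2 ^ k * (2 * i + 1). *)
Definition qside (x : nat) : bool := odd (x %/ 2 ^ (v x).+1).
Definition cornerv (mx my : nat) : option (bool * bool) :=
  if my == mx.+1 then Some (true, N <= mx) else if mx == my.+1 then Some (false, N <= my) else None.

Definition tupv (x y : nat) : tup G :=
  ((qside x, qside y), N <= v x, [ffun d => cornerv (v (lside x d.1)) (v (lside y d.2))],
   ([ffun d => g (v x) (v (lside x d))], [ffun d => g (v y) (v (lside y d))])).

Definition hedge x y : col G := let a := arm (v y) x in (tupv a.1.1 y, a.1.2, a.2).
Definition vedge x y : col G := let a := arm (v x) y in (tupv x a.1.1, a.1.2, a.2).

Definition tilev x y : wtile G :=
  ((odd x, odd y), (hedge x.-1 y, hedge x y, (vedge x y.-1, vedge x y))).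

Lemma lsideE k i d : lside (2 ^ k * (2 * i + 1)) d = 2 ^ k.+1 * (i + d).
Proof. by rewrite /lside v_cross expnS; case: d; nia. Qed.

Lemma qsideE k i : qside (2 ^ k * (2 * i + 1)) = odd i.
Proof.
rewrite /qside v_cross (_ : _ * _ = i * 2 ^ k.+1 + 2 ^ k); last by rewrite expnS; nia.
rewrite divnMDl ?expn_gt0 // divn_small ?addn0 // expnS.
have : 0 < 2 ^ k by rewrite expn_gt0.
lia.
Qed.

Lemma inner_v k i : v (2 ^ k.+1 * (i + ~~ odd i)) = k.+1.
Proof. by rewrite v_pow ?v_odd ?addn0 //; case: (boolP (odd i)) => h /=; lia. Qed.

(** Positive indices keep away the line of coordinate 0, whose value under [logn] is 0 by convention
    and not a level. *)
Lemma okT_tupv k i j : 0 < i -> 0 < j -> okT St Lst (tupv (2 ^ k * (2 * i + 1)) (2 ^ k * (2 * j + 1))).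
Proof.
move=> i0 j0; apply/and3P; split.
- apply/forallP => -[dx dy]; rewrite /okcorner /ct ffunE /lx /ly !ffunE /= !v_cross !lsideE /cornerv.
  have hx : k < v (2 ^ k.+1 * (i + dx)) by apply: v_line; lia.
  have hy : k < v (2 ^ k.+1 * (j + dy)) by apply: v_line; lia.
  case: eqP => [->|_]; first exact: (run_St gP hx).
  by case: eqP => [->|//]; exact: (run_St gP hy).
- by rewrite /lx ffunE /= /qx /= qsideE lsideE inner_v v_cross; exact: (run_Lst gP).
- by rewrite /ly ffunE /= /qy /= qsideE lsideE inner_v v_cross; exact: (run_Lst gP).
Qed.

Lemma ok0_tupv i j : 0 < i -> 0 < j -> ok0 St Ini Lft Lst (tupv (2 * i + 1) (2 * j + 1)).
Proof.
move=> i0 j0; have e m : 2 * m + 1 = 2 ^ 0 * (2 * m + 1) by rewrite mul1n.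
rewrite (e i) (e j); apply/and4P; split; first exact: okT_tupv.
- apply/forallP => d; rewrite /lx /ly !ffunE /= !v_cross !lsideE; apply/andP.
  by split; apply: (run_Lft gP); apply: v_line; lia.
- by rewrite /lx ffunE /= /qx /= qsideE lsideE inner_v v_cross; exact: (run_Ini gP).
- by rewrite /ly ffunE /= /qy /= qsideE lsideE inner_v v_cross; exact: (run_Ini gP).
Qed.

Lemma okPC_tupv k i j (e d : bool) : 0 < i -> 0 < j ->
  okPC Hr (tupv (2 ^ k.+1 * (2 * i + 1)) (2 ^ k.+1 * (2 * j + 1)))
    (tupv (2 ^ k * (2 * (2 * i + e) + 1)) (2 ^ k * (2 * (2 * j + d) + 1))).
Proof.
move=> i0 j0.
have oe (m : nat) (b : bool) : odd (2 * m + b) = b by case: b; lia.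
have ls (m : nat) (b b' : bool) : 2 ^ k.+1 * (2 * m + b + b') =
    if b' == b then 2 ^ k.+2 * (m + b) else 2 ^ k.+1 * (2 * m + 1).
  by rewrite !expnS; case: b; case: b' => /=; nia.
have vl m (b : bool) : 0 < m -> v (2 ^ k.+2 * (m + b)) = k.+2 + v (m + b) by move=> m0; rewrite v_pow //; lia.
(* The side of the parent towards its own parent is the one of level exactly k + 2; a requirement
   arises only where an arm of the parent ends there. *)
have odd1 m (b : bool) : 0 < m -> (v (m + b) == 0) = (b != odd m).
  move=> m0; case: (boolP (odd (m + b))) => o; first by rewrite v_odd //; move: o; case: b; rewrite ?addn0 ?addn1 /=; case: (odd m).
  have -> : (v (m + b) == 0) = false.
    by apply/negbTE; rewrite -lt0n -(pfactor_dvdn 1) ?dvdn2 //; lia.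
  by move: o; case: b; rewrite ?addn0 ?addn1 /=; case: (odd m).
apply/and3P; split.
- apply/forallP => -[dx dy]; rewrite /inherit /ct !ffunE /qx /qy /lf /= !qsideE !lsideE v_cross !oe !ls /cornerv.
  case: (dx =P e) => [->|_]; case: (dy =P d) => [->|_] //=.
  + rewrite v_cross vl // -odd1 //.
    have -> : (k.+1 == (k.+2 + v (i + e)).+1) = false by lia.
    by have -> : (k.+2 + v (i + e) == k.+2) = (v (i + e) == 0) by lia.
  + rewrite v_cross vl // -odd1 //.
    have -> : (k.+2 + v (j + d) == k.+2) = (v (j + d) == 0) by lia.
    by have -> : (k.+1 == (k.+2 + v (j + d)).+1) = false by lia.
  + by rewrite !v_cross; have -> : (k.+1 == k.+2) = false by lia.
- rewrite /ly !ffunE /qy /= qsideE !lsideE !v_cross oe ls eqxx; apply: (run_Hr gP).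
  by rewrite vl //; lia.
- rewrite /lx !ffunE /qx /= qsideE !lsideE !v_cross oe ls eqxx; apply: (run_Hr gP).
  by rewrite vl //; lia.
Qed.

Lemma tilev_C k i j : 0 < i -> 0 < j ->
  isC (0 < k) (tilev (2 ^ k * (2 * i + 1)) (2 ^ k * (2 * j + 1))).
Proof.
move=> i0 j0; have [a1 a2] := arm_center k i; have [b1 b2] := arm_center k j.
by rewrite /isC /eW /eE /eS /eN /tilev /hedge /vedge !v_cross a1 a2 b1 b2 /ctup /= !eqxx.
Qed.

Lemma tilev_H k i r : 0 < i -> 1 < r -> (odd r -> 0 < i./2) ->
  isH Hr (tilev (2 ^ k * (2 * i + 1)) (2 ^ k.+1 * r)) /\
  flipH (tilev (2 ^ k * (2 * i + 1)) (2 ^ k.+1 * r)) = odd r.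
Proof.
move=> i0 r1 i2; set x := 2 ^ k * (2 * i + 1); set y := 2 ^ k.+1 * r.
have vx : v x = k by exact: v_cross.
have x0 : 0 < x by rewrite /x muln_gt0 expn_gt0; lia.
have vy : k < v y by apply: v_line; lia.
have [s1 s2] := @arm_end k r (ltnW r1).
have [w1 w2] := @arm_inner (v y) x x0 ltac:(by rewrite vx).
have eNE : eN (tilev x y) = (tupv x (2 ^ k * (2 * r + 1)), false, false) by rewrite /eN /= /vedge vx -/y s2.
have eSE : eS (tilev x y) = (tupv x (2 ^ k * (2 * r.-1 + 1)), true, false) by rewrite /eS /= /vedge vx -/y s1.
have or : odd r.-1 = ~~ odd r by lia.
have fl : flipH (tilev x y) = odd r.
  by rewrite /flipH eNE eSE /ctup /qy /= !qsideE or negbK andbb.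
have pr : [/\ ctup (eW (tilev x y)) = tupv (arm (v y) x.-1).1.1 y, csd (eW (tilev x y)) = (arm (v y) x.-1).1.2,
  cin (eW (tilev x y)) = (arm (v y) x.-1).2, cin (eE (tilev x y)) = (arm (v y) x).2 &
  (eE (tilev x y)).1 = (eW (tilev x y)).1] by split => //; rewrite /eE /eW /tilev /hedge; move: w1; case: (arm _ _) => [[a b] ?]; case: (arm _ _) => [[a' b'] ?] [-> ->].
split => //; rewrite /isH fl eNE eSE; move: (eW (tilev x y)) (eE (tilev x y)) pr => p q [p1 p2 p3 p4 p5].
rewrite p1 p2 p3 p4 p5 eqxx; apply/andP; split => //; apply/and5P; split.
- by [].
- by rewrite /ctup /qy /= !qsideE or; case: (odd r).
- by apply/forallP => d; rewrite /lx !ffunE.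
- by rewrite /ly !ffunE !v_cross !lsideE; have -> : r.-1 + true = r + false by lia.
have vyE : v y = k.+1 + v r by rewrite v_pow //; lia.
case: ifP => o; last first.
  have vr : 0 < v r by rewrite -(pfactor_dvdn 1) ?dvdn2 ?o //; lia.
  by rewrite w2 // vx vyE; lia.
have er : r = 2 * r./2 + 1 by lia.
have ei : i = 2 * i./2 + odd i by lia.
rewrite (v_odd o) addn0 in vyE.
have [f1 f2] := arm_flip k i./2 (odd i).
rewrite -ei -/x in f1 f2.
rewrite vyE f1 f2 /ctup /qx /= qsideE !eqxx /=.
have r2 : 0 < r./2 by lia.
have P := fun d => @okPC_tupv k i./2 r./2 (odd i) d (i2 o) r2; rewrite -ei -/x in P.
have := P true; have := P false; rewrite /= -er -/y.
by rewrite (_ : 2 * r./2 + 0 = r.-1); [move=> -> -> | lia].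
Qed.

Lemma tilev_V k j r : 0 < j -> 1 < r -> isV (tilev (2 ^ k.+1 * r) (2 ^ k * (2 * j + 1))).
Proof.
move=> j0 r1; set y := 2 ^ k * (2 * j + 1); set x := 2 ^ k.+1 * r.
have vy : v y = k by exact: v_cross.
have y0 : 0 < y by rewrite /y muln_gt0 expn_gt0; lia.
have vx : k < v x by apply: v_line; lia.
have [s1 s2] := @arm_end k r (ltnW r1).
have [w1 w2] := @arm_inner (v x) y y0 ltac:(by rewrite vy).
have eEE : eE (tilev x y) = (tupv (2 ^ k * (2 * r + 1)) y, false, false) by rewrite /eE /= /hedge vy -/x s2.
have eWE : eW (tilev x y) = (tupv (2 ^ k * (2 * r.-1 + 1)) y, true, false) by rewrite /eW /= /hedge vy -/x s1.
have or : odd r.-1 = ~~ odd r by lia.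
have fl : flipV (tilev x y) = odd r.
  by rewrite /flipV eEE eWE /ctup /qx /= !qsideE or negbK andbb.
have pr : [/\ csd (eS (tilev x y)) = (arm (v x) y.-1).1.2,
  cin (eS (tilev x y)) = (arm (v x) y.-1).2, cin (eN (tilev x y)) = (arm (v x) y).2 &
  (eN (tilev x y)).1 = (eS (tilev x y)).1].
  by split => //; rewrite /eN /eS /tilev /vedge; move: w1; case: (arm _ _) => [[a b] ?]; case: (arm _ _) => [[a' b'] ?] [-> ->].
rewrite /isV fl eEE eWE; move: (eS (tilev x y)) (eN (tilev x y)) pr => p q [p2 p3 p4 p5].
rewrite p2 p3 p4 p5 eqxx; apply/andP; split => //; apply/and5P; split.
- by [].
- by rewrite /ctup /qx /= !qsideE or; case: (odd r).
- by apply/forallP => d; rewrite /ly !ffunE.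
- by rewrite /lx !ffunE !v_cross !lsideE; have -> : r.-1 + true = r + false by lia.
have vxE : v x = k.+1 + v r by rewrite v_pow //; lia.
case: ifP => o; last first.
  have vr : 0 < v r by rewrite -(pfactor_dvdn 1) ?dvdn2 ?o //; lia.
  by rewrite w2 // vy vxE; lia.
have ej : j = 2 * j./2 + odd j by lia.
rewrite (v_odd o) addn0 in vxE.
have [f1 f2] := arm_flip k j./2 (odd j).
rewrite -ej -/y in f1 f2.
by rewrite vxE f1 f2 /ctup /qy /= qsideE !eqxx.
Qed.

Lemma isH_notC fl (t : wtile G) : isH Hr t -> isC fl t = false.
Proof.
move=> h; apply/negP => /isC_edges [_ _ _ e]; case/andP: h => /and5P[_ + _ _ _] _; by rewrite e.
Qed.

Lemma isV_notC fl (t : wtile G) : isV t -> isC fl t = false.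
Proof.
move=> h; apply/negP => /isC_edges [e _ _ _]; case/andP: h => /and5P[_ + _ _ _] _; by rewrite e.
Qed.

Lemma isV_notH (t : wtile G) : isV t -> isH Hr t = false.
Proof.
case/andP => /and5P[_ h1 _ h2 _] _; apply/negP => /andP[/and5P[/eqP e _ _ _ _] _].
by move: h2; rewrite /csd e -/(csd _) h1.
Qed.

(** Strictly between two consecutive powers of 2 all valuations are below K, so the crosses, lines
    and parents that occur have indices large enough to avoid the coordinate 0. Such windows are
    arbitrarily large. *)
Lemma tilev_ok K x y : 2 ^ K < x < 2 ^ K.+1 -> 2 ^ K < y < 2 ^ K.+1 ->
  validT Hr St Ini Lft Lst (tilev x y) /\
  modeok N (tmode Hr (tilev x y)) (minn (v y) N) (minn (v x) N).
Proof.
have main z : 2 ^ K < z < 2 ^ K.+1 -> [/\ 0 < z, v z < K & exists2 i, 0 < i & z = 2 ^ v z * (2 * i + 1)].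
  move=> hz; have z0 : 0 < z by lia.
  have [i ei] := cross_ex z0.
  have vK : v z < K.
    rewrite ltnNge; apply/negP => h.
    have : 2 ^ K %| z by rewrite pfactor_dvdn.
    case/dvdnP => q e; move: hz; rewrite e expnS; have p : 0 < 2 ^ K by rewrite expn_gt0.
    by rewrite -{1}[2 ^ K]mul1n !ltn_pmul2r //; lia.
  split => //; exists i => //; rewrite lt0n; apply/negP => /eqP e0.
  move: hz; rewrite ei e0 muln0 add0n muln1 => /andP[+ _].
  by rewrite ltn_exp2l // => h; lia.
move=> hx hy; have [x0 vxK [i i0 ex]] := main x hx; have [y0 vyK [j j0 ey]] := main y hy.
have oddv z : 0 < z -> odd z = (v z == 0).
  move=> z0; apply/idP/idP => [/v_odd ->//|]; apply: contraLR => /negbTE o.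
  by rewrite -lt0n -(pfactor_dvdn 1) // dvdn2 o.
case: (ltngtP (v x) (v y)) => vxy.
- have [r r0 er] := line_ex y0 vxy.
  have pK : 0 < 2 ^ v x by rewrite expn_gt0.
  have Kp : 2 ^ K = 2 ^ (K - (v x).+1) * (2 * 2 ^ v x) by rewrite -expnS -expnD subnK.
  have r1 : 1 < r.
    rewrite ltnNge; apply/negP => r1; have e1 : r = 1 by lia.
    by move: hy; rewrite er e1 muln1 => /andP[+ _]; rewrite ltn_exp2l //; lia.
  have i2 : odd r -> 0 < i./2.
    move=> o; have vyE : v y = (v x).+1 by rewrite er v_pow // (v_odd o) addn0.
    rewrite lt0n; apply/negP => /eqP e2; have i1 : i = 1 by clear -i0 e2; lia.
    have : 2 ^ (v x).+2 <= 2 ^ K by rewrite leq_exp2l // -vyE.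
    move: hx; rewrite {1}ex i1 => /andP[+ _]; rewrite !expnS.
    by clear; move: (2 ^ v x) (2 ^ K) => p q; lia.
  have [H F] := tilev_H (v x) i0 r1 i2; rewrite -ex -er in H F.
  split; first by rewrite /validT (_ : bx _ = odd x) // (_ : by_ _ = odd y) // (oddv y y0) gtn_eqF ?(leq_ltn_trans _ vxy) // H orbT; case: ifP.
  rewrite /tmode !isH_notC // H F /=; case: ifP => //= o.
  have -> : v y = (v x).+1 by rewrite {1}er v_pow // (v_odd o) addn0.
  by apply/eqP; lia.
- have [r r0 er] := line_ex x0 vxy.
  have r1 : 1 < r.
    rewrite ltnNge; apply/negP => r1; have e1 : r = 1 by lia.
    by move: hx; rewrite er e1 muln1 => /andP[+ _]; rewrite ltn_exp2l //; lia.
  have V := tilev_V (v y) j0 r1; rewrite -ey -er in V.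
  split; first by rewrite /validT (_ : bx _ = odd x) // (_ : by_ _ = odd y) // (oddv x x0) gtn_eqF ?(leq_ltn_trans _ vxy) // V !orbT; case: ifP.
  by rewrite /tmode !isV_notC // isV_notH.
have C := tilev_C (v x) i0 j0; rewrite -ex [in 2 ^ v x]vxy -ey in C.
have eW1 : ctup (eW (tilev x y)) = tupv x y.
  rewrite (_ : ctup _ = tupv (arm (v y) x.-1).1.1 y) // -vxy.
  by have [a _] := arm_center (v x) i; rewrite -ex in a; rewrite a.
split.
  rewrite /validT (_ : bx _ = odd x) // (_ : by_ _ = odd y) // (oddv x x0) (oddv y y0) -vxy eW1.
  case: (posnP (v x)) C => v0 C.
    have e1 : x = 2 * i + 1 by rewrite ex v0 expn0 mul1n.
    have e2 : y = 2 * j + 1 by rewrite ey -vxy v0 expn0 mul1n.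
    by rewrite C /= e1 e2 ok0_tupv.
  have O := okT_tupv (v x) i0 j0; rewrite -ex [X in tupv _ (2 ^ X * _)]vxy -ey in O.
  by rewrite C O.
rewrite -vxy; case: (posnP (v x)) => v0.
  by rewrite isC_mode0 ?v0 ?min0n //; move: C; rewrite v0.
rewrite v0 in C; rewrite isC_mode1 // eW1 /lf /=; case: leqP => h /=; first by rewrite !eqxx.
by rewrite eqxx.
Qed.

End Explicit.

End Explicit_hierarchy.

(** * Neighbour relations encoded in a number *)

Section Limit.
Context (n : nat) (f : nat -> nat -> nat) (f_lt : forall k m, f k m < n).

Definition recurs (s : seq nat) : Prop :=
  forall K0, exists2 K, K0 <= K & forall m, m < size s -> f K m = nth 0 s m.

(** Pigeonhole: if each of the n values ceased to occur after [s] from some bound on, none would be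
    left beyond the largest bound. *)
Lemma recurs_rcons s : recurs s -> exists a, recurs (rcons s a).
Proof.
move=> rs; apply: NNPP => no.
have [K0 hK0] : exists K0, forall a, a < n -> forall K, K0 <= K ->
    ~ forall m, m < (size s).+1 -> f K m = nth 0 (rcons s a) m.
  elim: {1}n => [|a [K0 IH]]; first by exists 0.
  have [K1 hK1] : exists K1, forall K, K1 <= K -> ~ forall m, m < (size s).+1 -> f K m = nth 0 (rcons s a) m.
    apply: NNPP => h; apply: no; exists a => K1; apply: NNPP => h1; apply: h; exists K1 => K hK hm.
    by apply: h1; exists K => //; rewrite size_rcons.
  exists (maxn K0 K1) => b; rewrite ltnS leq_eqVlt => /orP[/eqP->|hb] K; rewrite geq_max => /andP[h1 h2].
    exact: hK1.
  exact: IH.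
have [K hK hm] := rs K0.
apply: (hK0 (f K (size s)) _ K hK) => // m; rewrite ltnS leq_eqVlt nth_rcons.
case: ltngtP => // [h _|-> _ //]; exact: hm.
Qed.

Lemma limit_ex : exists c : nat -> nat, forall m K0, exists2 K, K0 <= K & forall i, i < m -> f K i = c i.
Proof.
pose nxt (s : {s | recurs s}) := let: a := constructive_indefinite_description _ (recurs_rcons (proj2_sig s)) in
  exist recurs _ (proj2_sig a).
have r0 : recurs [::] by move=> K0; exists K0.
pose S m := iter m nxt (exist recurs [::] r0).
have SS m : exists a, sval (S m.+1) = rcons (sval (S m)) a.
  by rewrite /S iterS /nxt /=; eexists.
have sS m : size (sval (S m)) = m.
  by elim: m => // m IH; have [a ->] := SS m; rewrite size_rcons IH.
have st m k : k < m -> nth 0 (sval (S m)) k = nth 0 (sval (S k.+1)) k.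
  elim: m => // m IH; rewrite ltnS leq_eqVlt => /orP[/eqP-> //|h].
  by have [a ->] := SS m; rewrite nth_rcons sS h IH.
exists (fun i => nth 0 (sval (S i.+1)) i) => m K0.
have [K hK h] := svalP (S m) K0; exists K => // i hi.
by rewrite h ?sS // st.
Qed.
End Limit.

(** Squares of side about 2 K are recentred at the origin, the plane is enumerated by [pickle], and
    a limit of the resulting sequences agrees with some large square at any three given points. *)
Lemma sft_compact n (HR VR : rel nat) :
  (forall K, exists c : nat -> nat -> nat, forall i j, i <= K -> j <= K ->
    [/\ c i j < n, HR (c i j) (c i.+1 j) & VR (c i j) (c i j.+1)]) -> sft n HR VR.
Proof.
move=> H; have n0 : 0 < n by have [c /(_ 0 0 isT isT) [h _ _]] := H 0; exact: leq_ltn_trans h.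
pose C K := sval (constructive_indefinite_description _ (H K.*2)).
have CP K i j : i <= K.*2 -> j <= K.*2 ->
    [/\ C K i j < n, HR (C K i j) (C K i.+1 j) & VR (C K i j) (C K i j.+1)].
  by move=> hi hj; apply: (proj2_sig (constructive_indefinite_description _ (H K.*2))).
pose f K m := let d := if (choice.unpickle m : option (int * int)) is Some (x, y) then C K `|(x + K%:Z)%R| `|(y + K%:Z)%R| else 0 in
  if d < n then d else 0.
have f_lt K m : f K m < n by rewrite /f; case: ifP.
have fE K x y : (`|x| <= K)%N -> (`|y| <= K)%N -> f K (choice.pickle (x, y)) = C K `|(x + K%:Z)%R| `|(y + K%:Z)%R|.
  move=> hx hy; rewrite /f choice.pickleK; case: ifP => // /negP[].
  by have [] := CP K `|(x + K%:Z)%R| `|(y + K%:Z)%R| ltac:(lia) ltac:(lia).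
have [c cP] := limit_ex f_lt.
exists (fun x y => c (choice.pickle (x, y))) => x y.
pose p0 := choice.pickle (x, y); pose p1 := choice.pickle ((x + 1)%R, y); pose p2 := choice.pickle (x, (y + 1)%R).
have [K hK hc] := cP (p0 + p1 + p2).+1 (`|x| + `|y|).+1.
have [h1 h2 h3] := CP K `|(x + K%:Z)%R| `|(y + K%:Z)%R| ltac:(lia) ltac:(lia).
rewrite -!hc -/p0 -/p1 -/p2; try lia.
rewrite !fE; try lia.
have e z : (`|z| < K)%N -> `|(z + 1 + K%:Z)%R|%N = `|(z + K%:Z)%R|%N.+1 by lia.
by split=> //; rewrite e //; clear -hK; lia.
Qed.

(** * Packing of a tile number and two truncated levels *)

Definition bit (e i : nat) : bool := odd (e %/ 2 ^ i).
(** A pairing of the naturals with the positive integers. It is so large that the number of a tile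
    occurring in a pair listed by e is less than e. *)
Definition pairidx (a b : nat) : nat := 2 ^ a * (2 * b + 1).
(** Levels truncated at e + 1 take e + 2 values. *)
Definition radix (e : nat) : nat := e + 2.
Definition id_tile e id := id %/ radix e ^ 2.
Definition id_row e id := id %/ radix e %% radix e.
Definition id_col e id := id %% radix e.

(** The level test uses e as a threshold and reads the mode of the tile from its number modulo 8, so
    it needs no knowledge of the tiles listed by the bits. The first condition provides the
    irreflexivity on which the marks rely. *)
Definition relH (e : nat) : rel nat := fun p q =>
  [&& id_tile e p != id_tile e q, bit e (2 * pairidx (id_tile e p) (id_tile e q)), id_row e p == id_row e q
    & modeok e.+1 (id_tile e p %% 8) (id_row e p) (id_col e p)].
Definition relV (e : nat) : rel nat := fun p q =>
  [&& id_tile e p != id_tile e q, bit e (2 * pairidx (id_tile e p) (id_tile e q) + 1) & id_col e p == id_col e q].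

Lemma relH_irr e : irreflexive (relH e). Proof. by move=> p; rewrite /relH eqxx. Qed.
Lemma relV_irr e : irreflexive (relV e). Proof. by move=> p; rewrite /relV eqxx. Qed.

Lemma bit_le e i : bit e i -> 2 ^ i <= e.
Proof. by rewrite /bit; case: (leqP (2 ^ i) e) => // h; rewrite divn_small. Qed.

Lemma bits_ex (P : pred nat) m : (forall i, P i -> i < m) -> exists e, forall i, bit e i = P i.
Proof.
elim: m P => [|m IH] P hP.
  by exists 0 => i; rewrite /bit div0n; apply/esym/negP => /hP.
have [e he] := IH (fun i => P i.+1) (fun i => hP i.+1).
exists (P 0 + 2 * e) => -[|i]; first by rewrite /bit divn1 oddD oddM addbF; case: (P 0).
by rewrite -he /bit expnS divnMA; congr (odd (_ %/ _)); case: (P 0) => /=; lia.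
Qed.

Lemma pairidx_inj a b a' b' : pairidx a b = pairidx a' b' -> a = a' /\ b = b'.
Proof.
move=> h; have := congr1 (logn 2) h; rewrite !v_cross => e; split => //.
by move/eqP: h; rewrite /pairidx e eqn_pmul2l ?expn_gt0 //; lia.
Qed.

Section Code.
Context (G : finType) (Hr : rel G) (St : bool -> rel G) (Ini Lft Lst : pred G).

Local Notation valid := (validT Hr St Ini Lft Lst).

Definition num (t : wtile G) : nat := 8 * enum_rank t + tmode Hr t.

Lemma tmode_lt t : tmode Hr t < 8.
Proof. by rewrite /tmode; do !case: ifP. Qed.

Lemma num_inj : injective num.
Proof.
move=> t u h; apply: enum_rank_inj; apply: ord_inj.
by move: h (tmode_lt t) (tmode_lt u); rewrite /num; lia.
Qed.

Lemma num_mode t : num t %% 8 = tmode Hr t.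
Proof. by rewrite /num mulnC modnMDl modn_small // tmode_lt. Qed.

Definition okH (t u : wtile G) := [&& valid t, valid u, eE t == eW u, bx u != bx t & by_ u == by_ t].
Definition okV (t u : wtile G) := [&& valid t, valid u, eN t == eS u, bx u == bx t & by_ u != by_ t].

Definition okbit (i : nat) : bool := [exists t, exists u,
  okH t u && (i == 2 * pairidx (num t) (num u)) || okV t u && (i == 2 * pairidx (num t) (num u) + 1)].

Lemma program_ex : exists e, forall i, bit e i = okbit i.
Proof.
apply: (@bits_ex _ (\max_(p : wtile G * wtile G) (2 * pairidx (num p.1) (num p.2))).+2) => i.
move=> /existsP[t /existsP[u h]].
have /= := leq_bigmax (F := fun p : wtile G * wtile G => 2 * pairidx (num p.1) (num p.2)) (t, u).
move: (\max_(p : _) _) h => M h hM; move: h => /orP[] /andP[_ /eqP ->].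
  exact: leq_trans hM _.
by rewrite addn1 !ltnS.
Qed.

Context (e : nat) (eP : forall i, bit e i = okbit i).

Lemma bitH a b : bit e (2 * pairidx a b) -> exists t u, [/\ okH t u, num t = a & num u = b].
Proof.
rewrite eP => /existsP[t /existsP[u /orP[] /andP[h /eqP E]]]; last by lia.
by have [] := @pairidx_inj a b (num t) (num u); [lia | move=> -> ->; exists t, u].
Qed.

Lemma bitV a b : bit e (2 * pairidx a b + 1) -> exists t u, [/\ okV t u, num t = a & num u = b].
Proof.
rewrite eP => /existsP[t /existsP[u /orP[] /andP[h /eqP E]]]; first by lia.
by have [] := @pairidx_inj a b (num t) (num u); [lia | move=> -> ->; exists t, u].
Qed.

Lemma bitH_num t u : bit e (2 * pairidx (num t) (num u)) = okH t u.
Proof.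
apply/idP/idP => [/bitH[t' [u' [h /num_inj <- /num_inj <-]]] //|h].
by rewrite eP; apply/existsP; exists t; apply/existsP; exists u; rewrite h eqxx.
Qed.

Lemma bitV_num t u : bit e (2 * pairidx (num t) (num u) + 1) = okV t u.
Proof.
apply/idP/idP => [/bitV[t' [u' [h /num_inj <- /num_inj <-]]] //|h].
by rewrite eP; apply/existsP; exists t; apply/existsP; exists u; rewrite h eqxx orbT.
Qed.

Lemma sft_wang : sft (radix e ^ 3) (relH e) (relV e) -> exists t kh kv, wang Hr St Ini Lft Lst e.+1 t kh kv.
Proof.
move=> [c cP].
have cH x y : relH e (c x y) (c (x + 1)%R y) by have [] := cP x y.
have cV x y : relV e (c x y) (c x (y + 1)%R) by have [] := cP x y.
have ex x y : exists t, num t == id_tile e (c x y).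
  by have /and4P[_ /bitH[t [u [_ <- _]]] _ _] := cH x y; exists t.
pose T x y := xchoose (ex x y).
have TE x y : id_tile e (c x y) = num (T x y) by have /eqP := xchooseP (ex x y).
have TH x y : okH (T x y) (T (x + 1)%R y).
  by have /and4P[_ + _ _] := cH x y; rewrite !TE bitH_num.
have TV x y : okV (T x y) (T x (y + 1)%R).
  by have /and3P[_ + _] := cV x y; rewrite !TE bitV_num.
have khE x y : id_row e (c x y) = id_row e (c 0%R y).
  apply: (@iff_line (fun x => id_row e (c x y) = id_row e (c 0%R y)) 0%R) => // z.
  by have /and4P[_ _ /eqP -> _] := cH z y.
have kvE x y : id_col e (c x y) = id_col e (c x 0%R).
  apply: (@iff_line (fun y => id_col e (c x y) = id_col e (c x 0%R)) 0%R) => // z.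
  by have /and3P[_ _ /eqP ->] := cV x z.
(* Parities alternate, but that of the origin is free; a translation normalises it. *)
pose ox : int := if bx (T 0%R 0%R) then 1%R else 0%R.
pose oy : int := if by_ (T 0%R 0%R) then 1%R else 0%R.
have base_ x y : bx (T x y) = podd (x + ox)%R /\ by_ (T x y) = podd (y + oy)%R.
  have e0 : bx (T 0%R 0%R) = podd ox /\ by_ (T 0%R 0%R) = podd oy by rewrite /ox /oy; do !case: ifP.
  have ey : bx (T 0%R y) = podd ox /\ by_ (T 0%R y) = podd (y + oy)%R.
    apply: (@iff_line (fun y => bx (T 0%R y) = podd ox /\ by_ (T 0%R y) = podd (y + oy)%R) 0%R); last by rewrite add0r.
    move=> z; have /and5P[_ _ _ /eqP -> h] := TV 0%R z.
    rewrite (_ : z + 1 + oy = z + oy + 1)%R; last by lia.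
    by rewrite poddS; move: h; case: (by_ _); case: (by_ _); case: (podd (z + oy)) => //= _; split => -[].
  apply: (@iff_line (fun x => bx (T x y) = podd (x + ox)%R /\ by_ (T x y) = podd (y + oy)%R) 0%R); last by rewrite add0r.
  move=> z; have /and5P[_ _ _ h /eqP ->] := TH z y.
  rewrite (_ : z + 1 + ox = z + ox + 1)%R; last by lia.
  by rewrite poddS; move: h; case: (bx _); case: (bx _); case: (podd (z + ox)) => //= _; split => -[].
exists (fun x y => T (x - ox)%R (y - oy)%R), (fun y => id_row e (c 0%R (y - oy)%R)), (fun x => id_col e (c (x - ox)%R 0%R)).
split => x y.
- by have /and5P[] := TH (x - ox)%R (y - oy)%R.
- by have /and4P[_ _ _] := cH (x - ox)%R (y - oy)%R; rewrite khE kvE TE num_mode.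
- by have /and5P[_ _ /eqP -> _ _] := TH (x - ox)%R (y - oy)%R; congr (eW (T _ _)); lia.
- by have /and5P[_ _ /eqP -> _ _] := TV (x - ox)%R (y - oy)%R; congr (eS (T _ _)); lia.
- by have [-> _] := base_ (x - ox)%R (y - oy)%R; rewrite subrK.
- by have [_ ->] := base_ (x - ox)%R (y - oy)%R; rewrite subrK.
Qed.

Lemma num_lt t u : okH t u -> num t < radix e.
Proof.
rewrite -bitH_num => /bit_le h.
have h1 i : i < 2 ^ i by exact: ltn_expl.
have := h1 (2 * pairidx (num t) (num u)); have := h1 (num t); move: h; rewrite /radix /pairidx.
move: (2 ^ num t) => p; move: (2 ^ _) => q; nia.
Qed.

Lemma id_digits a b c : b < radix e -> c < radix e ->
  let id := (a * radix e + b) * radix e + c in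
  [/\ a < radix e -> id < radix e ^ 3, id_tile e id = a, id_row e id = b & id_col e id = c].
Proof.
move=> hb hc id; have B0 : 0 < radix e by rewrite /radix; lia.
have e1 : id %/ radix e = a * radix e + b by rewrite /id divnMDl // divn_small // addn0.
split.
- by move=> ha; rewrite /id !expnS; nia.
- by rewrite /id_tile expnS expn1 divnMA e1 divnMDl // divn_small // addn0.
- by rewrite /id_row e1 modnMDl modn_small.
- by rewrite /id_col /id modnMDl modn_small.
Qed.

Lemma run_sft g : run Hr St Ini Lft Lst e.+1 g -> sft (radix e ^ 3) (relH e) (relV e).
Proof.
move=> gP; apply: sft_compact => K.
(* All coordinates up to index K + 1 stay strictly between 2 ^ (K + 2) and 2 ^ (K + 3). *)
pose s i := (2 ^ K.+2 + i).+1; pose N := e.+1.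
pose T i j := tilev e.+1 g (s i) (s j).
pose id i j := (num (T i j) * radix e + minn (logn 2 (s j)) N) * radix e + minn (logn 2 (s i)) N.
have s_ok i : i <= K.+1 -> 2 ^ K.+2 < s i < 2 ^ K.+3.
  have : K.+2 < 2 ^ K.+2 by exact: ltn_expl.
  by rewrite /s [2 ^ K.+3]expnS; move: (2 ^ _) => p; lia.
have ok i j : i <= K.+1 -> j <= K.+1 -> valid (T i j) /\
    modeok N (tmode Hr (T i j)) (minn (logn 2 (s j)) N) (minn (logn 2 (s i)) N).
  by move=> hi hj; apply: tilev_ok gP _ _ _ (s_ok i hi) (s_ok j hj).
exists id => i j hi hj.
have [v0 m0] := ok i j ltac:(lia) ltac:(lia).
have [v1 m1] := ok i.+1 j ltac:(lia) ltac:(lia).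
have [v2 m2] := ok i j.+1 ltac:(lia) ltac:(lia).
have sS k : s k.+1 = (s k).+1 by rewrite /s addnS.
have H : okH (T i j) (T i.+1 j).
  by apply/and5P; split => //; rewrite /T sS //= /bx /by_ /=; case: odd.
have V : okV (T i j) (T i j.+1).
  by apply/and5P; split => //; rewrite /T sS //= /bx /by_ /=; case: odd.
have nlt : num (T i j) < radix e := num_lt H.
have mlt k : minn k N < radix e by rewrite /radix /N; lia.
have [d0 d1 d2 d3] := id_digits (num (T i j)) (mlt (logn 2 (s j))) (mlt (logn 2 (s i))).
have H' := H; have V' := V; rewrite -bitH_num in H'; rewrite -bitV_num in V'.
split; first exact: d0.
  have [_ f1 f2 f3] := id_digits (num (T i.+1 j)) (mlt (logn 2 (s j))) (mlt (logn 2 (s i.+1))).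
  rewrite /relH /id d1 d2 d3 f1 f2 H' eqxx num_mode m0 /= andbT.
  by apply/eqP => /num_inj E; case/and5P: H => _ _ _; rewrite E eqxx.
have [_ f1 _ f3] := id_digits (num (T i j.+1)) (mlt (logn 2 (s j.+1))) (mlt (logn 2 (s i))).
rewrite /relV /id d1 d3 f1 f3 V' eqxx /= andbT.
by apply/eqP => /num_inj E; case/and5P: V => _ _ _ _; rewrite E eqxx.
Qed.
End Code.

Lemma sft_run (G : finType) (Hr : rel G) (St : bool -> rel G) (Ini Lft Lst : pred G) :
  exists e, sft (radix e ^ 3) (relH e) (relV e) <-> exists g, run Hr St Ini Lft Lst e.+1 g.
Proof.
have [e eP] := program_ex Hr St Ini Lft Lst; exists e; split => [/(sft_wang eP)[t [kh [kv w]]]|[g gP]].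
  exact (wang_run (ltn0Sn e) w).
exact (run_sft eP gP).
Qed.

(** * Counter machines *)

(* Jz is a conditional forward jump, Jb an unconditional backward jump. *)
Inductive instr := Inc of nat | Dec of nat | Cp of nat & nat | Clr of nat | Jz of nat & nat | Jb of nat.

Definition regs := nat -> nat.
Definition setreg (m : regs) (r x : nat) : regs := fun s => if s == r then x else m s.

Definition nextreg (i : instr) (m : regs) : regs :=
  match i with
  | Inc r => setreg m r (m r).+1
  | Dec r => setreg m r (m r).-1
  | Cp r s => setreg m r (m s)
  | Clr r => setreg m r 0
  | Jz _ _ | Jb _ => m
  end.

Definition nextpc (i : instr) (pc : nat) (zero : nat -> bool) : nat :=
  match i with
  | Jz r k => if zero r then pc.+1 + k else pc.+1
  | Jb k => pc - k
  | _ => pc.+1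
  end.

(** The default [Jb 0] makes a machine that has left its program stay where it is. *)
Definition instr_at (p : seq instr) (pc : nat) : instr := nth (Jb 0) p pc.

Definition mstep (p : seq instr) (s : nat * regs) : nat * regs :=
  let i := instr_at p s.1 in
  (nextpc i s.1 (fun r => s.2 r == 0), nextreg i s.2).

Definition input (x : nat) : regs := fun r => if r == 0 then x else 0.

Definition diverges (p : seq instr) (x : nat) : Prop :=
  forall n, (iter n (mstep p) (0, input x)).1 < size p.

Definition bounded (R : nat) (i : instr) : bool :=
  match i with
  | Inc r | Dec r | Clr r => r <= R
  | Jz r _ => r <= R
  | Cp r s => (r <= R) && (s <= R)
  | Jb _ => true
  end.

(** * Counter machines as one-dimensional automata *)

Section Simulation.
Context (p : seq instr) (R : nat) (pR : all (bounded R) p).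

Local Notation bits := {ffun 'I_R.+1 -> bool}.

(* A cell knows whether it is the leftmost one, the program counter, and the
   bits of its left neighbour, of itself, and of its right neighbour.  Cell j
   contains the bits [j < m r] of the registers m. *)
Definition mcell : finType := (bool * 'I_(size p).+1 * (bits * bits * bits))%type.
Definition flag (a : mcell) : bool := a.1.1.
Definition cpc (a : mcell) : nat := a.1.2.
Definition lb (a : mcell) (r : nat) : bool := a.2.1.1 (inord r).
Definition cb (a : mcell) (r : nat) : bool := a.2.1.2 (inord r).
Definition rb (a : mcell) (r : nat) : bool := a.2.2 (inord r).

(** In unary notation an increment shifts the bits one cell to the right and a decrement one cell to
    the left, so local information suffices. *)
Definition nextbit (i : instr) (a : mcell) (r : nat) : bool :=
  match i with
  | Inc s => if r == s then lb a r else cb a r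
  | Dec s => if r == s then rb a r else cb a r
  | Cp s u => if r == s then cb a u else cb a r
  | Clr s => if r == s then false else cb a r
  | Jz _ _ | Jb _ => cb a r
  end.

Definition allr (P : pred nat) : bool := all P (iota 0 R.+1).

Definition mHr : rel mcell := fun a b =>
  [&& ~~ flag b, cpc a == cpc b & allr (fun r => (cb a r == lb b r) && (rb a r == cb b r))].
(** The leftmost cell sees which registers are zero and updates the program counter, which [mHr]
    copies to the other cells. The counter is capped at [size p], from where no step is allowed: a
    run exists only if the machine never stops. Before the threshold, register 0 is loaded
    instead. *)
Definition mSt (b : bool) : rel mcell := fun a a' =>
  if b then [&& cpc a < size p,
      flag a ==> (cpc a' == minn (nextpc (instr_at p (cpc a)) (cpc a) (fun r => ~~ cb a r)) (size p))
    & allr (fun r => cb a' r == nextbit (instr_at p (cpc a)) a r)]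
  else (cpc a' == cpc a) && allr (fun r => cb a' r == nextbit (Inc 0) a r).
Definition mIni : pred mcell := fun a => (cpc a == 0) && allr (fun r => ~~ cb a r).
(** The true bits beyond the left end are what an increment shifts in. *)
Definition mLft : pred mcell := fun a => flag a && allr (fun r => lb a r).
Definition mLst : pred mcell := fun a => allr (fun r => ~~ cb a r && ~~ rb a r).

Context (x : nat).

(* The registers are loaded in x steps, one increment each. *)
Definition conf (t : nat) : nat * regs :=
  if t <= x then (0, input t.-1) else iter (t - x.+1) (mstep p) (0, input x).

Lemma conf1 : conf 1 = (0, input 0).
Proof. by rewrite /conf; case: x. Qed.

Lemma confS t r : 0 < t -> (conf t.+1).2 r = nextreg (if x < t then instr_at p (conf t).1 else Inc 0) (conf t).2 r.
Proof.
move=> t0; rewrite /conf; case: (ltngtP t x) => [h|h|h].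
- by rewrite /= /setreg /input; case: t t0 {h} => // t _; case: r.
- by rewrite subSS -(subnSK h).
- by rewrite -h subnn /= /setreg /input; case: t t0 {h} => // t _; case: r.
Qed.

Lemma confS_pc t : 0 < t -> (conf t.+1).1 =
  if x < t then nextpc (instr_at p (conf t).1) (conf t).1 (fun r => (conf t).2 r == 0) else (conf t).1.
Proof.
move=> t0; rewrite /conf; case: (ltngtP t x) => [h|h|h] //=.
  by rewrite subSS -(subnSK h).
by rewrite h subnn.
Qed.

Lemma conf_lt t r : 0 < t -> (conf t).2 r < t.
Proof.
elim: t r => // -[|t] IH r _; first by rewrite conf1 /input /=; case: ifP.
rewrite confS //; move: (if x < t.+1 then instr_at p (conf t.+1).1 else Inc 0) => i.
have IH' s := IH s isT; clear IH.
have := IH' r; case: i => [s|s|s u|s|s k|k]; rewrite /= /setreg; try case: ifP => _.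
all: try lia.
all: try (by have := IH' s; lia).
by have := IH' u; lia.
Qed.

Lemma nextbitE i a (m : regs) j r : bounded R i -> r <= R ->
  (forall s, s <= R -> [/\ lb a s = (j <= m s), cb a s = (j < m s) & rb a s = (j.+1 < m s)]) ->
  nextbit i a r = (j < nextreg i m r).
Proof.
move=> bi hr h; have [h1 h2 h3] := h r hr.
case: i bi => [s|s|s u|s|s k|k] /= bi; rewrite /setreg ?h2 //; case: eqP => // e.
- by rewrite h1 e ltnS.
- by rewrite h3 e; lia.
by case/andP: bi => b1 b2; have [_ -> _] := h u b2.
Qed.

Lemma bounded_at pc : bounded R (instr_at p pc).
Proof.
rewrite /instr_at; case: (ltnP pc (size p)) => h; last by rewrite nth_default.
by have /all_nthP := pR; exact.
Qed.

Lemma nextpcE i pc a (m : regs) : bounded R i -> (forall s, s <= R -> cb a s = (0 < m s)) ->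
  nextpc i pc (fun r => ~~ cb a r) = nextpc i pc (fun r => m r == 0).
Proof. by move=> bi h; case: i bi => //= r k hr; rewrite h // -eqn0Ngt. Qed.

Lemma diverges_conf : diverges p x <-> forall t, x < t -> (conf t).1 < size p.
Proof.
split => h t; last by have := h (t + x.+1) ltac:(lia); rewrite /conf ifN ?addnK //; lia.
by move=> ht; rewrite /conf [t <= x]leqNgt ht /=; exact: h.
Qed.

Lemma forallP_le (P : nat -> bool) : reflect (forall r, r <= R -> P r) (allr P).
Proof.
apply: (iffP allP) => h r; first by move=> hr; apply: h; rewrite mem_iota.
by rewrite mem_iota => hr; apply: h.
Qed.

Lemma diverges_run : diverges p x -> exists g, run mHr mSt mIni mLft mLst x.+1 g.
Proof.
move=> /diverges_conf dv.
pose g j t : mcell := (j == 0, inord (minn (conf t).1 (size p)),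
  ([ffun r : 'I_R.+1 => j <= (conf t).2 r], [ffun r : 'I_R.+1 => j < (conf t).2 r],
   [ffun r : 'I_R.+1 => j.+1 < (conf t).2 r])).
have gb j t r : r <= R -> [/\ lb (g j t) r = (j <= (conf t).2 r), cb (g j t) r = (j < (conf t).2 r)
    & rb (g j t) r = (j.+1 < (conf t).2 r)].
  by move=> hr; rewrite /lb /cb /rb /= !ffunE inordK.
have gpc j t : cpc (g j t) = minn (conf t).1 (size p).
  by rewrite /cpc /= inordK // ltnS geq_minr.
exists g; split.
- move=> j t _; apply/and3P; split => //.
  by apply/forallP_le => r hr; have [_ -> ->] := gb j t r hr; have [-> -> _] := gb j.+1 t r hr; rewrite !eqxx.
- move=> j t jt; have t0 : 0 < t by lia.
  rewrite /mSt; case: ifP => xt.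
    have h := dv t xt; have e : minn (conf t).1 (size p) = (conf t).1 by lia.
    apply/and3P; split; rewrite !gpc e //.
      apply/implyP => /eqP j0; rewrite confS_pc // xt (nextpcE _ (bounded_at _) (m := (conf t).2)) //.
      by move=> s hs; have [_ -> _] := gb j t s hs; rewrite j0.
    apply/forallP_le => r hr; have [_ -> _] := gb j t.+1 r hr.
    by rewrite confS // xt (@nextbitE _ _ (conf t).2 j) ?bounded_at // => s; exact: gb.
  rewrite !gpc confS_pc // xt eqxx andTb; apply/forallP_le => r hr; have [_ -> _] := gb j t.+1 r hr.
  by rewrite confS // xt (@nextbitE (Inc 0) _ (conf t).2 j) // => s; exact: gb.
- apply/andP; split; first by rewrite gpc conf1 min0n.
  by apply/forallP_le => r hr; have [_ -> _] := gb 0 1 r hr; rewrite conf1 /input /=; case: ifP.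
- move=> t t0; apply/andP; split => //; apply/forallP_le => r hr; by have [-> _ _] := gb 0 t r hr.
- move=> t; apply/forallP_le => r hr; have [_ -> ->] := gb t t.+1 r hr.
  by have := @conf_lt t.+1 r isT; lia.
Qed.

Lemma run_diverges g : run mHr mSt mIni mLft mLst x.+1 g -> diverges p x.
Proof.
move=> gP; apply/diverges_conf.
have pcE t j : j < t -> cpc (g j t) = cpc (g 0 t).
  by elim: j => // j IH h; rewrite -IH ?(ltnW h) //; case/and3P: (run_Hr gP h) => _ /eqP.
have lE j t : j < t -> forall r, r <= R -> lb (g j t) r = if j is j'.+1 then cb (g j' t) r else true.
  case: j => [|j] h r hr; first by have /andP[_ /forallP_le /(_ r hr)] := run_Lft gP h.
  by have /and3P[_ _ /forallP_le /(_ r hr) /andP[/eqP]] := run_Hr gP h.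
have rE j t : j < t -> forall r, r <= R -> rb (g j t) r = if j.+1 < t then cb (g j.+1 t) r else false.
  move=> h r hr; case: ifP => h'; first by have /and3P[_ _ /forallP_le /(_ r hr) /andP[_ /eqP]] := run_Hr gP h'.
  have e : t = j.+1 by lia.
  by have /forallP_le /(_ r hr) /andP[_ /negbTE] := run_Lst gP j; rewrite e.
have main t : 0 < t -> (t > x.+1 -> (conf t.-1).1 < size p) /\ cpc (g 0 t) = minn (conf t).1 (size p) /\
    forall j, j < t -> forall r, r <= R -> cb (g j t) r = (j < (conf t).2 r).
  elim: t => // -[|t] IH _.
    rewrite conf1 min0n; split; first by lia.
    have /andP[/eqP -> /forallP_le h] := run_Ini gP; split => // -[|//] _ r hr.
    by rewrite (negbTE (h r hr)) /input /=; case: ifP.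
  have [_ [ipc icb]] := IH isT; set T := t.+1 in IH ipc icb *.
  have nb j : j < T -> forall s, s <= R -> [/\ lb (g j T) s = (j <= (conf T).2 s), cb (g j T) s = (j < (conf T).2 s)
      & rb (g j T) s = (j.+1 < (conf T).2 s)].
    move=> h s hs; rewrite lE // rE // icb //; split => //.
      by case: j h => // j h; rewrite icb //; lia.
    case: ifP => h'; first by rewrite icb.
    by have := @conf_lt T s isT; lia.
  have st j (h : j < T) := run_St gP h.
  have cbE j : j < T -> forall r, r <= R -> cb (g j T.+1) r = (j < (conf T.+1).2 r).
    move=> h r hr; have := st j h; rewrite confS // /mSt ltnS -/T; case: ifP => xt.
      case/and3P => hpc _ /forallP_le /(_ r hr) /eqP ->.
      have e : cpc (g j T) = (conf T).1 by move: hpc; rewrite pcE // ipc; lia.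
      by rewrite e (@nextbitE _ _ (conf T).2 j) ?bounded_at // => s; exact: nb.
    case/andP => _ /forallP_le /(_ r hr) /eqP ->.
    by rewrite (@nextbitE (Inc 0) _ (conf T).2 j) // => s; exact: nb.
  have cbE' j : j < T.+1 -> forall r, r <= R -> cb (g j T.+1) r = (j < (conf T.+1).2 r).
    rewrite ltnS leq_eqVlt => /orP[/eqP-> r hr|]; last exact: cbE.
    have /forallP_le /(_ r hr) /andP[/negbTE -> _] := run_Lst gP T.
    by have := @conf_lt T.+1 r isT; lia.
  have f0 : flag (g 0 T) by case/andP: (run_Lft gP (isT : 0 < T)).
  have := st 0 isT; rewrite /mSt; case: ifP => xt.
    case/and3P; rewrite f0 /= => h1 /eqP h2 _.
    have e : cpc (g 0 T) = (conf T).1 by move: h1; rewrite ipc; lia.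
    split; first by rewrite -e.
    split; last exact: cbE'.
    rewrite h2 e confS_pc // xt (nextpcE _ (bounded_at _) (m := (conf T).2)) //.
    by move=> s hs; have [] := nb 0 isT s hs.
  case/andP => /eqP h1 _; split; first by lia.
  by split; first by rewrite h1 confS_pc // xt.
by move=> t ht; have [/(_ ht)] := main t.+1 isT.
Qed.

End Simulation.

Lemma bounded_ex (p : seq instr) : exists R, all (bounded R) p.
Proof.
pose top i := match i with Inc r | Dec r | Clr r | Jz r _ => r | Cp r s => r + s | Jb _ => 0 end.
suff h R : sumn (map top p) <= R -> all (bounded R) p by exists (sumn (map top p)); exact: h.
elim: p => //= i p IH h; rewrite IH ?andbT; last by move: h; lia.
by case: i h => [r|r|r s|r|r k|k] /= h; lia.
Qed.

Lemma sft_machine (p : seq instr) :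
  exists e, sft (radix e ^ 3) (relH e) (relV e) <-> diverges p e.
Proof.
have [R pR] := bounded_ex p.
have [e eP] := sft_run (@mHr p R) (@mSt p R) (@mIni p R) (@mLft p R) (@mLst p R).
exists e; rewrite eP; split => [[g]|]; [exact: run_diverges | exact: diverges_run].
Qed.

(** * Compilation of recursive functions *)

Fixpoint AllP (T : Type) (P : T -> Prop) (s : seq T) : Prop :=
  if s is x :: s' then P x /\ AllP P s' else True.

(** The nested list in [Comp] calls for an induction hypothesis on its members, which [AllP]
    carries. *)
Definition recfun_nested_ind (P : recfun -> Prop) (hZ : P Zero) (hS : P Succ) (hP : forall i, P (Proj i))
  (hC : forall f gs, P f -> AllP P gs -> P (Comp f gs)) (hR : forall f g, P f -> P g -> P (Prec f g))
  (hM : forall f, P f -> P (Mu f)) : forall f, P f :=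
  fix F f := match f with
  | Zero => hZ
  | Succ => hS
  | Proj i => hP i
  | Comp f gs => hC f gs (F f) ((fix A gs : AllP P gs := match gs with
      | [::] => I
      | g :: gs' => conj (F g) (A gs')
      end) gs)
  | Prec f g => hR f g (F f) (F g)
  | Mu f => hM f (F f)
  end.

(* The code for f reads the registers args, writes its result into out and uses
   the registers from b on as scratch space. *)
Fixpoint compile (f : recfun) (args : seq nat) (out b : nat) {struct f} : seq instr :=
  match f with
  | Zero => [:: Clr out]
  | Succ => [:: Cp out (head 0 args); Inc out]
  | Proj i => [:: Cp out (nth 0 args i)]
  | Comp f gs =>
      let b' := b + size gs in
      (fix go l i := if l is g :: l' then compile g args i b' ++ go l' i.+1 else [::]) gs b
      ++ compile f (iota b (size gs)) out b'
  | Prec f g =>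
      let n := head 0 args in let xs := behead args in
      let body := compile g (b.+1 :: out :: xs) b.+2 b.+3 in
      compile f xs out b.+3 ++ [:: Cp b n, Clr b.+1, Jz b (size body).+4 & body] ++
      [:: Cp out b.+2; Inc b.+1; Dec b; Jb (size body).+4]
  | Mu f =>
      let body := compile f (out :: args) b b.+1 in
      Clr out :: body ++ [:: Jz b 2; Inc out; Jb (size body).+2]
  end.

(** The local loop of [compile] for [Comp], restated as a separate function so that it has an
    induction of its own. *)
Fixpoint compile_seq (args : seq nat) (b : nat) (gs : seq recfun) (i : nat) : seq instr :=
  if gs is g :: gs' then compile g args i b ++ compile_seq args b gs' i.+1 else [::].

Lemma compile_Comp f gs args out b : compile (Comp f gs) args out b =
  compile_seq args (b + size gs) gs b ++ compile f (iota b (size gs)) out (b + size gs).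
Proof.
rewrite /=; congr (_ ++ _); move: (b + size gs) => b'.
by elim: gs b => //= g gs IH i; rewrite IH.
Qed.

(** * Correctness of the compiled code *)

Section Correct.
Context (p : seq instr).

Definition reach (s s' : nat * regs) : Prop := exists n, iter n (mstep p) s = s'.

Lemma reach_refl s : reach s s. Proof. by exists 0. Qed.

Lemma reach_trans s1 s2 s3 : reach s1 s2 -> reach s2 s3 -> reach s1 s3.
Proof. by move=> [n <-] [k <-]; exists (k + n); rewrite iterD. Qed.

Lemma reach_step s1 s2 : reach (mstep p s1) s2 -> reach s1 s2.
Proof. by apply: reach_trans; exists 1. Qed.

Definition block (pc : nat) (c : seq instr) : Prop :=
  forall i, i < size c -> instr_at p (pc + i) = nth (Jb 0) c i.

Lemma block_cat pc c1 c2 : block pc (c1 ++ c2) <-> block pc c1 /\ block (pc + size c1) c2.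
Proof.
split => [h|[h1 h2] i].
  split => i hi; first by rewrite h ?nth_cat ?hi // size_cat; lia.
  by rewrite -addnA h ?nth_cat ?size_cat ?ltn_add2l // ltnNge leq_addr /= addKn.
rewrite size_cat nth_cat; case: (ltnP i (size c1)) => hi h; first exact: h1.
by rewrite -h2 ?subnKC //; [congr (instr_at p _); lia | lia].
Qed.

Lemma block_cons pc i c : block pc (i :: c) <-> instr_at p pc = i /\ block pc.+1 c.
Proof.
rewrite -cat1s block_cat addn1; split => -[h1 h2]; split => //; first by have := h1 0 isT; rewrite addn0.
by case=> // _; rewrite addn0 h1.
Qed.

Definition computes (f : recfun) (args : seq nat) (out b : nat) : Prop :=
  forall pc m y, block pc (compile f args out b) -> eval f (map m args) y ->
  exists m', [/\ reach (pc, m) (pc + size (compile f args out b), m'), m' out = y &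
    forall r, r < b -> r != out -> m' r = m r].

(** [out] must not be an argument: it serves as accumulator in [Prec] and as counter in [Mu] while
    the arguments are still being read. *)
Definition compilable (f : recfun) : Prop :=
  forall args out b, all (fun r => r < b) args -> out < b -> out \notin args -> computes f args out b.

Lemma mstepE pc m i : instr_at p pc = i -> mstep p (pc, m) = (nextpc i pc (fun r => m r == 0), nextreg i m).
Proof. by move=> h; rewrite /mstep /= h. Qed.

Lemma map_keep (b out : nat) (m m' : regs) args : all (fun r => r < b) args -> out \notin args ->
  (forall r, r < b -> r != out -> m' r = m r) -> map m' args = map m args.
Proof.
move=> /allP h1 h2 h; apply/eq_in_map => r hr; apply: h; first exact: h1.
by apply: contraNneq h2 => <-.
Qed.

Lemma setregE m r x : setreg m r x r = x. Proof. by rewrite /setreg eqxx. Qed.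
Lemma setregN m r x s : s != r -> setreg m r x s = m s. Proof. by rewrite /setreg => /negbTE ->. Qed.

Lemma compilable_Zero : compilable Zero.
Proof.
move=> args out b ha ho hn pc m y /block_cons[h _] ev; inversion ev; subst.
exists (setreg m out 0); split; [|by rewrite setregE|by move=> r _ ho'; rewrite setregN].
by apply: reach_step; rewrite (mstepE _ h) /= addn1; exact: reach_refl.
Qed.

Lemma compilable_Proj i : compilable (Proj i).
Proof.
move=> args out b ha ho hn pc m y /block_cons[h _] ev; inversion ev as [| |? ? hi| | | | ]; subst.
rewrite size_map in hi.
exists (setreg m out (m (nth 0 args i))); split; [|by rewrite setregE (nth_map 0)|by move=> r _ ho'; rewrite setregN].
by apply: reach_step; rewrite (mstepE _ h) /= addn1; exact: reach_refl.
Qed.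

Lemma compilable_Succ : compilable Succ.
Proof.
move=> [|a [|? ?]] out b ha ho hn pc m y /block_cons[h /block_cons[h' _]] ev; inversion ev; subst.
exists (setreg (setreg m out (m a)) out (setreg m out (m a) out).+1); split; [|by rewrite !setregE|by move=> r _ ho'; rewrite !setregN].
by apply: reach_step; rewrite (mstepE _ h); apply: reach_step; rewrite (mstepE _ h') /= addn2; exact: reach_refl.
Qed.

Lemma compile_seq_ok gs args b i pc m ys : AllP compilable gs -> all (fun r => r < i) args -> i + size gs <= b ->
  block pc (compile_seq args b gs i) -> evals gs (map m args) ys ->
  exists m', [/\ reach (pc, m) (pc + size (compile_seq args b gs i), m'), map m' (iota i (size gs)) = ys &
    forall r, r < i -> m' r = m r].
Proof.
elim: gs i pc m ys => [|g gs IH] i pc m ys /=.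
  by move=> _ _ _ _ ev; inversion ev; subst; exists m; rewrite addn0; split => //; exact: reach_refl.
move=> [hg hgs] ha hi /block_cat[hb1 hb2] ev; inversion ev as [|? ? ? y0 ys0 e1 e2]; subst.
have ha' : all (fun r => r < b) args by apply: sub_all ha => r /=; lia.
have hn : i \notin args by apply/negP => /(allP ha); rewrite ltnn.
have [m1 [r1 o1 k1]] := hg args i b ha' ltac:(lia) hn pc m y0 hb1 e1.
have k1' r : r < i -> m1 r = m r by move=> hr; apply: k1; lia.
rewrite -(map_keep (b := b) (m' := m1) ha' hn k1) in e2.
have ha2 : all (fun r => r < i.+1) args by apply: sub_all ha => r /=; lia.
have [m2 [r2 o2 k2]] := IH i.+1 _ m1 ys0 hgs ha2 ltac:(lia) hb2 e2.
exists m2; split; first by rewrite size_cat addnA; exact: reach_trans r1 r2.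
  by rewrite o2 k2 // o1.
by move=> r hr; rewrite k2 ?k1' //; lia.
Qed.

Lemma compilable_Comp f gs : compilable f -> AllP compilable gs -> compilable (Comp f gs).
Proof.
move=> hf hgs args out b ha ho hn pc m y; rewrite compile_Comp => /block_cat[hb1 hb2] ev.
inversion ev as [| | |? ? ? ys ? e1 e2| | |]; subst.
have [m1 [r1 o1 k1]] := compile_seq_ok hgs ha (leqnn _) hb1 e1.
rewrite -o1 in e2.
have [||| m2 [r2 o2 k2]] := hf (iota b (size gs)) out (b + size gs) _ _ _ _ m1 y hb2 e2.
- by apply/allP => r; rewrite mem_iota; lia.
- by lia.
- by rewrite mem_iota; lia.
exists m2; split => //; first by rewrite size_cat addnA; exact: reach_trans r1 r2.
by move=> r hr hro; rewrite k2 ?k1 //; lia.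
Qed.

Lemma Mu_inv f v y : eval (Mu f) v y ->
  exists h : nat -> nat, (forall k, k < y -> eval f (k :: v) (h k).+1) /\ eval f (y :: v) 0.
Proof. by move=> e; inversion e as [| | | | | |? ? ? h hk hy]; subst; exists h. Qed.

Lemma compilable_Mu f : compilable f -> compilable (Mu f).
Proof.
move=> hf args out b ha ho hn pc m y; rewrite /=; set body := compile _ _ _ _.
move=> /block_cons[h0 /block_cat[hb /block_cons[h1 /block_cons[h2 /block_cons[h3 _]]]]] ev.
have [h [hk hy]] := Mu_inv ev.
have args_lt : all (fun r => r < b.+1) (out :: args).
  by rewrite /= (ltn_trans ho) //=; apply: sub_all ha => r /=; lia.
have b_notin : b \notin out :: args.
  by rewrite inE negb_or (gtn_eqF ho) /=; apply/negP => /(allP ha); rewrite ltnn.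
have loop k m1 : k <= y -> m1 out = k -> (forall r, r < b -> r != out -> m1 r = m r) ->
    exists m', [/\ reach (pc.+1, m1) (pc + (size body).+4, m'), m' out = y &
      forall r, r < b -> r != out -> m' r = m r].
  move=> hk0; have [d] : exists d, d + k = y by exists (y - k); rewrite subnK.
  elim: d k m1 {hk0} => [|d IH] k m1 hd o1 k1.
    have e : eval f (map m1 (out :: args)) 0 by rewrite /= o1 (map_keep ha hn k1); move: hd; rewrite add0n => ->.
    have [m2 [r2 o2 k2]] := hf (out :: args) b b.+1 args_lt (ltnSn b) b_notin pc.+1 m1 0 hb e.
    exists m2; split.
    - apply: reach_trans r2 _; apply: reach_step; rewrite (mstepE _ h1) /= o2 /=.
      by rewrite (_ : _ + _ = pc + (size body).+4); [exact: reach_refl | lia].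
    - by rewrite k2 ?(ltn_eqF ho) //; lia.
    - by move=> r hr hro; rewrite k2 ?k1 ?(ltn_eqF hr) //; lia.
  have ky : k < y by lia.
  have e : eval f (map m1 (out :: args)) (h k).+1 by rewrite /= o1 (map_keep ha hn k1); exact: hk.
  have [m2 [r2 o2 k2]] := hf (out :: args) b b.+1 args_lt (ltnSn b) b_notin pc.+1 m1 _ hb e.
  have [||| m3 [r3 o3 k3]] := IH k.+1 (setreg m2 out (m2 out).+1); first by lia.
  - by rewrite setregE k2 ?o1 ?(ltn_eqF ho) //; lia.
  - by move=> r hr hro; rewrite setregN // k2 ?k1 ?(ltn_eqF hr) //; lia.
  exists m3; split => //; apply: reach_trans r2 _; apply: reach_step; rewrite (mstepE _ h1) /= o2 /=.
  apply: reach_step; rewrite (mstepE _ h2) /=; apply: reach_step; rewrite (mstepE _ h3) /=.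
  by rewrite (_ : _ - _ = pc.+1); [exact: r3 | rewrite -/body; lia].
have [|m' [r' o' k']] := loop 0 (setreg m out 0) (leq0n y) (setregE _ _ _).
  by move=> r _ hro; rewrite setregN.
exists m'; split => //; apply: reach_step; rewrite (mstepE _ h0) /=.
by rewrite size_cat /= (_ : pc + _ = pc + (size body).+4); [exact: r' | lia].
Qed.

Lemma Prec_trace f g k v y : eval (Prec f g) (k :: v) y -> exists z : nat -> nat,
  [/\ eval f v (z 0), forall i, i < k -> eval g [:: i, z i & v] (z i.+1) & z k = y].
Proof.
elim: k y => [|k IH] y e; inversion e as [| | | |? ? ? ? e1|? ? ? ? y0 ? e1 e2|]; subst; first by exists (fun=> y).
have [z [h1 h2 h3]] := IH _ e1; exists (fun i => if i <= k then z i else y).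
rewrite ltnn; split => // i; rewrite ltnS; case: (ltngtP i k) => // [h _|-> _]; first exact: h2.
by rewrite h3.
Qed.

Lemma compilable_Prec f g : compilable f -> compilable g -> compilable (Prec f g).
Proof.
move=> hf hg [|n xs] out b ha ho hn pc m y /=; first by move=> _ ev; inversion ev.
set body := compile g _ _ _; set init := compile f _ _ _.
move=> /block_cat[hb0 /block_cons[h1 /block_cons[h2 /block_cons[h3]]]].
move=> /block_cat[hb1 /block_cons[h4 /block_cons[h5 /block_cons[h6 /block_cons[h7 _]]]]] ev.
move: ha hn; rewrite inE negb_or => /andP[hnb ha] /andP[hno hn].
have xs_lt : all (fun r => r < b.+3) xs by apply: sub_all ha => r /=; lia.
have gargs_lt : all (fun r => r < b.+3) (b.+1 :: out :: xs).
  by rewrite /= xs_lt andbT; lia.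
have gout : b.+2 \notin b.+1 :: out :: xs.
  have e3 : b.+2 \notin xs by apply/negP => /(allP ha) /=; lia.
  have e1 : b.+2 != b.+1 by rewrite eqn_leq ltnn.
  have e2 : b.+2 != out by rewrite gtn_eqF //; lia.
  by rewrite in_cons negb_or e1 in_cons negb_or e2.
have [z [z0 zS zM]] := Prec_trace ev.
have [m0 [r0 o0 k0]] := hf xs out b.+3 xs_lt ltac:(lia) hn pc m _ hb0 z0.
set q := pc + size init in r0 h1 h2 h3 hb1 h4 h5 h6 h7 *.
(* Invariant before round k: [out] holds the value after k rounds, [b] the number of rounds left and
   [b.+1] the number of rounds done. *)
have loop k m1 : k <= m n -> m1 out = z k -> m1 b = m n - k -> m1 b.+1 = k ->
    (forall r, r < b -> r != out -> m1 r = m r) ->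
    exists m', [/\ reach (q.+2, m1) (q + (size body + 7), m'), m' out = y &
      forall r, r < b -> r != out -> m' r = m r].
  move=> hk0; have [d] : exists d, d + k = m n by exists (m n - k); rewrite subnK.
  elim: d k m1 {hk0} => [|d IH] i m1 hd o1 b1 c1 k1.
    exists m1; split => //; last by rewrite o1 -zM; congr z; lia.
    apply: reach_step; rewrite (mstepE _ h3) /= b1 (_ : m n - i == 0) /=; last by lia.
    by rewrite (_ : _ + _ = q + (size body + 7)); [exact: reach_refl | lia].
  have e : eval g (map m1 (b.+1 :: out :: xs)) (z i.+1).
    by rewrite /= o1 c1 (map_keep ha hn k1); apply: zS; lia.
  have [m2 [r2 o2 k2]] := hg _ b.+2 b.+3 gargs_lt (ltnSn _) gout q.+3 m1 _ hb1 e.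
  pose m3 := setreg m2 out (m2 b.+2); pose m4 := setreg m3 b.+1 (m3 b.+1).+1; pose m5 := setreg m4 b (m4 b).-1.
  have [||||| m' [r' o' k']] := IH i.+1 m5.
  - by lia.
  - by rewrite /m5 setregN 1?/m4 1?setregN 1?/m3 ?setregE //; lia.
  - rewrite /m5 setregE /m4 setregN 1?/m3 1?setregN ?k2 ?b1; lia.
  - rewrite /m5 setregN 1?/m4 1?setregE 1?/m3 1?setregN ?k2 ?c1; lia.
  - move=> r hr hro; rewrite /m5 setregN 1?/m4 1?setregN 1?/m3 1?setregN ?k2 ?k1 //; lia.
  exists m'; split => //; apply: reach_step; rewrite (mstepE _ h3) /= b1 (_ : m n - i == 0 = false) /=; last by lia.
  apply: reach_trans r2 _; apply: reach_step; rewrite (mstepE _ h4) /=.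
  apply: reach_step; rewrite (mstepE _ h5) /=; apply: reach_step; rewrite (mstepE _ h6) /=.
  apply: reach_step; rewrite (mstepE _ h7) /= (_ : _ - _ = q.+2); [exact: r' | lia].
pose m1 := setreg (setreg m0 b (m0 n)) b.+1 0.
have [|||| m' [r' o' k']] := loop 0 m1 (leq0n _).
- by rewrite /m1 !setregN ?o0 //; lia.
- by rewrite /m1 setregN ?setregE ?subn0 ?k0 //; lia.
- by rewrite /m1 setregE.
- by move=> r hr hro; rewrite /m1 !setregN ?k0 //; lia.
exists m'; split => //; apply: reach_trans r0 _.
apply: reach_step; rewrite (mstepE _ h1) /=; apply: reach_step; rewrite (mstepE _ h2) /=.
rewrite (_ : pc + _ = q + (size body + 7)); first exact: r'.
by rewrite /q !size_cat /=; rewrite size_cat /=; lia.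
Qed.

Lemma compile_ok f : compilable f.
Proof.
elim/recfun_nested_ind: f => *; [exact: compilable_Zero | exact: compilable_Succ | exact: compilable_Proj
  | exact: compilable_Comp | exact: compilable_Prec | exact: compilable_Mu].
Qed.

End Correct.

(* The last four instructions loop for ever on the value 0. *)
Definition decider (f : recfun) : seq instr :=
  compile f [:: 0] 1 2 ++ [:: Jz 1 2; Clr 1; Jz 1 1; Jb 0].

Lemma stuck p pc m n : mstep p (pc, m) = (pc, m) -> iter n (mstep p) (pc, m) = (pc, m).
Proof. by move=> h; elim: n => // n IH; rewrite iterS IH. Qed.

Lemma stuck_end p pc m : size p <= pc -> mstep p (pc, m) = (pc, m).
Proof. by move=> h; rewrite /mstep /instr_at /= nth_default //= subn0. Qed.

Lemma decider_ok f x (b : bool) : eval f [:: x] b -> diverges (decider f) x <-> b = false.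
Proof.
move=> ev; set p := decider f; set c := compile f [:: 0] 1 2.
have szp : size p = size c + 4 by rewrite size_cat.
have [hb1 /block_cons[h1 /block_cons[h2 /block_cons[h3 /block_cons[h4 _]]]]] :
    block p 0 c /\ block p (size c) [:: Jz 1 2; Clr 1; Jz 1 1; Jb 0].
  by have := @block_cat p 0 c [:: Jz 1 2; Clr 1; Jz 1 1; Jb 0]; rewrite add0n => <- i _; rewrite add0n.
have [m [[n hn] o _]] := @compile_ok p f [:: 0] 1 2 isT isT isT 0 (input x) b hb1 ev.
rewrite add0n -/c in hn.
split => [h|b0].
  (* On the value 1 the first jump is not taken, and clearing register 1 makes the second jump leave
     the program. *)
  case: b o {ev} => // o; have := h (3 + n).
  have -> : iter (3 + n) (mstep p) (0, input x) = ((size c).+4, setreg m 1 0).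
    by rewrite iterD hn /= (mstepE _ h1) /= o (mstepE _ h2) /= (mstepE _ h3) /= addn1.
  by rewrite szp /=; lia.
have end_ k : iter (k + n.+1) (mstep p) (0, input x) = ((size c).+3, m).
  rewrite iterD iterS hn (mstepE _ h1) /= o b0 /= addn2; apply: stuck.
  by rewrite (mstepE _ h4) /= subn0.
move=> k; rewrite ltnNge; apply/negP => hk.
have := end_ k; rewrite addnC iterD; case: (iter k _ _) hk => pc m1 hk.
by rewrite stuck; [case=> e _; move: hk; rewrite szp e /=; lia | exact: stuck_end].
Qed.

(** * Computable functions *)

Definition computable (k : nat) (F : seq nat -> nat) : Prop :=
  exists f, forall s, size s = k -> eval f s (F s).

Lemma computable_ext k F F' : (forall s, size s = k -> F s = F' s) -> computable k F -> computable k F'.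
Proof. by move=> e [f fP]; exists f => s hs; rewrite -e //; exact: fP. Qed.

Lemma computable_nth k i : i < k -> computable k (fun s => nth 0 s i).
Proof. by move=> hi; exists (Proj i) => s hs; apply: eval_Proj; rewrite hs. Qed.

Lemma computable_comp k (Gs : seq (seq nat -> nat)) F : computable (size Gs) F -> AllP (computable k) Gs ->
  computable k (fun s => F [seq G s | G <- Gs]).
Proof.
move=> [f fP] h; suff [gs gsP] : exists gs, forall s, size s = k -> evals gs s [seq G s | G <- Gs].
  by exists (Comp f gs) => s hs; apply: eval_Comp (gsP s hs) (fP _ _); rewrite size_map.
elim: Gs h {f fP F} => [_|G Gs IH [[g gP] /IH[gs gsP]]] /=; first by exists [::] => s _; exact: evals_nil.
by exists (g :: gs) => s hs; apply: evals_cons; [exact: gP | exact: gsP].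
Qed.

Lemma computable_S k F : computable k F -> computable k (fun s => (F s).+1).
Proof.
move=> h; apply: (computable_ext _ (@computable_comp k [:: F] (fun s => (nth 0 s 0).+1) _ (conj h I))) => //.
by exists Succ => -[|x [|? ?]] // _; exact: eval_Succ.
Qed.

Lemma computable_const k c : computable k (fun=> c).
Proof. by elim: c => [|c /computable_S //]; exists Zero => s _; exact: eval_Zero. Qed.

Lemma computable_rec k A B F : computable k A -> computable k.+2 B ->
  (forall v, size v = k -> F (0 :: v) = A v) ->
  (forall n v, size v = k -> F (n.+1 :: v) = B [:: n, F (n :: v) & v]) -> computable k.+1 F.
Proof.
move=> [a aP] [b bP] h0 hS; exists (Prec a b) => -[//|n v] [hv].
elim: n => [|n IH]; first by rewrite h0 //; apply: eval_Prec0; exact: aP.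
by rewrite hS //; apply: eval_PrecS IH _; apply: bP; rewrite /= hv.
Qed.

Lemma computable1 (phi : nat -> nat) k F : computable 1 (fun s => phi (nth 0 s 0)) ->
  computable k F -> computable k (fun s => phi (F s)).
Proof. by move=> h hF; exact: (@computable_comp k [:: F] _ h (conj hF I)). Qed.

Lemma computable2 (phi : nat -> nat -> nat) k F G : computable 2 (fun s => phi (nth 0 s 0) (nth 0 s 1)) ->
  computable k F -> computable k G -> computable k (fun s => phi (F s) (G s)).
Proof. by move=> h hF hG; exact: (@computable_comp k [:: F; G] _ h (conj hF (conj hG I))). Qed.

Lemma computable_add k F G : computable k F -> computable k G -> computable k (fun s => F s + G s).
Proof.
apply: computable2; apply: (@computable_rec 1 (nth 0 ^~ 0) (fun s => (nth 0 s 1).+1)) => //.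
- exact: computable_nth.
- by apply: computable_S; exact: computable_nth.
Qed.

Lemma computable_mul k F G : computable k F -> computable k G -> computable k (fun s => F s * G s).
Proof.
apply: computable2; apply: (@computable_rec 1 (fun=> 0) (fun s => nth 0 s 2 + nth 0 s 1)) => //.
- exact: computable_const.
- by apply: computable_add; exact: computable_nth.
Qed.

Lemma computable_exp k F G : computable k F -> computable k G -> computable k (fun s => F s ^ G s).
Proof.
move=> hF hG; apply: (@computable2 (fun x y => y ^ x)) hG hF.
apply: (@computable_rec 1 (fun=> 1) (fun s => nth 0 s 2 * nth 0 s 1)) => //.
- exact: computable_const.
- by apply: computable_mul; exact: computable_nth.
- by move=> n v _; rewrite expnS.
Qed.

Lemma computable_pred k F : computable k F -> computable k (fun s => (F s).-1).
Proof.
apply: (computable1 (phi := predn)); apply: (@computable_rec 0 (fun=> 0) (nth 0 ^~ 0)) => //.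
- exact: computable_const.
- exact: computable_nth.
Qed.

Lemma computable_sub k F G : computable k F -> computable k G -> computable k (fun s => F s - G s).
Proof.
move=> hF hG; apply: (@computable2 (fun x y => y - x)) hG hF.
apply: (@computable_rec 1 (nth 0 ^~ 0) (fun s => (nth 0 s 1).-1)) => //.
- exact: computable_nth.
- by apply: computable_pred; exact: computable_nth.
- by move=> [|x [|? ?]] //= _; rewrite subn0.
- by move=> n v _; rewrite /= subnS.
Qed.

Lemma computable_eq0 k F : computable k F -> computable k (fun s => F s == 0).
Proof.
apply: (computable1 (phi := fun x => x == 0)); apply: (@computable_rec 0 (fun=> 1) (fun=> 0)) => //; exact: computable_const.
Qed.

Lemma computable_leq k F G : computable k F -> computable k G -> computable k (fun s => F s <= G s).
Proof. by move=> hF hG; apply: computable_eq0; exact: computable_sub. Qed.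

Lemma computable_and k (P Q : seq nat -> bool) : computable k (fun s => P s) -> computable k (fun s => Q s) ->
  computable k (fun s => P s && Q s).
Proof.
by move=> hP hQ; apply: computable_ext (computable_mul hP hQ) => s _; case: (P s); case: (Q s).
Qed.

Lemma computable_not k (P : seq nat -> bool) : computable k (fun s => P s) -> computable k (fun s => ~~ P s).
Proof. by move=> hP; apply: computable_ext (computable_eq0 hP) => s _; case: (P s). Qed.

Lemma computable_or k (P Q : seq nat -> bool) : computable k (fun s => P s) -> computable k (fun s => Q s) ->
  computable k (fun s => P s || Q s).
Proof.
move=> hP hQ; apply: computable_ext (computable_not (computable_and (computable_not hP) (computable_not hQ))) => s _.
by rewrite negb_and !negbK.
Qed.

Lemma computable_eq k F G : computable k F -> computable k G -> computable k (fun s => F s == G s).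
Proof.
move=> hF hG; apply: computable_ext (computable_and (computable_leq hF hG) (computable_leq hG hF)) => s _.
by rewrite eqn_leq.
Qed.

Lemma computable_if k (P : seq nat -> bool) F G : computable k (fun s => P s) -> computable k F -> computable k G ->
  computable k (fun s => if P s then F s else G s).
Proof.
move=> hP hF hG.
apply: computable_ext (computable_add (computable_mul hP hF) (computable_mul (computable_not hP) hG)) => s _.
by case: (P s); rewrite /= ?mul1n ?mul0n ?addn0.
Qed.

Lemma computable_ifb k (P Q R : seq nat -> bool) : computable k (fun s => P s) -> computable k (fun s => Q s) ->
  computable k (fun s => R s) -> computable k (fun s => if P s then Q s else R s).
Proof. by move=> hP hQ hR; apply: computable_ext (computable_if hP hQ hR) => s _; case: (P s). Qed.

(** A counter reset on reaching the divisor. With divisor 0 it is never reset, in agreement with n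
    %% 0 = n. *)
Lemma computable_mod k F G : computable k F -> computable k G -> computable k (fun s => F s %% G s).
Proof.
apply: computable2; apply: (@computable_rec 1 (fun=> 0)
  (fun s => if (nth 0 s 1).+1 == nth 0 s 2 then 0 else (nth 0 s 1).+1)).
- exact: computable_const.
- apply: computable_if; [apply: computable_eq | exact: computable_const | apply: computable_S];
    by [apply: computable_S; exact: computable_nth | exact: computable_nth].
- by move=> v _ /=; rewrite mod0n.
- move=> n [|[|d] [|? ?]] //= _.
  rewrite modnS -[n.+1]addn1 /dvdn -modnDml addn1; have := ltn_pmod n (ltn0Sn d).
  rewrite leq_eqVlt => /orP[/eqP -> | h]; first by rewrite modnn !eqxx.
  by rewrite modn_small //= (ltn_eqF h).
Qed.

(** The quotient counts the positive multiples of the divisor met so far; divisor 0 has none, in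
    agreement with n %/ 0 = 0. *)
Lemma computable_div k F G : computable k F -> computable k G -> computable k (fun s => F s %/ G s).
Proof.
apply: computable2; apply: (@computable_rec 1 (fun=> 0)
  (fun s => nth 0 s 1 + ((nth 0 s 0).+1 %% nth 0 s 2 == 0))).
- exact: computable_const.
- apply: computable_add; first exact: computable_nth.
  apply: computable_eq0; apply: computable_mod; last exact: computable_nth.
  by apply: computable_S; exact: computable_nth.
- by move=> v _ /=; rewrite div0n.
- move=> n [|[|d] [|? ?]] //= _.
  by rewrite divnS // addnC.
Qed.

Lemma computable_odd k F : computable k F -> computable k (fun s => odd (F s)).
Proof.
move=> hF; apply: computable_ext (computable_mod hF (computable_const k 2)) => s _; exact: modn2.
Qed.

Ltac computability := repeat (first [assumption | lazymatch goal with
  | |- computable _ (fun _ => ?c) => apply: computable_const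
  | |- computable _ (fun s => nth 0 s _) => exact: computable_nth
  | |- computable _ (fun s => (@?F s).+1) => apply: (@computable_S _ F)
  | |- computable _ (fun s => @?F s + @?G s) => apply: (@computable_add _ F G)
  | |- computable _ (fun s => @?F s * @?G s) => apply: (@computable_mul _ F G)
  | |- computable _ (fun s => @?F s ^ @?G s) => apply: (@computable_exp _ F G)
  | |- computable _ (fun s => (@?F s).-1) => apply: (@computable_pred _ F)
  | |- computable _ (fun s => @?F s - @?G s) => apply: (@computable_sub _ F G)
  | |- computable _ (fun s => @?F s %% @?G s) => apply: (@computable_mod _ F G)
  | |- computable _ (fun s => @?F s %/ @?G s) => apply: (@computable_div _ F G)
  | |- computable _ (fun s => nat_of_bool (@?F s <= @?G s)) => apply: (@computable_leq _ F G)
  | |- computable _ (fun s => nat_of_bool (@?F s == @?G s)) => apply: (@computable_eq _ F G)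
  | |- computable _ (fun s => nat_of_bool (odd (@?F s))) => apply: (@computable_odd _ F)
  | |- computable _ (fun s => nat_of_bool (@?P s && @?Q s)) => apply: (@computable_and _ P Q)
  | |- computable _ (fun s => nat_of_bool (@?P s || @?Q s)) => apply: (@computable_or _ P Q)
  | |- computable _ (fun s => nat_of_bool (~~ (@?P s))) => apply: (@computable_not _ P)
  | |- computable _ (fun s => nat_of_bool _) => apply: computable_ifb
  | |- computable _ (fun s => if _ then _ else _) => apply: computable_if
  end]).

(** * Computing the points of a tile *)

Section Relations.
Context (k : nat).
Implicit Types (E P Q F G : seq nat -> nat).

Lemma computable_minn F G : computable k F -> computable k G -> computable k (fun s => minn (F s) (G s)).
Proof. by move=> *; rewrite /minn; computability. Qed.

Lemma modeokE N m kh kv : modeok N m kh kv =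
  if m == 0 then (kh == 0) && (kv == 0) else if m == 1 then (kh == kv) && (kh < N)
  else if m == 2 then (kh == N) && (kv == N) else if m == 3 then kh == minn kv.+1 N else true.
Proof. by case: m => [|[|[|[|m]]]]. Qed.

Lemma computable_id_tile E P : computable k E -> computable k P -> computable k (fun s => id_tile (E s) (P s)).
Proof. by move=> *; rewrite /id_tile /radix; computability. Qed.
Lemma computable_id_row E P : computable k E -> computable k P -> computable k (fun s => id_row (E s) (P s)).
Proof. by move=> *; rewrite /id_row /radix; computability. Qed.
Lemma computable_id_col E P : computable k E -> computable k P -> computable k (fun s => id_col (E s) (P s)).
Proof. by move=> *; rewrite /id_col /radix; computability. Qed.

Lemma computable_relH E P Q : computable k E -> computable k P -> computable k Q ->
  computable k (fun s => relH (E s) (P s) (Q s)).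
Proof.
move=> hE hP hQ; have d0 := computable_id_tile hE hP; have d0' := computable_id_tile hE hQ.
have d1 := computable_id_row hE hP; have d1' := computable_id_row hE hQ; have d2 := computable_id_col hE hP.
have hm := computable_minn (computable_S d2) (computable_S hE).
have h : computable k (fun s => modeok (E s).+1 (id_tile (E s) (P s) %% 8) (id_row (E s) (P s)) (id_col (E s) (P s))).
  by apply: computable_ext (fun s _ => esym (congr1 nat_of_bool (modeokE _ _ _ _))) _; computability.
by rewrite /relH /bit /pairidx; computability.
Qed.

Lemma computable_relV E P Q : computable k E -> computable k P -> computable k Q ->
  computable k (fun s => relV (E s) (P s) (Q s)).
Proof.
move=> hE hP hQ; have d0 := computable_id_tile hE hP; have d0' := computable_id_tile hE hQ.
have d2 := computable_id_col hE hP; have d2' := computable_id_col hE hQ.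
by rewrite /relV /bit /pairidx; computability.
Qed.

Context (E X Y Z W : seq nat -> nat) (hE : computable k E) (hX : computable k X) (hY : computable k Y)
  (hZ : computable k Z) (hW : computable k W).

Local Notation nn s := (radix (E s) ^ 3).
Local Notation cl K s := (Cell K (X s) (Y s) (Z s) (W s)).

Lemma computable_nn : computable k (fun s => nn s).
Proof. by rewrite /radix; computability. Qed.

Lemma computable_okblock : computable k (fun s => okblock (nn s) (relH (E s)) (relV (E s)) (Z s)).
Proof.
have hn := computable_nn; rewrite /okblock.
have h1 : computable k (fun s => dg1 (nn s) (Z s)) by rewrite /dg1; computability.
have h2 : computable k (fun s => dg2 (nn s) (Z s)) by rewrite /dg2; computability.
have h3 : computable k (fun s => dg3 (nn s) (Z s)) by rewrite /dg3; computability.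
have h4 : computable k (fun s => dg4 (nn s) (Z s)) by rewrite /dg4; computability.
have r1 := computable_relH hE h1 h2; have r2 := computable_relH hE h3 h4.
have r3 := computable_relV hE h1 h3; have r4 := computable_relV hE h2 h4.
by computability.
Qed.

Lemma computable_alpha : computable k (fun s => alpha (nn s) (relH (E s)) (relV (E s)) (X s) (Y s) (Z s)).
Proof.
have hn := computable_nn; have hb := computable_okblock.
by rewrite /alpha /dg1 /dg2 /dg3 /dg4; computability.
Qed.

Lemma computable_memC K : computable k (fun s => memC (nn s) (cl K s)).
Proof.
have hn := computable_nn.
by case: K; rewrite /memC /clsx /clsy /rcls /qcls /height /width /=; computability.
Qed.
End Relations.

Section Cells.
Context (k : nat) (K : kind) (E X Y Z W : seq nat -> nat) (hE : computable k E) (hX : computable k X)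
  (hY : computable k Y) (hZ : computable k Z) (hW : computable k W).

Local Notation nn s := (radix (E s) ^ 3).
Local Notation cl s := (Cell K (X s) (Y s) (Z s) (W s)).

Lemma computable_clsx : computable k (fun s => clsx (cl s)).
Proof. by case: K; rewrite /clsx /=; computability. Qed.

Lemma computable_clsy : computable k (fun s => clsy (cl s)).
Proof. by case: K; rewrite /clsy /=; computability. Qed.

Lemma computable_cp0 : computable k (fun s => cp0 (nn s) (relH (E s)) (relV (E s)) (cl s)).
Proof.
have ha := computable_clsx; have hb := computable_clsy; rewrite /cp0 /=.
have ha' : computable k (fun s => (clsx (cl s) + 1) %% 5) by computability.
have hal := computable_alpha hE ha' hb hZ.
by rewrite /code_cls /holec /rcls /qcls; computability.
Qed.

Lemma computable_cm0 : computable k (fun s => cm0 (cl s)).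
Proof using hX hY hZ hW.
have ha := computable_clsx; have hb := computable_clsy; rewrite /cm0 /=.
by rewrite /code_cls /holec /rcls /qcls; computability.
Qed.

Lemma computable_cp1 : computable k (fun s => cp1 (cl s)).
Proof using hX hY hZ hW.
have ha := computable_clsx; have hb := computable_clsy; rewrite /cp1 /=.
by rewrite /code_cls /holec /rcls /qcls; computability.
Qed.

Lemma computable_cm1 : computable k (fun s => cm1 (cl s)).
Proof using hX hY hZ hW.
have ha := computable_clsx; have hb := computable_clsy; rewrite /cm1 /=.
by rewrite /code_cls /holec /rcls /qcls; computability.
Qed.

Lemma computable_c2 : computable k (fun s => c2 (cl s)).
Proof using hX hY hZ hW.
have ha := computable_clsx; have hb := computable_clsy; rewrite /c2 /=.
by rewrite /code_cls /holec /rcls /qcls; computability.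
Qed.

Lemma computable_c3 : computable k (fun s => c3 (cl s)).
Proof using hX hY hZ hW.
have ha := computable_clsx; have hb := computable_clsy; rewrite /c3 /=.
by rewrite /code_cls /holec /rcls /qcls; computability.
Qed.
End Cells.

Section Membership.
Context (n : nat) (HR VR : rel nat) (K : kind).

Definition ndent (c x a b d : nat) : bool :=
  [&& a == 3, b == 3, d == 3 & x <= 1] || [&& a == 5 + c, b == 5 + c, d == 5 + c & x == 0].

Definition before (i : nat) (s : cell) : cell :=
  match i with
  | 0 => Cell (knd s) (cx s).-1 (cy s) (cz s) (cw s)
  | 1 => Cell (knd s) (cx s) (cy s).-1 (cz s) (cw s)
  | 2 => Cell (knd s) (cx s) (cy s) (cz s).-1 (cw s)
  | _ => Cell (knd s) (cx s) (cy s) (cz s) (cw s).-1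
  end.

(** Membership in natural arithmetic, open to the closure properties of [computable]: 50 is
    [side 42], and each truncated predecessor is guarded by a positivity test. *)
Definition nmem (x y z w : nat) : bool :=
  let s := Cell K (x %/ 50) (y %/ 50) (z %/ 50) (w %/ 50) in
  let x' := x %% 50 in let y' := y %% 50 in let z' := z %% 50 in let w' := w %% 50 in
  let m0 := (0 < cx s) && memC n (before 0 s) in
  let m1 := (0 < cy s) && memC n (before 1 s) in
  let m2 := (0 < cz s) && memC n (before 2 s) in
  let m3 := (0 < cw s) && memC n (before 3 s) in
  if memC n s then
    [&& m0 || ~~ ndent (cm0 s %% 43) x' y' z' w', m1 || ~~ ndent (cm1 s %% 43) y' x' z' w',
        m2 || ~~ ndent (c2 s %% 43) z' x' y' w' & m3 || ~~ ndent (c3 s %% 43) w' x' y' z']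
  else
    [|| m0 && ndent (cp0 n HR VR (before 0 s) %% 43) x' y' z' w',
        m1 && ndent (cp1 (before 1 s) %% 43) y' x' z' w',
        m2 && ndent (c2 (before 2 s) %% 43) z' x' y' w' |
        m3 && ndent (c3 (before 3 s) %% 43) w' x' y' z'].

Lemma forall4 (P : pred 'I_4) : [forall i, P i] = [&& P o0, P o1, P o2 & P o3].
Proof.
apply/forallP/and4P => [h|[h0 h1 h2 h3]]; first by split.
exact: ord4_ind.
Qed.

Lemma exists4 (P : pred 'I_4) : [exists i, P i] = [|| P o0, P o1, P o2 | P o3].
Proof.
by rewrite -[LHS]negbK negb_exists forall4 !negb_and !negbK.
Qed.

Lemma dentE c (i : 'I_4) (o : 'I_4 -> int) (f : nat -> nat) : (forall l, o l = (f l)%:Z) ->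
  dent c i o = match val i with
    | 0 => ndent c (f 0) (f 1) (f 2) (f 3)
    | 1 => ndent c (f 1) (f 0) (f 2) (f 3)
    | 2 => ndent c (f 2) (f 0) (f 1) (f 3)
    | _ => ndent c (f 3) (f 0) (f 1) (f 2)
    end.
Proof.
move=> h; rewrite /dent !forall4 !h /=; move: i; apply: ord4_ind => /=; rewrite !eqz_nat ?andbT -!andbA; by [].
Qed.

Lemma cell_of_vec4 (X Y Z W : int) : cell_of K (vec4 X Y Z W) = Cell K `|X| `|Y| `|Z| `|W|.
Proof. by rewrite /cell_of !mxE. Qed.

Lemma memV_vec4 (X Y Z W : int) : memV n K (vec4 X Y Z W) =
  [&& 0 <= X, 0 <= Y, 0 <= Z & 0 <= W]%R && memC n (Cell K `|X| `|Y| `|Z| `|W|).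
Proof. by rewrite /memV forall4 cell_of_vec4 !mxE. Qed.

Lemma memV_before (X Y Z W : nat) (i : 'I_4) : let s := Cell K X Y Z W in
  let m := (0 < nth 0 [:: X; Y; Z; W] i) && memC n (before i s) in
  memV n K (vec4 X%:Z Y%:Z Z%:Z W%:Z - ee i)%R = m /\
  (m -> cell_of K (vec4 X%:Z Y%:Z Z%:Z W%:Z - ee i)%R = before i s).
Proof.
have e X' Y' Z' W' : [/\ (vec4 X' Y' Z' W' - ee o0 = vec4 (X' - 1) Y' Z' W')%R, (vec4 X' Y' Z' W' - ee o1 = vec4 X' (Y' - 1) Z' W')%R,
   (vec4 X' Y' Z' W' - ee o2 = vec4 X' Y' (Z' - 1) W')%R & (vec4 X' Y' Z' W' - ee o3 = vec4 X' Y' Z' (W' - 1))%R].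
  by split; apply/rowP; apply: ord4_ind; rewrite !mxE /=; lia.
move=> s m; rewrite {}/m {}/s; move: i; apply: ord4_ind; have [e0 e1 e2 e3] := e X%:Z Y%:Z Z%:Z W%:Z; clear e;
  rewrite ?e0 ?e1 ?e2 ?e3 memV_vec4 cell_of_vec4 /=.
- case: X {e0 e1 e2 e3} => [//|X]; rewrite (_ : X.+1%:Z - 1 = X)%R //; lia.
- case: Y {e0 e1 e2 e3} => [|Y]; first by rewrite (_ : (0 <= 0%:Z - 1)%R = false) // ?andbF.
  by rewrite (_ : Y.+1%:Z - 1 = Y)%R //; lia.
- case: Z {e0 e1 e2 e3} => [|Z]; first by rewrite (_ : (0 <= 0%:Z - 1)%R = false) // ?andbF.
  by rewrite (_ : Z.+1%:Z - 1 = Z)%R //; lia.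
- case: W {e0 e1 e2 e3} => [|W]; first by rewrite (_ : (0 <= 0%:Z - 1)%R = false) // ?andbF.
  by rewrite (_ : W.+1%:Z - 1 = W)%R //; lia.
Qed.

Lemma inmacro_nat (x y z w : nat) :
  inmacro (memV n) (cpV n HR VR) cmV 42 K (vec4 x%:Z y%:Z z%:Z w%:Z) = nmem x y z w.
Proof.
rewrite /inmacro; set c : pt := (\row_i _)%R.
pose o (i : 'I_4) : int := modz (vec4 x%:Z y%:Z z%:Z w%:Z 0%R i) (side 42).
have oE l : o l = (nth 0 [:: x; y; z; w] l %% 50)%N%:Z.
  by rewrite /o mxE; move: l; apply: ord4_ind; rewrite /= modz_nat.
have cE : c = vec4 (x %/ 50)%N%:Z (y %/ 50)%N%:Z (z %/ 50)%N%:Z (w %/ 50)%N%:Z.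
  by apply/rowP; apply: ord4_ind; rewrite !mxE /= divz_nat.
have d k i := @dentE k i o (fun l => nth 0 [:: x; y; z; w] l %% 50) oE.
have [] := memV_before (x %/ 50) (y %/ 50) (z %/ 50) (w %/ 50) o0; rewrite /= -cE => m0 c0.
have [] := memV_before (x %/ 50) (y %/ 50) (z %/ 50) (w %/ 50) o1; rewrite /= -cE => m1 c1.
have [] := memV_before (x %/ 50) (y %/ 50) (z %/ 50) (w %/ 50) o2; rewrite /= -cE => m2 c2'.
have [] := memV_before (x %/ 50) (y %/ 50) (z %/ 50) (w %/ 50) o3; rewrite /= -cE => m3 c3'.
have mc : memV n K c = memC n (Cell K (x %/ 50) (y %/ 50) (z %/ 50) (w %/ 50)) by rewrite cE memV_vec4.
have cc : cell_of K c = Cell K (x %/ 50) (y %/ 50) (z %/ 50) (w %/ 50) by rewrite cE cell_of_vec4.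
have congA (a b b' : bool) : (a -> b = b') -> a && b = a && b' by case: a => // ->.
rewrite -/o forall4 exists4 mc /nmem; case: ifP => _.
  by rewrite !d m0 m1 m2 m3 /cmV /= cc.
rewrite m0 m1 m2 m3; congr [|| _, _, _ | _]; apply: congA => h; rewrite d /= /cpV /=.
- by rewrite c0.
- by rewrite c1.
- by rewrite c2'.
- by rewrite c3'.
Qed.

(** A crude bound common to the four coordinates: a sum exceeding the height, the width and the
    planar size, with room for the bumps beyond the last cells. *)
Definition extent : nat := 50 * (n ^ 4 + 2 ^ (n + 3) + 7).

Lemma inmacro_box v : inmacro (memV n) (cpV n HR VR) cmV 42 K v ->
  exists x y z w, v = vec4 x%:Z y%:Z z%:Z w%:Z /\ [/\ x < extent, y < extent, z < extent & w < extent].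
Proof.
pose M := n ^ 4 + 2 ^ (n + 3) + 7.
suff h : inmacro (memV n) (cpV n HR VR) cmV 42 K v -> forall i, (0 <= v ord0 i < (50 * M)%N%:Z)%R.
  move/h => {}h; have hh i : v ord0 i = `|v ord0 i|%N%:Z by have := h i; lia.
  exists `|v ord0 o0|%N, `|v ord0 o1|%N, `|v ord0 o2|%N, `|v ord0 o3|%N; rewrite -!hh vec4K; split => //.
  by rewrite /extent -/M; have := h o0; have := h o1; have := h o2; have := h o3; move: (50 * M) => B; split; lia.
have bound c i : memV n K c -> (0 <= c ord0 i < M%:Z - 1)%R.
  move=> m; have /andP[/forallP h _] := m; rewrite h /=; have := h i.
  have : memC n (Cell K `|c ord0 o0| `|c ord0 o1| `|c ord0 o2| `|c ord0 o3|) by case/andP: m.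
  rewrite /memC /height /width => /and3P[/= a b d].
  have ex : `|c ord0 o0|%N < 5 by clear -d; case: (K) d => /= /and3P[h1 h2 _]; clear -h1; lia.
  have ey : `|c ord0 o1|%N < 5 by clear -d; case: (K) d => /= /and3P[h1 h2 _]; clear -h2; lia.
  by rewrite /M; move: i (n ^ 4) (2 ^ (n + 3)) a b {h m d}; apply: ord4_ind => p q a b; lia.
have far (c : pt) i : (0 <= c ord0 i < M%:Z)%R -> (c ord0 i = v ord0 i %/ 50)%Z -> (0 <= v ord0 i < (50 * M)%N%:Z)%R by lia.
rewrite /inmacro; set c : pt := (\row_i _)%R.
have cE i : c ord0 i = (v ord0 i %/ 50)%Z by rewrite mxE.
case: ifP => [m _ i|_ /existsP[j /andP[m _]] i]; apply: far (cE i).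
  by have := bound _ i m; lia.
have := bound _ i m; rewrite !mxE; case: (i == j) => /=; lia.
Qed.
End Membership.

Section MembershipComputable.
Context (k : nat) (K : kind) (E X Y Z W : seq nat -> nat) (hE : computable k E) (hX : computable k X)
  (hY : computable k Y) (hZ : computable k Z) (hW : computable k W).

Lemma computable_nmem : computable k (fun s =>
  nmem (radix (E s) ^ 3) (relH (E s)) (relV (E s)) K (X s) (Y s) (Z s) (W s)).
Proof.
have hx : computable k (fun s => X s %/ 50) by computability.
have hy : computable k (fun s => Y s %/ 50) by computability.
have hz : computable k (fun s => Z s %/ 50) by computability.
have hw : computable k (fun s => W s %/ 50) by computability.
have px := computable_pred hx; have py := computable_pred hy; have pz := computable_pred hz; have pw := computable_pred hw.
rewrite /nmem /before /=.
have m := computable_memC hE hx hy hz hw K.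
have m0 := computable_memC hE px hy hz hw K.
have m1 := computable_memC hE hx py hz hw K.
have m2 := computable_memC hE hx hy pz hw K.
have m3 := computable_memC hE hx hy hz pw K.
have a0 := computable_cm0 K hx hy hz hw; have a1 := computable_cm1 K hx hy hz hw.
have a2 := computable_c2 K hx hy hz hw; have a3 := computable_c3 K hx hy hz hw.
have b0 := computable_cp0 K hE px hy hz hw; have b1 := computable_cp1 K hx py hz hw.
have b2 := computable_c2 K hx hy pz hw; have b3 := computable_c3 K hx hy hz pw.
by rewrite /ndent; computability.
Qed.
End MembershipComputable.

(** * Undecidability *)

Section Listing.
Context (n : nat) (HR VR : rel nat) (K : kind).

Local Notation B := (extent n).

Definition digit (m i : nat) : nat := m %/ B ^ i %% B.
Definition point (m : nat) : pt := vec4 (digit m 3)%:Z (digit m 2)%:Z (digit m 1)%:Z (digit m 0)%:Z.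
Definition listed (m : nat) : bool := nmem n HR VR K (digit m 3) (digit m 2) (digit m 1) (digit m 0).

(** Candidates are numbers whose digits in base [extent] are coordinates. Adding the newest point in
    front matches [CodeSeq.code], which sends x :: s to 2 ^ x * (2 * c + 1) with c the code of s, so
    the code of the list is given by primitive recursion. *)
Fixpoint points (m : nat) : seq pt :=
  if m is m'.+1 then if listed m' then point m' :: points m' else points m' else [::].

Definition tile : {fset pt} := [fset v in points (B ^ 4)].

Lemma pointsP m v : reflect (exists i, [/\ i < m, listed i & v = point i]) (v \in points m).
Proof.
elim: m => [|m IH] /=; first by rewrite in_nil; constructor => -[i []].
case: ifP => hm; last first.
  apply: (iffP IH) => -[i [h1 h2 h3]]; exists i; split => //; first by rewrite ltnS ltnW.
  by move: h1; rewrite ltnS leq_eqVlt => /orP[/eqP e|//]; rewrite -e h2 in hm.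
rewrite in_cons; apply: (iffP orP) => [[/eqP ->|/IH[i [h1 h2 h3]]]|[i [h1 h2 h3]]].
- by exists m.
- by exists i; split => //; rewrite ltnS ltnW.
- by move: h1; rewrite ltnS leq_eqVlt => /orP[/eqP e|h1]; [left; rewrite h3 e | right; apply/IH; exists i].
Qed.

Lemma extent_gt0 : 0 < B. Proof. by rewrite /extent; lia. Qed.

Lemma digits_sum m : m < B ^ 4 -> m = ((digit m 3 * B + digit m 2) * B + digit m 1) * B + digit m 0.
Proof.
move=> h; have B0 := extent_gt0.
have h3 : m %/ B ^ 3 < B by rewrite ltn_divLR ?expn_gt0 ?B0 // -expnS.
have e i : m %/ B ^ i = m %/ B ^ i.+1 * B + digit m i by rewrite /digit expnSr divnMA -divn_eq.
have e3 : m %/ B ^ 3 = digit m 3 by rewrite /digit modn_small.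
by rewrite -e3 -e -e -e divn1.
Qed.

Lemma point_inj m m' : m < B ^ 4 -> m' < B ^ 4 -> point m = point m' -> m = m'.
Proof.
move=> h h' e; rewrite (digits_sum h) (digits_sum h').
have c i : point m ord0 i = point m' ord0 i by rewrite e.
have := c o0; have := c o1; have := c o2; have := c o3; rewrite !mxE /= => -[->] [->] [->] [->].
by [].
Qed.

Lemma points_uniq m : m <= B ^ 4 -> uniq (points m).
Proof.
elim: m => //= m IH h; have hm := IH (ltnW h); case: ifP => //= l; rewrite hm andbT.
apply/negP => /pointsP[i [h1 _ e]]; move: (h1).
by rewrite -(point_inj h (ltn_trans h1 h) e) ltnn.
Qed.

Lemma tileE v : v \in tile = inmacro (memV n) (cpV n HR VR) cmV 42 K v.
Proof.
rewrite in_fset; apply/pointsP/idP => [[i [_ h ->]]|h]; first by rewrite /point inmacro_nat.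
have [x [y [z [w [e [hx hy hz hw]]]]]] := inmacro_box h; have B0 := extent_gt0.
pose m := ((x * B + y) * B + z) * B + w.
have e0 : digit m 0 = w by rewrite /digit divn1 /m modnMDl modn_small.
have q1 : m %/ B = (x * B + y) * B + z by rewrite /m divnMDl // divn_small // addn0.
have e1 : digit m 1 = z by rewrite /digit expn1 q1 modnMDl modn_small.
have q2 : m %/ B ^ 2 = x * B + y by rewrite expnS expn1 divnMA q1 divnMDl // divn_small // addn0.
have e2 : digit m 2 = y by rewrite /digit q2 modnMDl modn_small.
have q3 : m %/ B ^ 3 = x by rewrite expnSr divnMA q2 divnMDl // divn_small // addn0.
have e3 : digit m 3 = x by rewrite /digit q3 modn_small.
exists m; split; last by rewrite /point e0 e1 e2 e3.
- by rewrite expnS -ltn_divLR ?expn_gt0 ?B0 // q3.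
- by rewrite /listed e0 e1 e2 e3 -inmacro_nat -e.
Qed.

Definition tile_code (m : nat) : nat := CodeSeq.code [seq code_point v | v <- points m].

Lemma code_vec4 (x y z w : nat) : code_point (vec4 x%:Z y%:Z z%:Z w%:Z) =
  2 ^ (2 * x) * (2 * (2 ^ (2 * y) * (2 * (2 ^ (2 * z) * (2 * 2 ^ (2 * w)).+1)).+1)).+1.
Proof.
have eI : enum 'I_4 = [:: o0; o1; o2; o3] by apply: (inj_map val_inj); rewrite val_enum_ord.
by rewrite /code_point eI /= !mxE /= !mul2n muln1.
Qed.

Lemma tile_codeS m : tile_code m.+1 =
  if listed m then 2 ^ code_point (point m) * (2 * tile_code m).+1 else tile_code m.
Proof. by rewrite /tile_code /=; case: ifP => //= _; rewrite mul2n. Qed.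
End Listing.

Section ListingComputable.
Context (k : nat) (E M : seq nat -> nat) (hE : computable k E) (hM : computable k M).

Local Notation nn s := (radix (E s) ^ 3).

Lemma computable_extent : computable k (fun s => extent (nn s)).
Proof. have h := computable_nn hE; by rewrite /extent; computability. Qed.

Lemma computable_digit i : computable k (fun s => digit (nn s) (M s) i).
Proof. have h := computable_extent; by rewrite /digit; computability. Qed.

Lemma computable_listed K : computable k (fun s => listed (nn s) (relH (E s)) (relV (E s)) K (M s)).
Proof.
exact: (computable_nmem K hE (computable_digit 3) (computable_digit 2) (computable_digit 1) (computable_digit 0)).
Qed.

Lemma computable_point : computable k (fun s => code_point (point (nn s) (M s))).
Proof.
apply: computable_ext (fun s _ => esym (code_vec4 _ _ _ _)) _.
have d0 := computable_digit 0; have d1 := computable_digit 1; have d2 := computable_digit 2; have d3 := computable_digit 3.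
by computability.
Qed.
End ListingComputable.

Lemma computable_tile_code K : computable 2 (fun s =>
  tile_code (radix (nth 0 s 1) ^ 3) (relH (nth 0 s 1)) (relV (nth 0 s 1)) K (nth 0 s 0)).
Proof.
pose n (s : seq nat) := radix (nth 0 s 2) ^ 3.
have h0 : computable 3 (fun s => nth 0 s 0) by exact: computable_nth.
have h2 : computable 3 (fun s => nth 0 s 2) by exact: computable_nth.
apply: (@computable_rec 1 (fun=> 0) (fun s =>
  if listed (n s) (relH (nth 0 s 2)) (relV (nth 0 s 2)) K (nth 0 s 0)
  then 2 ^ code_point (point (n s) (nth 0 s 0)) * (2 * nth 0 s 1).+1 else nth 0 s 1)) => //.
- exact: computable_const.
- have h := computable_listed h2 h0 K; have h' := computable_point h2 h0; by computability.
- by move=> m v _; exact: tile_codeS.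
Qed.

Lemma code_listing3 (a b c : seq pt) : code_listing [:: a; b; c] =
  let code t := CodeSeq.code [seq code_point v | v <- t] in
  2 ^ code a * (2 * (2 ^ code b * (2 * 2 ^ code c).+1)).+1.
Proof. by rewrite /code_listing /= !mul2n muln1. Qed.

Lemma mem_fset3 (T : choiceType) (a b c x : T) : (x \in [fset a; b; c]) = (x \in [:: a; b; c]).
Proof. by rewrite !inE -orbA. Qed.

Lemma card_fset3 (T : choiceType) (a b c : T) : [/\ a != b, a != c & b != c] -> #|` [fset a; b; c]| = 3.
Proof.
move=> [ab ac bc]; rewrite (_ : [fset a; b; c] = a |` (b |` [fset c])); last first.
  by apply/fsetP => x; rewrite !inE -orbA.
by rewrite !cardfsU1 !inE cardfs1 negb_or ab ac bc.
Qed.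

Definition three_tiles (e : nat) : seq (seq pt) :=
  let n := radix e ^ 3 in [seq points n (relH e) (relV e) K (extent n ^ 4) | K <- [:: KA; KT; KF]].

Lemma computable_listing : computable 1 (fun s => code_listing (three_tiles (nth 0 s 0))).
Proof.
have hE : computable 1 (fun s => nth 0 s 0) by exact: computable_nth.
have hx := computable_extent hE.
pose c K (s : seq nat) := let e := nth 0 s 0 in let n := radix e ^ 3 in tile_code n (relH e) (relV e) K (extent n ^ 4).
have hc K : computable 1 (c K).
  by apply: (@computable2 (fun m e => tile_code (radix e ^ 3) (relH e) (relV e) K m));
    [exact: computable_tile_code | computability | exact: hE].
have hA := hc KA; have hT := hc KT; have hF := hc KF.
apply: (@computable_ext _ (fun s => 2 ^ c KA s * (2 * (2 ^ c KT s * (2 * (2 ^ c KF s)).+1)).+1)).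
  by move=> s _; exact: esym (code_listing3 _ _ _).
by computability.
Qed.

Theorem theorem1 :
  ~ recursively_decidable
      (fun S : {fset {fset 'rV[int]_4}} =>
         #|` S| = 3%N /\ forall P : {fset 'rV[int]_4}, P \in S -> polyhypercube P)
      (fun S => code_tileset S)
      (fun S => tileable S).
Proof.
move=> [f fP]; have [G GP] := computable_listing.
(* The fixed point: the machine computes the listing from its input and asks [f], and e encodes the
   Wang tiles of this very machine. *)
have [e eP] := sft_machine (decider (Comp f [:: G])).
pose n := radix e ^ 3; have n0 : 0 < n by rewrite expn_gt0 /radix addn2.
pose t K := tile n (relH e) (relV e) K.
have tE K v : (v \in t K) = inmacro (memV n) (cpV n (relH e) (relV e)) cmV 42 K v by exact: tileE.
have ne := mac_neq n0 tE.
pose S := [fset t KA; t KT; t KF]%fset.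
have SE P : P \in S <-> exists K, P = t K.
  rewrite mem_fset3 (_ : [:: _; _; _] = map t [:: KA; KT; KF]) //.
  split => [|[K ->]]; last by case: K; rewrite /= !in_cons eqxx ?orbT.
  by rewrite /= !in_cons in_nil orbF => /or3P[] /eqP ->; [exists KA | exists KT | exists KF].
have code : code_tileset S (code_listing (three_tiles e)).
  exists (three_tiles e); split => //; split.
  - by rewrite /= !points_uniq.
  - have [ne1 ne2 ne3] := ne; rewrite (_ : map _ _ = [:: t KA; t KT; t KF]) //.
    by rewrite !cons_uniq !in_cons !in_nil !orbF negb_or ne1 ne2 ne3.
  - by move=> P; rewrite mem_fset3.
have [|b [ev bP]] := fP S (code_listing (three_tiles e)) _ code.
  by split; [exact: card_fset3 | move=> P /SE[K ->]; exact: (mac_poly n0 tE)].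
have ev' : eval (Comp f [:: G]) [:: e] b.
  by apply: eval_Comp ev; apply: evals_cons (evals_nil _); exact: (GP [:: e]).
have hH a : ~~ relH e a a by rewrite relH_irr.
have hV a : ~~ relV e a a by rewrite relV_irr.
have [d1 d2] := decider_ok ev'; have [s1 s2] := tileable_sft n0 tE SE hH hV.
case: eP => e1 e2; case: bP => b1 b2.
have bF : b = false by case: b {ev ev'} d1 d2 b1 b2 => // d1 _ b1 _; exact: d1 (e1 (s1 (b1 isT))).
by have := b2 (s2 (e2 (d2 bF))); rewrite bF.
Qed.
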